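(* Let $r\geq 3$ be an integer and let $B(r,3)$ be the Burnside group of exponent $3$ and rank $r$. Then there is a homotopy equivalence \[ \mathscr{C}(\mathcal{N}_3,B(r,3))\simeq \bigvee^{m(r)} S^2 , \] where $m(r)=3^{r-3}(9^r-13\cdot 3^r+39)-1$.
   Context: $B(r,3):=F_r/(F_r)^3$, where $F_r$ is the free group on $r$ generators and $(F_r)^3$ is the subgroup generated by all cubes. For a group $G$ and a family $\mathcal{F}$ of subgroups of $G$, the coset poset $\mathscr{C}(\mathcal{F},G)$ is the set of left cosets $\{gH\mid g\in G,\ H\in\mathcal{F}\}$ partially ordered by inclusion; the same symbol denotes the geometric realization of its order complex (the simplicial complex whose $n$-simplices are the strictly increasing chains of $n+1$ cosets). $\mathcal{N}_{3}$ denotes the family of all subgroups of $G$ that are nilpotent of class at most $2$. $\bigvee^m X$ denotes the wedge of $m$ copies of $X$. *)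

(* Defs.v *)
From HB Require Import structures.
From mathcomp Require Import all_boot all_order all_algebra.
From mathcomp Require Import generic_quotient finmap.
From mathcomp Require Import all_classical all_reals all_analysis homotopy.

Set Implicit Arguments.
Unset Strict Implicit.
Unset Printing Implicit Defensive.

Import Order.TTheory GRing.Theory Num.Theory.
Import numFieldNormedType.Exports.

Local Open Scope classical_set_scope.
Local Open Scope quotient_scope.

Section Subgroups.
Context {G : groupType}.
Local Open Scope group_scope.
Implicit Types (A B S H : set G) (g x y : G).

Definition subgroup A : Prop :=
  [/\ A 1, (forall x y, A x -> A y -> A (x * y)) &
      (forall x, A x -> A x^-1)].

Definition generated S : set G := smallest subgroup S.

Definition lcoset g H : set G := [set g * h | h in H].

Definition commutator_subgroup A B : set G :=
  generated [set [~ p.1, p.2] | p in A `*` B].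

(* With the indexing gamma_1(H) = H and gamma_{i+1}(H) = [gamma_i(H), H], this
   is gamma_{n+1}(H), so that H has class at most c iff lower_central H c is
   trivial. *)
Fixpoint lower_central H (n : nat) : set G :=
  if n is m.+1 then commutator_subgroup (lower_central H m) H else H.

Lemma generated_subgroup S : subgroup (generated S).
Proof.
split=> [A [[]]//|x y Sx Sy A AS|x Sx A AS].
- by have [[_ AM _] _] := AS; apply: AM; [exact: Sx|exact: Sy].
- by have [[_ _ AV] _] := AS; apply: AV; exact: Sx.
Qed.

End Subgroups.

Definition power_subgroup (G : groupType) (n : nat) : set G :=
  generated [set (x ^+ n)%g | x in [set: G]].
Arguments power_subgroup : clear implicits.

(* The family N_{c+1} of subgroups that are nilpotent of class at most c. *)
Definition nilpotent_subgroups (G : groupType) (c : nat) : set (set G) :=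
  [set H | subgroup H /\ lower_central H c = [set 1%g]].
Arguments nilpotent_subgroups : clear implicits.

Record normal_subgroup (G : groupType) := NormalSubgroup {
  normal_carrier :> set G;
  normal_is_subgroup : subgroup normal_carrier;
  normal_conj : forall x g : G, normal_carrier x -> normal_carrier (x ^ g)%g }.

Section QuotientGroup.
Context (G : groupType) (N : normal_subgroup G).
Local Open Scope group_scope.
Implicit Types x y z : G.

Definition quotient_rel : rel G := fun x y => `[< normal_carrier N (x^-1 * y) >].

Lemma quotient_rel_refl : reflexive quotient_rel.
Proof.
by move=> x; apply/asboolP; rewrite mulVg; case: (normal_is_subgroup N).
Qed.

Lemma quotient_rel_sym : symmetric quotient_rel.
Proof.
suff sub x y : quotient_rel x y -> quotient_rel y x.
  by move=> x y; apply/idP/idP; exact: sub.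
move=> /asboolP Nxy; apply/asboolP; case: (normal_is_subgroup N) => _ _ NV.
by have := NV _ Nxy; rewrite invgM invgK.
Qed.

Lemma quotient_rel_trans : transitive quotient_rel.
Proof.
move=> y x z /asboolP Nxy /asboolP Nyz; apply/asboolP.
case: (normal_is_subgroup N) => _ NM _.
by have := NM _ _ Nxy Nyz; rewrite mulgA mulgK.
Qed.

Canonical quotient_equiv :=
  EquivRel quotient_rel quotient_rel_refl quotient_rel_sym quotient_rel_trans.

Definition quotient_group := {eq_quot quotient_equiv}.
HB.instance Definition _ := Choice.on quotient_group.
HB.instance Definition _ := EqQuotient.on quotient_group.

Definition quotient_proj (x : G) : quotient_group := \pi x.

Lemma quotient_projP x y :
  quotient_proj x = quotient_proj y <-> normal_carrier N (x^-1 * y).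
Proof. by split=> [/eqmodP/asboolP|?]; last exact/eqmodP/asboolP. Qed.

Lemma quotient_repr (a : quotient_group) : quotient_proj (repr a) = a.
Proof. exact: reprK. Qed.

Definition quotient_mul (a b : quotient_group) := quotient_proj (repr a * repr b).
Definition quotient_inv (a : quotient_group) := quotient_proj (repr a)^-1.

Lemma quotient_mulE x y :
  quotient_mul (quotient_proj x) (quotient_proj y) = quotient_proj (x * y).
Proof.
apply/quotient_projP.
have [_ NM _] := normal_is_subgroup N.
set x' := repr _; set y' := repr _.
have /quotient_projP xx : quotient_proj x' = quotient_proj x.
  exact: quotient_repr.
have /quotient_projP yy : quotient_proj y' = quotient_proj y.
  exact: quotient_repr.
have := NM _ _ (normal_conj y' xx) yy.
by rewrite /conjg invgM !mulgA mulgK.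
Qed.

Lemma quotient_invE x : quotient_inv (quotient_proj x) = quotient_proj x^-1.
Proof.
apply/quotient_projP; rewrite invgK.
have [_ _ NV] := normal_is_subgroup N.
set x' := repr _.
have /quotient_projP xx : quotient_proj x = quotient_proj x'.
  exact/esym/quotient_repr.
by have := normal_conj x^-1 xx; rewrite /conjg invgK !mulgA mulgV mul1g.
Qed.

Lemma quotient_mulA : associative quotient_mul.
Proof.
move=> a b c; rewrite -(quotient_repr a) -(quotient_repr b) -(quotient_repr c).
by rewrite !quotient_mulE mulgA.
Qed.

Lemma quotient_mul1 : left_id (quotient_proj 1) quotient_mul.
Proof. by move=> a; rewrite -(quotient_repr a) quotient_mulE mul1g. Qed.

Lemma quotient_mulr1 : right_id (quotient_proj 1) quotient_mul.
Proof. by move=> a; rewrite -(quotient_repr a) quotient_mulE mulg1. Qed.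

Lemma quotient_mulV : left_inverse (quotient_proj 1) quotient_inv quotient_mul.
Proof.
by move=> a; rewrite -(quotient_repr a) quotient_invE quotient_mulE mulVg.
Qed.

Lemma quotient_mulrV : right_inverse (quotient_proj 1) quotient_inv quotient_mul.
Proof.
by move=> a; rewrite -(quotient_repr a) quotient_invE quotient_mulE mulgV.
Qed.

HB.instance Definition _ := isGroup.Build quotient_group
  quotient_mulA quotient_mul1 quotient_mulr1 quotient_mulV quotient_mulrV.

End QuotientGroup.

(* The free group on I as the set of reduced words; the letter (i, b) stands
   for the generator i if b is false and for its inverse if b is true. *)
Section FreeGroup.
Context (I : choiceType).
Implicit Types (x y : I * bool) (u v w : seq (I * bool)).

Definition letter_inv x : I * bool := (x.1, ~~ x.2).

Definition reduced : pred (seq (I * bool)) :=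
  sorted (fun x y => y != letter_inv x).

Definition push x w :=
  if w is y :: w' then if y == letter_inv x then w' else x :: w else [:: x].

Lemma letter_invK : involutive letter_inv.
Proof. by case=> i b; rewrite /letter_inv negbK. Qed.

Lemma push_reduced x w : reduced w -> reduced (push x w).
Proof.
case: w => [//|y w] rw; rewrite /push; case: ifPn => [_|yx].
  exact: path_sorted rw.
by rewrite /reduced /= yx.
Qed.

Lemma pushK x w : reduced w -> push (letter_inv x) (push x w) = w.
Proof.
case: w => [_|y w rw] /=; first by rewrite letter_invK eqxx.
case: eqVneq => [yx|_] /=; last by rewrite letter_invK eqxx.
case: w rw => [|z w] /=; first by rewrite yx.
by rewrite -yx => /andP[/negPf -> _].
Qed.

Lemma push_cons x w : reduced (x :: w) -> push x w = x :: w.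
Proof. by case: w => [//|y w] /= /andP[/negPf -> _]. Qed.

Lemma foldr_push_reduced u v : reduced v -> reduced (foldr push v u).
Proof. by move=> rv; elim: u => //= x u; exact: push_reduced. Qed.

Lemma foldr_push_push x u v : reduced u -> reduced v ->
  foldr push v (push x u) = push x (foldr push v u).
Proof.
move=> ru rv; case: u ru => [//|y u] ru /=.
case: eqP => [->|//] /=; have := @pushK (letter_inv x) (foldr push v u).
by rewrite letter_invK => ->//; exact: foldr_push_reduced.
Qed.

Lemma foldr_pushA u v w : reduced u -> reduced v -> reduced w ->
  foldr push (foldr push w v) u = foldr push w (foldr push v u).
Proof.
move=> ru rv rw; elim: u ru => //= x u IH ru.
rewrite foldr_push_push ?IH//; first exact: path_sorted ru.
exact: foldr_push_reduced.
Qed.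

Lemma foldr_push_nil u : reduced u -> foldr push [::] u = u.
Proof.
elim: u => // x u IH rxu; rewrite /= IH; first exact: push_cons.
exact: path_sorted rxu.
Qed.

Record free_group := FreeGroup { word : seq (I * bool); _ : reduced word }.
HB.instance Definition _ := [isSub for word].
HB.instance Definition _ := [Choice of free_group by <:].

Lemma wordP (a : free_group) : reduced (word a).
Proof. exact: valP. Qed.

Definition free_one := @FreeGroup [::] isT.
Definition free_mul (a b : free_group) :=
  FreeGroup (foldr_push_reduced (word a) (wordP b)).

Lemma rev_inv_reduced u : reduced u -> reduced (rev (map letter_inv u)).
Proof.
rewrite /reduced rev_sorted sorted_map; apply: sub_sorted => x y /=.
by apply: contraNN => /eqP ->; rewrite letter_invK.
Qed.

Definition free_inv (a : free_group) := FreeGroup (rev_inv_reduced (wordP a)).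

Lemma free_mulA : associative free_mul.
Proof. by move=> a b c; apply/val_inj; apply: foldr_pushA; exact: wordP. Qed.

Lemma free_mul1 : left_id free_one free_mul.
Proof. by move=> a; exact/val_inj. Qed.

Lemma free_mulr1 : right_id free_one free_mul.
Proof. by move=> a; apply/val_inj; exact/foldr_push_nil/wordP. Qed.

Lemma foldr_push_revK u w :
  reduced w -> foldr push (foldr push w u) (rev (map letter_inv u)) = w.
Proof.
elim: u w => //= x u IH w rw.
rewrite rev_cons foldr_rcons pushK ?IH//; exact: foldr_push_reduced.
Qed.

Lemma free_mulV : left_inverse free_one free_inv free_mul.
Proof.
move=> a; apply/val_inj => /=.
by rewrite -{1}(foldr_push_nil (wordP a)) foldr_push_revK.
Qed.

Lemma free_mulrV : right_inverse free_one free_inv free_mul.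
Proof.
move=> a; have inv2 : free_inv (free_inv a) = a.
  apply/val_inj; rewrite /= map_rev revK -map_comp.
  by rewrite (eq_map (g := id)) ?map_id//; exact: letter_invK.
by rewrite -{1}inv2 free_mulV.
Qed.

HB.instance Definition _ := isGroup.Build free_group
  free_mulA free_mul1 free_mulr1 free_mulV free_mulrV.

End FreeGroup.

Section Burnside.
Local Open Scope group_scope.

Lemma power_subgroup_conj (G : groupType) (n : nat) (x g : G) :
  power_subgroup G n x -> power_subgroup G n (x ^ g).
Proof.
have [P1 PM PV] := generated_subgroup [set (x ^+ n)%g | x in [set: G]].
apply: (@smallest_sub _ _ _ [set y | power_subgroup G n (y ^ g)]).
  split=> /= [|y z Py Pz|y Py]; first by rewrite conj1g.
  - by rewrite conjMg; exact: PM.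
  - by rewrite conjVg; exact: PV.
move=> _ [y _ <-] /=; rewrite conjXg.
by apply: sub_gen_smallest; exists (y ^ g).
Qed.

Definition power_normal (G : groupType) (n : nat) : normal_subgroup G :=
  NormalSubgroup (generated_subgroup _) (@power_subgroup_conj G n).

Definition burnside (r n : nat) : groupType :=
  quotient_group (power_normal (free_group 'I_r) n).

End Burnside.

Section CosetPoset.
Context (G : groupType) (F : set (set G)).

Definition is_coset_of : set (set G) :=
  [set C | exists g H, F H /\ C = lcoset g H].

Definition coset_poset := set_type is_coset_of.
HB.instance Definition _ := SubChoice.on coset_poset.
HB.instance Definition _ :=
  [SubChoice_isSubPOrder of coset_poset by <: with set_display].

End CosetPoset.

Definition order_complex (d : Order.disp_t) (P : porderType d) :
    set {fset P} :=
  [set s | s != fset0 /\ {in s &, forall x y, (x >=< y)%O}].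
Arguments order_complex {d} P.

Section GeometricRealization.
Local Open Scope ring_scope.
Context (R : realType) (V : choiceType) (K : set {fset V}).

Definition closed_simplex (s : {fset V}) : set (V -> R) :=
  [set t | [/\ forall v, 0 <= t v, forall v, v \notin s -> t v = 0 &
               \sum_(v <- s) t v = 1]].

Record realization := Realization {
  barycentric :> V -> R;
  realizationP : exists2 s, K s & closed_simplex s barycentric }.

HB.instance Definition _ := gen_eqMixin realization.
HB.instance Definition _ := gen_choiceMixin realization.

(* The weak topology: a set is open iff its trace on every closed simplex is
   open. On a closed simplex all but finitely many coordinates vanish, so the
   topology induced by pointwise convergence is the Euclidean one. *)
Definition realization_open : set_system realization :=
  [set U | forall s, K s -> exists2 W : set {ptws V -> R}, open W &
     forall x : realization, closed_simplex s x -> U x <-> W x].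

Lemma realization_openT : realization_open setT.
Proof. by move=> s Ks; exists setT => //; exact: openT. Qed.

Lemma realization_openI : setI_closed realization_open.
Proof.
move=> A B oA oB s Ks.
have [OA oOA AE] := oA s Ks; have [OB oOB BE] := oB s Ks.
exists (OA `&` OB); first exact: openI.
by move=> x sx; split=> -[/(AE x sx) ? /(BE x sx)].
Qed.

Lemma realization_open_bigU (I : Type) (f : I -> set realization) :
  (forall i, realization_open (f i)) -> realization_open (\bigcup_i f i).
Proof.
move=> of_ s Ks.
have /choice[W WP] : forall i, exists W : set {ptws V -> R}, open W /\
    forall x : realization, closed_simplex s x -> f i x <-> W x.
  by move=> i; have [W ? ?] := of_ i s Ks; exists W.
exists (\bigcup_i W i); first by apply: bigcup_open => i _; case: (WP i).
by move=> x sx; split=> -[i _ ix]; exists i => //; apply/((WP i).2 x sx).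
Qed.

HB.instance Definition _ := isOpenTopological.Build realization
  realization_openT realization_openI realization_open_bigU.

End GeometricRealization.

Section Homotopy.
Local Open Scope ring_scope.
Context (R : realType).

Definition homotopic (X Y : topologicalType) (f g : X -> Y) : Prop :=
  exists H : X * R -> Y,
    [/\ {within [set: X] `*` `[0, 1]%classic, continuous H},
        forall x, H (x, 0) = f x & forall x, H (x, 1) = g x].

Definition homotopy_equivalent (X Y : topologicalType) : Prop :=
  exists (f : X -> Y) (g : Y -> X),
    [/\ continuous f, continuous g, homotopic (g \o f) id &
        homotopic (f \o g) id].

Definition unit_sphere (n : nat) : set 'rV[R]_n.+1 :=
  [set x | \sum_i x ord0 i ^+ 2 = 1].
Arguments unit_sphere : clear implicits.

Definition sphere (n : nat) : topologicalType := set_type (unit_sphere n).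

Lemma sphere_base_subproof n : delta_mx ord0 ord0 \in unit_sphere n.
Proof.
rewrite inE /unit_sphere /= (bigD1 ord0)//= big1 ?mxE ?eqxx ?addr0 ?expr1n//.
by move=> i /negPf i0; rewrite mxE i0 andbF expr0n.
Qed.

Definition sphere_base n : sphere n := SigSub (sphere_base_subproof n).

(* For m = 0 the library's wedge is empty rather than a point. *)
Definition wedge_copies (m : nat) (X : topologicalType) (x0 : X) :
    topologicalType :=
  wedge (fun _ : 'I_m => x0).

End Homotopy.

(* No subtraction is truncated when r >= 3, since then 13 * 3 ^ r <= 9 ^ r. *)
Definition num_spheres (r : nat) : nat :=
  (3 ^ (r - 3) * (9 ^ r - 13 * 3 ^ r + 39) - 1)%N.

(* Main.v *)
Require Import Defs.
From HB Require Import structures.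
From mathcomp Require Import all_boot all_order all_algebra finmap.
From mathcomp Require Import ring zify.

(* In a group of exponent 3 the commutator [x, y, z] is trilinear and
   alternating and factors through the abelianization.  A subgroup of B(r,3) is
   therefore nilpotent of class at most 2 iff its image in F_3^r has dimension
   at most 2 (a nonzero commutator being detected in B(3,3), realized by
   matrices), so that saturating cosets under the kernel of the abelianization
   deforms the coset poset onto the poset of affine points, lines and planes of
   F_3^r.

   Let p(F) be a chosen point of each flat F.  Call a flag q < l < P critical
   if the plane P misses 0, the line l misses p(P) and q <> p(l).  An acyclic
   matching collapses the complex of the other chains to the vertex {0}: below
   a plane through 0 one joins with 0, below a plane P missing 0 with p(P), and
   below a line of P missing p(P) with p(l).  Crushing the resulting
   contractible subcomplex leaves one 2-sphere for each critical flag, and the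
   critical flags number (3^r - 1)(3^r - 3)(3^r - 9) / 27. *)

Set Implicit Arguments.
Unset Strict Implicit.
Unset Printing Implicit Defensive.

Import Order.TTheory GRing.Theory Num.Theory.

(** All homotopies are explicit maps on barycentric coordinates; neither homology nor homotopy
    extension is invoked. The price is that deforming a subcomplex means deforming the whole
    realization without leaving the complex, although a face that is free in the subcomplex need not
    be free in the whole complex. The homotopy inverse of the crushing map is then an arbitrary
    set-theoretic lift followed by the collapse at time 1: since this sends the whole crushed
    subcomplex to one point, the choice of lift is invisible. Continuity rests on the finiteness of
    B(r,3). With finitely many vertices, continuity into the realization can be tested coordinate by
    coordinate, subcomplexes are compact, and maps out of the wedge can be tested before crushing.
    Finiteness and the properties of [x, y, z] have the same source: in exponent 3 the normal
    closure of a single element is abelian. *)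

Section ExponentThree.

(** * Commutator calculus in groups of exponent 3 *)

Context (G : groupType).
Local Open Scope group_scope.
Hypothesis exp3 : forall x : G, x ^+ 3 = 1.
Implicit Types x y z u v g h : G.

Lemma exp3_sqr x : x * x = x^-1.
Proof. by apply: (mulgI x); rewrite mulgV -[RHS](exp3 x) expgSS expg2. Qed.

Lemma exp3_conj_prod x y : x * x ^ y * x ^ y^-1 = 1.
Proof.
rewrite -[RHS](exp3 (x * y^-1)) expgSS expg2 !conjgE invgK !mulgA.
by rewrite -(mulgA _ y y) exp3_sqr.
Qed.

(* Expanding [(x y^-1)^3 = 1] and [(x y)^3 = 1] into conjugates of [x]. *)
Lemma exp3_conj_commute x y : commute x (x ^ y).
Proof.
have c1 g : commute (x ^ g) (x ^ g^-1).
  have h1 := exp3_conj_prod x g; have := exp3_conj_prod x g^-1; rewrite invgK.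
  by move=> h2; rewrite /commute; apply: (mulgI x); rewrite !(mulgA x (x ^ _)) h1 h2.
have := congr1 (fun g => g ^ y^-1) (c1 y^-1) => /=.
rewrite (conjMg (x ^ _)) (conjMg (x ^ _)) invgK conjgK -conjgM exp3_sqr invgK.
exact: commute_sym.
Qed.

Inductive normal_closure x : G -> Prop :=
| NormalClosure1 : normal_closure x 1
| NormalClosureJ g : normal_closure x (x ^ g)
| NormalClosureM a b :
    normal_closure x a -> normal_closure x b -> normal_closure x (a * b)
| NormalClosureV a : normal_closure x a -> normal_closure x a^-1.

Lemma normal_closure_self x : normal_closure x x.
Proof. by rewrite -[X in normal_closure _ X](conjg1 x); exact: NormalClosureJ. Qed.

Lemma normal_closure_conj x a g : normal_closure x a -> normal_closure x (a ^ g).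
Proof.
elim=> [|k|b c _ IHb _ IHc|b _ IHb].
- by rewrite conj1g; exact: NormalClosure1.
- by rewrite -conjgM; exact: NormalClosureJ.
- by rewrite conjMg; exact: NormalClosureM.
- by rewrite conjVg; exact: NormalClosureV.
Qed.

Lemma normal_closure_commg x a g : normal_closure x a -> normal_closure x [~ a, g].
Proof.
by move=> xa; apply: NormalClosureM; [exact: NormalClosureV|exact: normal_closure_conj].
Qed.

(** Two conjugates [x ^ g] and [x ^ k] commute because [x] commutes with [x ^ (k * g^-1)], so the
    normal closure of [x] is abelian. The identities below are computed inside such abelian normal
    subgroups. *)
Lemma normal_closure_commute x a b :
  normal_closure x a -> normal_closure x b -> commute a b.
Proof.
have conj_ncl g c : normal_closure x c -> commute (x ^ g) c.
  elim=> [|k|c1 c2 _ ? _ ?|c1 _ ?]; last 2 first.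
  - exact: commuteM.
  - exact: commuteV.
  - exact: commute1.
  have := exp3_conj_commute x (k * g^-1) => /(congr1 (conjg^~ g)).
  by rewrite (conjMg x) (conjMg (x ^ _)) -conjgM mulgVK.
move=> + xb; elim=> [|g|c1 c2 _ ? _ ?|c1 _ ?]; last 2 first.
- by apply/commute_sym/commuteM; exact/commute_sym.
- by apply/commute_sym/commuteV; exact/commute_sym.
- exact/commute_sym/commute1.
- exact: conj_ncl.
Qed.

Lemma normal_closure_commg2 x y : normal_closure y [~ x, y].
Proof.
rewrite commgEr; apply: NormalClosureM; last exact: normal_closure_self.
by rewrite conjVg; exact/NormalClosureV/NormalClosureJ.
Qed.

Lemma exp3_engel x y : [~ x, y, y] = 1.
Proof.
apply/eqP/commgP/(normal_closure_commute (normal_closure_commg2 x y)).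
exact: normal_closure_self.
Qed.

Lemma exp3_engel4 x y z : [~ x, y, z, y] = 1.
Proof.
apply/eqP/commgP/(@normal_closure_commute y); last exact: normal_closure_self.
exact/normal_closure_commg/normal_closure_commg2.
Qed.

Lemma normal_closure_commVg x a g : normal_closure x a -> [~ a^-1, g] = [~ a, g]^-1.
Proof.
move=> xa; rewrite !commgEl invgM invgK conjVg.
by apply: (@normal_closure_commute x) => //; apply/NormalClosureV/normal_closure_conj.
Qed.

Lemma normal_closure_commMg x a b g : normal_closure x a -> normal_closure x b ->
  [~ a * b, g] = [~ a, g] * [~ b, g].
Proof.
move=> xa xb; rewrite !commgEl invgM (conjMg a b).
have : commute b^-1 (a^-1 * a ^ g).
  by apply: (@normal_closure_commute x); [exact: NormalClosureV|exact: normal_closure_commg].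
by rewrite /commute; move: (a ^ g) (b ^ g) => A B c; rewrite !mulgA -c mulgA.
Qed.

Lemma commgM_right x g h : [~ x, g * h] = [~ x, h] * [~ x, g] * [~ x, g, h].
Proof.
rewrite !commgEl conjgM (conjMg x^-1) conjVg.
by move: (x ^ g) (x ^ h) ((x ^ g) ^ h) => A B C; rewrite !invgM !invgK !mulgA mulgK mulgVK mulgK.
Qed.

(** Polarization of the Engel identity: in the expansion of [[~ x, g * h, g * h] = 1] every factor
    with a repeated [g] or [h] is trivial, and [[~ x, h, g] * [~ x, g, h]] remains. *)
Lemma exp3_commg_swap23 x g h : [~ x, g, h] = [~ x, h, g]^-1.
Proof.
have C := @normal_closure_commg x.
have Ng := C _ g (normal_closure_self x); have Nh := C _ h (normal_closure_self x).
have := exp3_engel x (g * h); rewrite (commgM_right x).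
rewrite (normal_closure_commMg _ (NormalClosureM Nh Ng) (C _ h Ng)).
rewrite (normal_closure_commMg _ Nh Ng).
rewrite !(commgM_right [~ x, _]) (commgM_right [~ x, g, h]) !exp3_engel.
rewrite !exp3_engel4 !comm1g !mul1g !mulg1.
by move=> h1; apply/esym/mulg1_eq.
Qed.

Lemma exp3_commg_swap12 x g h : [~ x, g, h] = [~ g, x, h]^-1.
Proof.
rewrite -(@normal_closure_commVg x) ?invgR//.
exact: normal_closure_commg2.
Qed.

Lemma exp3_commg_cycle x g h : [~ x, g, h] = [~ g, h, x].
Proof. by rewrite exp3_commg_swap12 exp3_commg_swap23 invgK. Qed.

Lemma exp3_commg_commg u g h : [~ u, [~ g, h]] = [~ u, g, h]^-1.
Proof. by rewrite -invgR exp3_commg_cycle exp3_commg_cycle. Qed.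

(** The commutator of [[~ x, y]] with [[~ g, h]] is the inverse of [[~ x, y, g, h]], and in the
    other order it is the inverse of [[~ g, h, x, y]]. Exchanging the two pairs is an even
    permutation of the arguments, so the two fourfold commutators agree. Hence [[~ x, y, g, h]] is
    its own inverse, and trivial in exponent 3. *)
Lemma exp3_class3 x y g h : [~ x, y, g, h] = 1.
Proof.
have sw34 (a b c d : G) : [~ a, b, c, d] = [~ a, b, d, c]^-1 by exact: exp3_commg_swap23.
have sw23 (a b c d : G) : [~ a, b, c, d] = [~ a, c, b, d]^-1.
  rewrite (exp3_commg_swap23 a b c) (@normal_closure_commVg a)//.
  exact/normal_closure_commg/normal_closure_commg/normal_closure_self.
have sw12 (a b c d : G) : [~ a, b, c, d] = [~ b, a, c, d]^-1.
  rewrite (exp3_commg_swap12 a b c) (@normal_closure_commVg a)//.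
  exact/normal_closure_commg/normal_closure_commg2.
have h1 := exp3_commg_commg [~ x, y] g h.
have h2 := exp3_commg_commg [~ g, h] x y.
have h3 : [~ g, h, x, y] = [~ x, y, g, h].
  by rewrite (sw23 g) (sw12 g) (sw34 x) (sw23 x) !invgK.
have : [~ x, y, g, h] * [~ x, y, g, h] = 1.
  apply: invg_inj; rewrite invgM -{1}h1 -{1}h3 -h2 invg1.
  by rewrite -{1}invgR mulVg.
by rewrite exp3_sqr => /eqP; rewrite invg_eq1 => /eqP.
Qed.

Lemma exp3_commgM x y g h : [~ x, y, g * h] = [~ x, y, g] * [~ x, y, h].
Proof.
rewrite commgM_right exp3_class3 mulg1; apply: (@normal_closure_commute x);
by do 2 apply: normal_closure_commg; exact: normal_closure_self.
Qed.

Lemma exp3_commgX x y g n : [~ x, y, g ^+ n] = [~ x, y, g] ^+ n.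
Proof.
elim: n => [|n IH]; first by rewrite !expg0 commg1.
by rewrite !expgS exp3_commgM IH.
Qed.

End ExponentThree.

(** * Affine subspaces of F_3^r *)

Section Flats.
Local Open Scope ring_scope.
Context (r : nat).
Local Notation U := 'rV['F_3]_r.
Implicit Types (F E l : {set U}) (a b c u v x y : U).

Definition independent3 u v w : Prop :=
  forall a b c : 'F_3, a *: u + b *: v + c *: w = 0 -> [/\ a = 0, b = 0 & c = 0].

Lemma F3_cases (i : 'F_3) : [\/ i = 0, i = 1 | i = -1].
Proof.
case: i => -[|[|[|//]]] i3;
  [constructor 1|constructor 2|constructor 3]; exact/val_inj.
Qed.

Lemma rV3_opp x : - x = x + x.
Proof.
have x3 : x *+ 3 = 0 by rewrite -scaler_nat (_ : 3%:R = 0 :> 'F_3) ?scale0r//; exact/val_inj.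
by apply/eqP; rewrite eq_sym -subr_eq0 opprK -mulr2n -mulrSr x3.
Qed.

Lemma rV3_oppB x : - x - x = x.
Proof. by rewrite {1}rV3_opp addrK. Qed.

(** The three points of an affine line over F_3 sum to 0, so [- a - b] is the third point of the
    line through [a] and [b], and is [a] itself when [a = b]. Closure under this operation therefore
    characterizes affine subspaces. *)
Definition flat F := (F != set0) && [forall a in F, forall b in F, - a - b \in F].

Lemma flatP F :
  reflect ((exists a, a \in F) /\ forall a b, a \in F -> b \in F -> - a - b \in F)
    (flat F).
Proof.
apply: (iffP andP) => [[/set0Pn F0 /forall_inP FF]|[F0 FF]]; split=> //.
- by move=> a b /FF/forall_inP; exact.
- exact/set0Pn.
- by apply/forall_inP => a Fa; apply/forall_inP => b Fb; exact: FF.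
Qed.

Lemma flat_add3 F a b c : flat F -> a \in F -> b \in F -> c \in F -> a + b - c \in F.
Proof.
by move=> /flatP[_ FF] Fa Fb Fc; have := FF _ _ (FF _ _ Fa Fb) Fc; rewrite opprD !opprK.
Qed.

Lemma flat_scale F a u (i : 'F_3) : flat F -> a \in F -> a + u \in F -> forall c, c \in F ->
  c + i *: u \in F.
Proof.
move=> fF Fa Fu c Fc; case: (F3_cases i) => ->.
- by rewrite scale0r addr0.
- by rewrite scale1r; have := flat_add3 fF Fc Fu Fa; rewrite addrCA (addrC a) addrK.
- rewrite scaleN1r; have := flat_add3 fF Fc Fa Fu.
  by rewrite opprD addrA addrK.
Qed.

Lemma flat_comb F a u v (i j : 'F_3) : flat F -> a \in F -> a + u \in F ->
  a + v \in F -> a + i *: u + j *: v \in F.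
Proof.
by move=> fF Fa Fu Fv; apply: (flat_scale _ fF Fa Fv); exact: (flat_scale _ fF Fa Fu).
Qed.

Lemma flat1 a : flat [set a].
Proof.
apply/flatP; split; first by exists a; rewrite inE.
by move=> x y; rewrite !inE => /eqP-> /eqP->; rewrite rV3_oppB.
Qed.

Definition line a b : {set U} := [set a; b; - a - b].

Lemma line_l a b : a \in line a b. Proof. by rewrite !inE eqxx. Qed.
Lemma line_r a b : b \in line a b. Proof. by rewrite !inE eqxx orbT. Qed.

Lemma flat_line a b : flat (line a b).
Proof.
apply/flatP; split; first by exists a; exact: line_l.
move=> x y; rewrite !inE -!orbA => /or3P[]/eqP-> /or3P[]/eqP->;
  rewrite ?opprD ?opprK ?rV3_oppB ?eqxx ?orbT //.
- by rewrite addrA addNr add0r eqxx orbT.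
- by rewrite (addrC (- b)) eqxx !orbT.
- by rewrite addrCA addNr addr0 eqxx.
- by rewrite (addrC a) addrK eqxx orbT.
- by rewrite addrK eqxx.
- by rewrite addrACA -!rV3_opp eqxx !orbT.
Qed.

Lemma line_sub F a b : flat F -> a \in F -> b \in F -> line a b \subset F.
Proof.
move=> /flatP[_ FF] Fa Fb; apply/subsetP => x.
by rewrite !inE -!orbA => /or3P[]/eqP-> //; exact: FF.
Qed.

Lemma card_line a b : a != b -> #|line a b| = 3%N.
Proof.
move=> ab; rewrite /line (_ : [set a; b; - a - b] = - a - b |: [set a; b]); last first.
  by rewrite setUC.
rewrite cardsU1 cards2 ab; suff -> : - a - b \notin [set a; b] by [].
rewrite !inE negb_or; apply/andP; split; apply: contra ab => /eqP h; apply/eqP.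
- by rewrite -[LHS]rV3_oppB -{2}h opprD !opprK addKr.
- by rewrite -[RHS]rV3_oppB -{1}h opprD !opprK addrK.
Qed.

Lemma flat_line_uniq F a b : flat F -> #|F| = 3%N -> a != b -> a \in F -> b \in F ->
  F = line a b.
Proof.
move=> fF F3 ab Fa Fb; apply/esym/eqP; rewrite eqEcard F3 card_line// leqnn andbT.
exact: line_sub.
Qed.

Definition plane a u v : {set U} := [set a + p.1 *: u + p.2 *: v | p : 'F_3 * 'F_3].

Lemma planeP a u v x :
  reflect (exists i j, x = a + i *: u + j *: v) (x \in plane a u v).
Proof.
by apply: (iffP imsetP) => [[[i j] _ ->]|[i [j ->]]]; [exists i, j|exists (i, j)].
Qed.

Lemma flat_plane a u v : flat (plane a u v).
Proof.
apply/flatP; split.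
  by exists a; apply/planeP; exists 0, 0; rewrite !scale0r !addr0.
move=> _ _ /planeP[i [j ->]] /planeP[i' [j' ->]]; apply/planeP.
exists (- i - i'), (- j - j'); rewrite !scalerBl !scaleNr !opprD.
by rewrite (addrACA (- a - _)) (addrACA (- a)) rV3_oppB.
Qed.

Lemma plane_sub F a u v : flat F -> a \in F -> a + u \in F -> a + v \in F ->
  plane a u v \subset F.
Proof. by move=> ? ? ? ?; apply/subsetP => _ /planeP[i [j ->]]; exact: flat_comb. Qed.

Lemma plane_0 a u v : a \in plane a u v.
Proof. by apply/planeP; exists 0, 0; rewrite !scale0r !addr0. Qed.

Lemma plane_1 a u v : a + u \in plane a u v.
Proof. by apply/planeP; exists 1, 0; rewrite scale1r scale0r addr0. Qed.

Lemma plane_2 a u v : a + v \in plane a u v.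
Proof. by apply/planeP; exists 0, 1; rewrite scale1r scale0r addr0. Qed.

Lemma card_plane a u v : u != 0 -> v \notin line 0 u -> #|plane a u v| = 9%N.
Proof.
move=> u0 vu; rewrite card_imset; first by rewrite card_prod !card_Fp.
move=> [i j] [i' j'] /=; rewrite -!addrA => /addrI h.
have h' : (j - j') *: v = (i' - i) *: u.
  rewrite !scalerBl; apply/eqP; rewrite subr_eq addrAC eq_sym subr_eq.
  by rewrite -h addrC.
have jj : j = j'.
  apply/eqP; rewrite -subr_eq0; apply: contraNT vu => jj0.
  have -> : v = ((j - j')^-1 * (i' - i)) *: u by rewrite -scalerA -h' scalerK.
  rewrite !inE oppr0 add0r; case: (F3_cases ((j - j')^-1 * (i' - i))) => ->.
  - by rewrite scale0r eqxx.
  - by rewrite scale1r eqxx orbT.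
  - by rewrite scaleN1r eqxx orbT.
move: h'; rewrite jj subrr scale0r => /esym/eqP.
by rewrite scaler_eq0 (negPf u0) orbF subr_eq0 => /eqP ->.
Qed.

Lemma flat_plane_sub F a : flat F -> a \in F -> (3 < #|F|)%N ->
  exists u v, [/\ u != 0, v \notin line 0 u & plane a u v \subset F].
Proof.
move=> fF Fa F3.
have [b Fb ab] : exists2 b, b \in F & a != b.
  have : (1 < #|F|)%N by exact: leq_trans F3.
  rewrite (cardsD1 a) Fa ltnS => /card_gt0P[b]; rewrite !inE => /andP[ba Fb].
  by exists b; rewrite // eq_sym.
have [c Fc abc] : exists2 c, c \in F & c \notin line a b.
  apply/subsetPn; apply/negP => /subset_leq_card; rewrite card_line// leqNgt.
  by rewrite F3.
exists (b - a), (c - a); split.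
- by rewrite subr_eq0 eq_sym.
- apply: contra abc; rewrite !inE oppr0 add0r subr_eq0 -!orbA.
  move=> /or3P[/eqP->|/eqP/addIr->|/eqP]; rewrite ?eqxx ?orbT//.
  rewrite opprB => /eqP; rewrite subr_eq => /eqP->.
  by rewrite addrAC -(opprK (a + a)) -rV3_opp opprK eqxx !orbT.
- by apply: plane_sub => //; rewrite addrC subrK.
Qed.

Lemma flat_card F : flat F -> (#|F| <= 9)%N -> [\/ #|F| = 1%N, #|F| = 3%N | #|F| = 9%N].
Proof.
move=> fF F9; have /flatP[[a Fa] _] := fF.
have [F3|F3] := ltnP 3 #|F|.
  have [u [v [u0 vu /subset_leq_card]]] := flat_plane_sub fF Fa F3.
  by rewrite card_plane// => F9'; constructor 3; apply/eqP; rewrite eqn_leq F9.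
have [F1|F1] := leqP #|F| 1.
  by constructor 1; apply/eqP; rewrite eqn_leq F1 (cardsD1 a) Fa.
constructor 2; apply/eqP; rewrite eqn_leq F3.
have [b] : exists b, b \in F :\ a.
  by apply/card_gt0P; move: F1; rewrite (cardsD1 a) Fa.
rewrite !inE => /andP[ba Fb].
by apply: leq_trans (subset_leq_card (line_sub fF Fb Fa)); rewrite card_line.
Qed.

(** Two points of [l] span the plane: a linear relation between them would make them coincide or put
    0 on [l]. This is the plane with which the matching pairs a line missing 0. *)
Lemma line_span0 l : flat l -> #|l| = 3%N -> 0 \notin l ->
  exists E, [/\ flat E, #|E| = 9%N, 0 \in E, l \subset E &
    forall F, flat F -> 0 \in F -> l \subset F -> E \subset F].
Proof.
move=> fl l3 l0; have /flatP[[a la] _] := fl.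
have [b] : exists b, b \in l :\ a by apply/card_gt0P; move: (cardsD1 a l); rewrite la l3; case: #|_ :\ _|.
rewrite !inE => /andP[ba lb]; have lE := flat_line_uniq fl l3 ba lb la.
exists (plane 0 a b); split.
- exact: flat_plane.
- apply: card_plane; first by apply: contraNneq l0 => <-.
  rewrite !inE oppr0 add0r !negb_or ba; apply/andP; split.
    by rewrite andbT; apply: contraNneq l0 => <-.
  by apply: contraNneq l0 => bE; rewrite lE !inE bE opprK subrr eqxx !orbT.
- exact: plane_0.
- rewrite lE; apply: line_sub; first exact: flat_plane.
    by rewrite -[X in X \in _]add0r plane_2.
  by rewrite -[X in X \in _]add0r plane_1.
- by move=> F fF F0 /subsetP lF; apply: plane_sub => //; rewrite add0r; exact: lF.
Qed.

End Flats.

(** * Counting independent triples, planes missing 0 and critical flags *)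

Section FlatCounting.
Local Open Scope ring_scope.
Context (r : nat).
Local Notation U := 'rV['F_3]_r.
Implicit Types (F E l : {set U}) (a b c u v x y : U).

Lemma card_rV3 : #|{: U}| = (3 ^ r)%N.
Proof. by rewrite card_mx card_Fp// mul1n. Qed.

(** This turns a bound on the rank into one on the cardinality. Three independent elements have 27
    combinations in [W]; conversely, more than 9 elements leave one outside some [plane 0 u v]
    contained in [W]. *)
Lemma subgroup_independent3 (W : {set U}) : 0 \in W ->
  (forall a b, a \in W -> b \in W -> a + b \in W) ->
  (forall u v w, u \in W -> v \in W -> w \in W -> ~ independent3 u v w) <->
  (#|W| <= 9)%N.
Proof.
move=> W0 WD; have WN a : a \in W -> - a \in W by rewrite rV3_opp => ?; exact: WD.
have fW : flat W.
  apply/flatP; split; first by exists 0.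
  by move=> a b Wa Wb; apply: WD; exact: WN.
split=> [dep|W9 u v w Wu Wv Ww ind].
  rewrite leqNgt; apply/negP => W9.
  have [u [v [u0 vu sub]]] := flat_plane_sub fW W0 (leq_trans (isT : 3 < 10)%N W9).
  have [w Ww wuv] : exists2 w, w \in W & w \notin plane 0 u v.
    apply/subsetPn; apply/negP => /subset_leq_card; rewrite card_plane// leqNgt.
    by rewrite W9.
  apply: (dep u v w) => //.
  - by apply: (subsetP sub); rewrite -[X in X \in _]add0r plane_1.
  - by apply: (subsetP sub); rewrite -[X in X \in _]add0r plane_2.
  move=> a b c abc.
  have c0 : c = 0.
    apply/eqP; apply: contraNT wuv => c0; apply/planeP.
    exists (- (c^-1 * a)), (- (c^-1 * b)); rewrite add0r !scaleNr -opprD.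
    apply/eqP; rewrite -subr_eq0 opprK -!scalerA -scalerDr -[X in X + _](scalerK c0).
    by rewrite -scalerDr addrC abc scaler0.
  have b0 : b = 0.
    apply/eqP; apply: contraNT vu => b0.
    have -> : v = (- (b^-1 * a)) *: u.
      apply/eqP; rewrite -subr_eq0 -scaleNr opprK -scalerA -[X in X + _](scalerK b0).
      by rewrite -scalerDr addrC -[X in _ *: X]addr0 -[X in _ + X](scale0r w) -c0 abc scaler0.
    rewrite !inE oppr0 add0r; case: (F3_cases (- (b^-1 * a))) => ->.
    - by rewrite scale0r eqxx.
    - by rewrite scale1r eqxx orbT.
    - by rewrite scaleN1r eqxx orbT.
  move: abc; rewrite c0 b0 !scale0r !addr0 => /eqP.
  by rewrite scaler_eq0 (negPf u0) orbF => /eqP.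
pose f (p : 'F_3 * 'F_3 * 'F_3) := p.1.1 *: u + p.1.2 *: v + p.2 *: w.
have f_inj : injective f.
  move=> [[i j] k] [[i' j'] k'] /eqP; rewrite -subr_eq0 /f /= !opprD.
  rewrite addrACA (addrACA (i *: u)) -!scalerBl => /eqP/ind[].
  by move=> /subr0_eq -> /subr0_eq -> /subr0_eq ->.
have Wsc (i : 'F_3) x : x \in W -> i *: x \in W.
  move=> Wx; case: (F3_cases i) => ->; rewrite ?scale0r ?scale1r ?scaleN1r//.
  exact: WN.
have : (#|[set f p | p in [set: 'F_3 * 'F_3 * 'F_3]]| <= #|W|)%N.
  apply/subset_leq_card/subsetP => _ /imsetP[[[i j] k] _ ->].
  by apply: (WD); [apply: (WD)|]; exact: Wsc.
rewrite card_imset// cardsT !card_prod !card_Fp// => h.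
by have := leq_trans h W9.
Qed.

Definition planes0 : {set {set U}} := [set E | [&& flat E, #|E| == 9%N & 0 \notin E]].

(** Ordered independent triples [(u, v, a)], read as [plane a u v] with a base point and two ordered
    directions: this plane misses 0 exactly when [a] is outside [plane 0 u v]. *)
Definition frames : {set U * U * U} :=
  [set t | [&& t.1.1 != 0, t.1.2 \notin line 0 t.1.1 & t.2 \notin plane 0 t.1.1 t.1.2]].

Lemma card_frames : #|frames| = ((3 ^ r - 1) * (3 ^ r - 3) * (3 ^ r - 9))%N.
Proof.
rewrite -sum1_card.
transitivity (\sum_(u : U | u != 0%R) \sum_(v | v \notin line 0%R u)
    \sum_(a | a \notin plane 0%R u v) 1)%N.
  rewrite pair_big_dep /= pair_big_dep /=; apply: eq_bigl => -[[u v] a] /=.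
  by rewrite inE /= andbA.
have notin (S : {set U}) : #|[pred a | a \notin S]| = (3 ^ r - #|S|)%N.
  by rewrite -card_rV3 -(cardC S) addKn; apply: eq_card => a; rewrite !inE.
rewrite (eq_bigr (fun=> (3 ^ r - 3) * (3 ^ r - 9))%N); last first.
  move=> u u0; rewrite (eq_bigr (fun=> (3 ^ r - 9)%N)); last first.
    by move=> v vu; rewrite sum1_card notin card_plane.
  by rewrite sum_nat_const notin card_line// eq_sym.
rewrite sum_nat_const mulnA; congr (_ * _ * _)%N.
rewrite -[X in (_ - X)%N](cards1 (0 : U)) -notin.
by apply: eq_card => a; rewrite !inE.
Qed.

Lemma card_dir_diff E F a : a \in E -> F \subset [set x - a | x in E] ->
  #|[pred v | (v \notin F) && (a + v \in E)]| = (#|E| - #|F|)%N.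
Proof.
move=> Ea FE; have -> : #|E| = #|[set x - a | x in E]|.
  by rewrite card_imset//; exact: addIr.
rewrite -(cardsID F [set x - a | x in E]) (setIidPr FE) addKn; apply: eq_card => v.
rewrite !inE; congr (_ && _); apply/idP/imsetP => [aE|[x Ex ->]].
  by exists (a + v) => //; rewrite addrC addKr.
by rewrite addrC subrK.
Qed.

(** A plane has [9 * 8 * 6 = 432] frames: a base point, a nonzero direction, and a direction outside
    the three multiples of the first. *)
Lemma card_planes0_frames : #|frames| = (#|planes0| * 432)%N.
Proof.
rewrite -sum1_card (partition_big (fun t => plane t.2 t.1.1 t.1.2) (mem planes0)) /=.
  rewrite -sum_nat_const; apply: eq_bigr => E; rewrite inE => /and3P[fE /eqP E9 E0].
  transitivity (\sum_(a in E) \sum_(u : U | (u \notin [set 0%R]) && ((a + u)%R \in E))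
    \sum_(v | (v \notin line 0%R u) && ((a + v)%R \in E)) 1)%N.
    rewrite pair_big_dep /= pair_big_dep /=.
    rewrite (reindex (fun t : U * U * U => (t.1.2, t.2, t.1.1))) /=; last first.
      by exists (fun t => (t.2, t.1.1, t.1.2)) => -[[? ?] ?].
    apply: eq_bigl => -[[a u] v] /=; rewrite inE /= !inE.
    apply/idP/idP.
      move=> /andP[/and3P[u0 vu _] /eqP <-]; by rewrite u0 vu plane_0 plane_1 plane_2.
    move=> /andP[/and3P[Ea u0 Eu]] /andP[vu Ev].
    have vu' : v \notin line 0 u by rewrite !inE.
    have PE : plane a u v = E.
      by apply/eqP; rewrite eqEcard plane_sub// card_plane// E9.
    rewrite u0 vu PE eqxx andbT /=; apply: contra E0 => /planeP[i [j]]; rewrite add0r => aE.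
    rewrite -PE; apply/planeP; exists (- i), (- j).
    by rewrite aE !scaleNr addrAC addrK subrr.
  rewrite (eq_bigr (fun=> (8 * 6)%N)).
    by rewrite sum_nat_const E9.
  move=> a Ea; rewrite (eq_bigr (fun=> 6%N)).
    rewrite sum_nat_const card_dir_diff ?cards1 ?E9// sub1set.
    by apply/imsetP; exists a; rewrite ?subrr.
  move=> u /andP[u0 Eu]; rewrite sum1_card card_dir_diff ?E9 ?card_line//.
    by move: u0; rewrite inE eq_sym.
  apply/subsetP => x; rewrite !inE oppr0 add0r -orbA => /or3P[]/eqP->.
  - by apply/imsetP; exists a; rewrite ?subrr.
  - by apply/imsetP; exists (a + u); rewrite // addrC addKr.
  - apply/imsetP; exists (a - u); last by rewrite addrC addKr.
    by rewrite -scaleN1r; exact: (flat_scale _ fE Ea Eu).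
move=> [[u v] a]; rewrite inE /= => /and3P[u0 vu auv]; rewrite inE flat_plane card_plane//=.
apply: contra auv => /planeP[i [j /esym/eqP h]]; apply/planeP; exists (- i), (- j).
by apply/eqP; rewrite add0r !scaleNr -subr_eq0 opprD !opprK addrA.
Qed.

Section Critical.
Context (p c : {set U} -> U).
Hypothesis pE : forall E, E \in planes0 -> p E \in E.
Hypothesis cl : forall l, flat l -> c l \in l.

Definition critical : {set U * {set U} * {set U}} :=
  [set t | [&& t.2 \in planes0, flat t.1.2, #|t.1.2| == 3%N, t.1.2 \subset t.2,
    p t.2 \notin t.1.2, t.1.1 \in t.1.2 & t.1.1 != c t.1.2]].

Lemma card3D1 l y : #|l| = 3%N -> y \in l -> #|l :\ y| = 2%N.
Proof.
by move=> l3 ly; move: (cardsD1 y l); rewrite ly l3; case: #|_ :\ _| => [|[|[|n]]].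
Qed.

(** Double count of the pairs [(y, z)] of points of [E] with [y != x] and [z] off the line through
    [x] and [y]: there are [8 * 6 = 48], and each line missing [x] is [line y z] for [3 * 2 = 6] of
    them. *)
Lemma card_lines_off E x : flat E -> #|E| = 9%N -> x \in E ->
  #|[set l : {set U} | [&& flat l, #|l| == 3%N, l \subset E & x \notin l]]| = 8%N.
Proof.
move=> fE E9 Ex; set L := [set _ | _].
have c48 : (\sum_(y in E :\ x) \sum_(z in E :\: line x y) 1 = 48)%N.
  rewrite (eq_bigr (fun=> 6%N)).
    by rewrite sum_nat_const -[RHS]/(8 * 6)%N -[8%N]/(9 - 1)%N -E9 (cardsD1 x E) Ex addKn.
  move=> y; rewrite !inE => /andP[yx Ey]; rewrite sum1_card.
  by rewrite cardsD (setIidPr (line_sub fE Ex Ey)) E9 card_line// eq_sym.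
suff : (#|L| * 6 = 48)%N by move=> h; apply/eqP; rewrite -(eqn_pmul2r (isT : 0 < 6)%N) h.
rewrite -c48 -sum_nat_const pair_big_dep /=.
rewrite [RHS](partition_big (fun t => line t.1 t.2) (mem L)) /=; last first.
  move=> [y z] /= /andP[]; rewrite in_setD1 => /andP[yx Ey].
  rewrite in_setD => /andP[zxy Ez]; rewrite inE.
  have yz : y != z by apply: contraNneq zxy => <-; exact: line_r.
  rewrite flat_line card_line// line_sub//=.
  apply: contra zxy => xyz; rewrite eq_sym in yx.
  rewrite -(flat_line_uniq (flat_line y z) (card_line yz) yx xyz (line_l _ _)).
  exact: line_r.
apply: eq_bigr => l; rewrite inE => /and4P[fl /eqP l3 lE xl].
transitivity (\sum_(y in l) \sum_(z in l :\ y) 1)%N.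
  rewrite (eq_bigr (fun=> 2%N)).
    by rewrite sum_nat_const l3.
  by move=> y ly; rewrite sum1_card; exact: card3D1.
rewrite pair_big_dep /=; apply: eq_bigl => -[y z] /=.
apply/idP/idP.
  rewrite !inE => /andP[ly /andP[zy lz]].
  have lyz : l = line y z by apply: flat_line_uniq; rewrite // eq_sym.
  have xy : y != x by apply: contraNneq xl => <-.
  rewrite -lyz eqxx xy (subsetP lE)// (subsetP lE)// !andbT /=.
  have : z \notin line x y; last by rewrite !inE.
  apply: contra xl => zl; rewrite (flat_line_uniq fl l3 zy lz ly).
  rewrite -(flat_line_uniq (flat_line x y) (card_line _) zy zl (line_r _ _)) ?line_l//.
  by rewrite eq_sym.
move=> /andP[/andP[_ h] /eqP <-]; rewrite line_l /= in_setD1 line_r andbT.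
by apply: contraTneq h => ->; rewrite in_setD line_r.
Qed.

Lemma card_critical : #|critical| = (#|planes0| * 16)%N.
Proof.
rewrite -sum1_card.
transitivity (\sum_(E in planes0) \sum_(l in [set l : {set U} |
    [&& flat l, #|l| == 3%N, l \subset E & p E \notin l]]) \sum_(q in l :\ c l) 1)%N.
  rewrite pair_big_dep /= pair_big_dep /=.
  rewrite (reindex (fun t : {set U} * {set U} * U => (t.2, t.1.2, t.1.1))) /=; last first.
    by exists (fun t => (t.2, t.1.2, t.1.1)) => -[[? ?] ?].
  apply: eq_bigl => -[[E l] q] /=; rewrite !inE /= -!andbA.
  by rewrite [(q \in l) && _]andbC.
rewrite -sum_nat_const; apply: eq_bigr => E PE.
have := PE; rewrite inE => /and3P[fE /eqP E9 _].
rewrite (eq_bigr (fun=> 2%N)).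
  by rewrite sum_nat_const card_lines_off//; exact: pE.
move=> l; rewrite inE => /and4P[fl /eqP l3 _ _]; rewrite sum1_card.
by apply: card3D1 => //; exact: cl.
Qed.

(** A plane missing 0 carries 432 frames and [8 * 2 = 16] critical flags, and [432 = 27 * 16]. *)
Lemma critical_card27 :
  (27 * #|critical| = (3 ^ r - 1) * (3 ^ r - 3) * (3 ^ r - 9))%N.
Proof. by rewrite -card_frames card_planes0_frames card_critical; lia. Qed.

End Critical.
End FlatCounting.

(** * Simplicial collapses from acyclic matchings *)

Inductive collapse (V : choiceType) : {fset {fset V}} -> {fset {fset V}} -> Prop :=
| CollapseRefl B : collapse B B
| CollapseStep B B' (s : {fset V}) (w : V) :
    s != fset0 -> w \notin s -> (w |` s)%fset \in B ->
    (forall t, t \in B -> (s `<=` t)%fset -> t = s \/ t = (w |` s)%fset) ->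
    collapse (B `\ s `\ (w |` s)%fset)%fset B' -> collapse B B'.

Section RankedCollapse.
Context (V : choiceType) (C : finType) (sim : C -> {fset V}).
Context (low up : C -> C) (rk : C -> nat) (b : C).

(* An acyclic matching on the simplices indexed by [P] other than [b]: [c] is
   matched within the pair [low c], [up c], and in the pair of largest rank
   the lower simplex is a free face. *)
Record ranked_matching (P : {set C}) : Prop := RankedMatching {
  rm_base : b \in P;
  rm_low : forall c, c \in P -> c != b -> low c \in P /\ low c != b;
  rm_up : forall c, c \in P -> c != b -> up c \in P /\ up c != b;
  rm_or : forall c, c \in P -> c != b -> c = low c \/ c = up c;
  rm_lowlow : forall c, c \in P -> c != b ->
    [/\ low (low c) = low c, up (low c) = up c & rk (low c) = rk c];
  rm_lowup : forall c, c \in P -> c != b ->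
    [/\ low (up c) = low c, up (up c) = up c & rk (up c) = rk c];
  rm_sim : forall c, c \in P -> c != b -> sim (low c) != fset0 /\
    exists2 w, w \notin sim (low c) & sim (up c) = (w |` sim (low c))%fset;
  rm_rank : forall c c', c \in P -> c' \in P -> c != b -> low c = c ->
    (sim c `<=` sim c')%fset -> c' != c -> c' != up c -> c' != b /\ (rk c < rk c')%N;
  rm_inj : {in P &, injective sim} }.

(** A pair of maximal rank is removed first: by [rm_rank] any other simplex containing its lower
    member would have larger rank, so that member is a free face. What is left is again a ranked
    matching. *)
Lemma ranked_collapse (P : {set C}) : ranked_matching P ->
  collapse [fset sim c | c in P]%fset [fset sim b]%fset.
Proof.
move: {2}#|P| (leqnn #|P|) => n; elim: n P => [|n IH] P Pn rmP.
  by move: Pn; rewrite leqn0 cards_eq0 => /eqP P0; have := rm_base rmP; rewrite P0 inE.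
have [Pb|] := boolP (P \subset [set b]).
  have -> : P = [set b].
    by apply/eqP; rewrite finset.eqEsubset Pb finset.sub1set (rm_base rmP).
  suff -> : [fset sim c | c in [set b]]%fset = [fset sim b]%fset by exact: CollapseRefl.
  apply/fsetP => t; rewrite inE; apply/imfsetP/eqP => /= [[c]|->].
    by rewrite inE => /eqP -> ->.
  by exists b; rewrite ?inE.
move=> /subsetPn[c1 Pc1]; rewrite inE => c1b.
have := arg_maxnP (P := [pred c in P | c != b]) rk (i0 := c1).
move=> /(_ _)[|/= c]; first by rewrite /= Pc1 c1b.
move=> /andP[Pc cb] cmax.
have [Pl lb] := rm_low rmP Pc cb; have [Pu ub] := rm_up rmP Pc cb.
have [ll ul rl] := rm_lowlow rmP Pc cb; have [lu uu ru] := rm_lowup rmP Pc cb.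
have [s0 [w wl simu]] := rm_sim rmP Pc cb.
have lNu : low c != up c.
  by apply: contraNneq wl => h; rewrite h simu fset1U1.
pose P1 := (P :\ low c :\ up c).
have P1P x : x \in P1 = [&& x != up c, x != low c & x \in P] by rewrite !inE.
have simP (Q : {set C}) t : t \in [fset sim x | x in Q]%fset <-> exists2 x, x \in Q & t = sim x.
  by split=> [/imfsetP|[x Qx ->]]; last exact: in_imfset.
have P1E : ([fset sim x | x in P] `\ sim (low c) `\ (w |` sim (low c)))%fset =
    [fset sim x | x in P1]%fset.
  apply/fsetP => t; rewrite -simu; apply/idP/idP.
    rewrite !inE => /and3P[tu tl /simP[x Px tx]]; apply/simP; exists x => //.
    rewrite P1P Px andbT; apply/andP; split.
      by apply: contraNneq tu => xu; rewrite tx xu.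
    by apply: contraNneq tl => xl; rewrite tx xl.
  move=> /simP[x]; rewrite P1P => /and3P[xu xl Px] ->.
  rewrite in_fsetD1 in_fsetD1; apply/and3P; split; last by apply/simP; exists x.
    by apply: contra_neq xu => /(rm_inj rmP Px Pu).
  by apply: contra_neq xl => /(rm_inj rmP Px Pl).
apply: (CollapseStep s0 wl); first by rewrite -simu; apply/simP; exists (up c).
  move=> t /simP[x Px ->] lx; rewrite -simu.
  have [->|xl] := eqVneq x (low c); first by left.
  have [->|xu] := eqVneq x (up c); first by right.
  have := rm_rank rmP Pl Px lb ll lx xl; rewrite ul => /(_ xu)[xb].
  by rewrite rl ltnNge; have := cmax x; rewrite /= Px xb => ->.
rewrite P1E; apply: IH.
  have h1 := cardsD1 (low c) P; have h2 := cardsD1 (up c) (P :\ low c).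
  rewrite Pl in h1; move: h2; rewrite in_setD1 eq_sym lNu Pu /= -/P1 => h2.
  by move: Pn; rewrite h1 h2 !add1n ltnS => /ltnW.
(* The pairs are disjoint: [low] determines the pair, so a simplex that survives keeps its
   partner. *)
have notpair x : x \in P1 -> x != b -> low x != low c.
  rewrite P1P => /and3P[xu xl Px] xb; apply/eqP => lxc.
  have [_ ulx _] := rm_lowlow rmP Px xb.
  have [xE|xE] := rm_or rmP Px xb; first by rewrite xE lxc eqxx in xl.
  by rewrite xE -ulx lxc ul eqxx in xu.
split.
- by rewrite P1P eq_sym ub eq_sym lb (rm_base rmP).
- move=> x P1x xb; have := P1x; rewrite P1P => /and3P[xu xl Px].
  have [Plx lxb] := rm_low rmP Px xb; split=> //; rewrite P1P Plx (notpair _ P1x xb) !andbT.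
  apply: contraNneq (notpair _ P1x xb) => lxu.
  by have [<- _ _] := rm_lowlow rmP Px xb; rewrite lxu lu.
- move=> x P1x xb; have := P1x; rewrite P1P => /and3P[xu xl Px].
  have [Pux uxb] := rm_up rmP Px xb; split=> //; rewrite P1P Pux andbT.
  have [lux _ _] := rm_lowup rmP Px xb.
  apply/andP; split; apply: contraNneq (notpair _ P1x xb) => uxE; rewrite -lux uxE.
    by rewrite lu.
  by rewrite ll.
- by move=> x; rewrite P1P => /and3P[_ _ Px]; exact: (rm_or rmP).
- by move=> x; rewrite P1P => /and3P[_ _ Px]; exact: (rm_lowlow rmP).
- by move=> x; rewrite P1P => /and3P[_ _ Px]; exact: (rm_lowup rmP).
- by move=> x; rewrite P1P => /and3P[_ _ Px]; exact: (rm_sim rmP).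
- move=> x y; rewrite !P1P => /and3P[_ _ Px] /and3P[_ _ Py]; exact: (rm_rank rmP).
- move=> x y; rewrite !P1P => /and3P[_ _ Px] /and3P[_ _ Py]; exact: (rm_inj rmP).
Qed.

End RankedCollapse.

(** * The acyclic matching on flags of points, lines and planes *)

Section AffineMatching.
Local Open Scope ring_scope.
Context (r : nat).
Local Notation U := 'rV['F_3]_r.
Implicit Types (F l P : {set U}) (q : U).

Definition is_line l := flat l && (#|l| == 3%N).
Definition is_plane P := flat P && (#|P| == 9%N).

(* A chain of flats of dimension at most 2: its point, line and plane. *)
Definition flag : Type := option U * option {set U} * option {set U}.
HB.instance Definition _ := Finite.on flag.

Definition valid (c : flag) : bool :=
  [&& c != (None, None, None), oapp is_line true c.1.2, oapp is_plane true c.2,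
    (if c is (Some q, Some l, _) then q \in l else true),
    (if c is (Some q, _, Some P) then q \in P else true) &
    (if c is (_, Some l, Some P) then l \subset P else true)].

Definition pt F : U := odflt 0 [pick x in F].

Lemma ptP F : flat F -> pt F \in F.
Proof.
move=> /flatP[[x Fx] _]; rewrite /pt; case: pickP => //= /(_ x).
by rewrite Fx.
Qed.

Definition span0 l : {set U} :=
  odflt l [pick P : {set U} | [&& is_plane P, 0 \in P & l \subset P]].

Lemma span0P l : is_line l -> 0 \notin l ->
  [/\ is_plane (span0 l), 0 \in span0 l, l \subset span0 l &
    forall P, is_plane P -> 0 \in P -> l \subset P -> P = span0 l].
Proof.
move=> /andP[fl /eqP l3] l0; have [P0 [fP P9 P00 lP Pmin]] := line_span0 fl l3 l0.
have uniqP P : is_plane P -> 0 \in P -> l \subset P -> P0 = P.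
  move=> /andP[fP' /eqP P9'] P0' lP'; apply/eqP; rewrite eqEcard Pmin//=.
  by rewrite P9 P9'.
have -> : span0 l = P0.
  rewrite /span0; case: pickP => /= [P /and3P[h1 h2 h3]|/(_ P0)]; last first.
    by rewrite /is_plane fP P9 P00 lP.
  by rewrite (uniqP P).
split=> //; first by rewrite /is_plane fP P9.
by move=> P h1 h2 h3; rewrite -(uniqP P).
Qed.

Definition crit (c : flag) : bool :=
  match c with
  | (Some q, Some l, Some P) => [&& 0 \notin P, pt P \notin l & q != pt l]
  | _ => false
  end.

(* The lower and upper simplices of the pair containing [c], and its rank. *)
Definition match_of (c : flag) : flag * flag * nat :=
  match c with
  | (oq, ol, Some P) =>
    if 0 \notin P then
      match oq, ol with
      | None, None => ((None, None, Some P), (Some (pt P), None, Some P), 7%N)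
      | Some q, None =>
        if q == pt P then ((None, None, Some P), (Some (pt P), None, Some P), 7%N)
        else ((Some q, None, Some P), (Some q, Some (line (pt P) q), Some P), 9%N)
      | None, Some l =>
        if pt P \in l then
          ((None, Some l, Some P), (Some (pt P), Some l, Some P), 8%N)
        else ((None, Some l, Some P), (Some (pt l), Some l, Some P), 10%N)
      | Some q, Some l =>
        if pt P \in l then
          if q == pt P then
            ((None, Some l, Some P), (Some (pt P), Some l, Some P), 8%N)
          else ((Some q, None, Some P), (Some q, Some (line (pt P) q), Some P), 9%N)
        else ((None, Some l, Some P), (Some (pt l), Some l, Some P), 10%N)
      end
    else
      match oq, ol with
      | oq, Some l =>
        if 0 \notin l then
          ((oq, Some l, None), (oq, Some l, Some (span0 l)), if oq then 6%N else 5%N)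
        else match oq with
          | Some q => if q != 0 then
              ((Some q, None, Some P), (Some q, Some (line 0 q), Some P), 4%N)
            else ((None, Some l, Some P), (Some 0, Some l, Some P), 2%N)
          | None => ((None, Some l, Some P), (Some 0, Some l, Some P), 2%N)
          end
      | Some q, None => if q != 0 then
          ((Some q, None, Some P), (Some q, Some (line 0 q), Some P), 4%N)
        else ((None, None, Some P), (Some 0, None, Some P), 1%N)
      | None, None => ((None, None, Some P), (Some 0, None, Some P), 1%N)
      end
  | (oq, Some l, None) =>
    if 0 \notin l then
      ((oq, Some l, None), (oq, Some l, Some (span0 l)), if oq then 6%N else 5%N)
    else match oq with
      | Some q => if q != 0 then
          ((Some q, None, None), (Some q, Some (line 0 q), None), 3%N)
        else ((None, Some l, None), (Some 0, Some l, None), 1%N)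
      | None => ((None, Some l, None), (Some 0, Some l, None), 1%N)
      end
  | (Some q, None, None) =>
    ((Some q, None, None), (Some q, Some (line 0 q), None), 3%N)
  | (None, None, None) => ((None, None, None), (None, None, None), 0%N)
  end.

Definition flags0 : {set flag} := [set c | valid c && ~~ crit c].
Definition origin_flag : flag := (Some 0, None, None).

Context (V : choiceType) (vt : {set U} -> V).
Hypothesis vt_inj : forall F F', flat F -> flat F' -> (#|F| <= 9)%N -> (#|F'| <= 9)%N ->
  vt F = vt F' -> F = F'.

Definition flag_verts (c : flag) : seq V :=
  (if c.1.1 is Some q then [:: vt [set q]] else [::]) ++
  (if c.1.2 is Some l then [:: vt l] else [::]) ++
  (if c.2 is Some P then [:: vt P] else [::]).

Definition sim (c : flag) : {fset V} := [fset v in flag_verts c]%fset.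

Lemma line_small l : is_line l -> flat l /\ (#|l| <= 9)%N.
Proof. by move=> /andP[-> /eqP ->]. Qed.

Lemma plane_small P : is_plane P -> flat P /\ (#|P| <= 9)%N.
Proof. by move=> /andP[-> /eqP ->]. Qed.

Lemma point_small q : flat [set q] /\ (#|[set q]| <= 9)%N.
Proof. by rewrite flat1 cards1. Qed.

Lemma vt_qq q q' : vt [set q] = vt [set q'] -> q = q'.
Proof.
have [h1 h2] := point_small q; have [h3 h4] := point_small q'.
by move=> /(vt_inj h1 h3 h2 h4)/set1_inj.
Qed.

Lemma vt_ql q l : is_line l -> (vt [set q] == vt l) = false.
Proof.
move=> ll; have [h1 h2] := point_small q; have [h3 h4] := line_small ll.
apply/eqP => /(vt_inj h1 h3 h2 h4) ql; move: ll => /andP[_].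
by rewrite -ql cards1.
Qed.

Lemma vt_qp q P : is_plane P -> (vt [set q] == vt P) = false.
Proof.
move=> ll; have [h1 h2] := point_small q; have [h3 h4] := plane_small ll.
apply/eqP => /(vt_inj h1 h3 h2 h4) ql; move: ll => /andP[_].
by rewrite -ql cards1.
Qed.

Lemma vt_lp l P : is_line l -> is_plane P -> (vt l == vt P) = false.
Proof.
move=> hl hP; have [h1 h2] := line_small hl; have [h3 h4] := plane_small hP.
apply/eqP => /(vt_inj h1 h3 h2 h4) lP; move: hl hP => /andP[_ /eqP l3] /andP[_].
by rewrite -lP l3.
Qed.

Lemma vt_ll l l' : is_line l -> is_line l' -> vt l = vt l' -> l = l'.
Proof.
by move=> hl hl'; have [h1 h2] := line_small hl; have [h3 h4] := line_small hl'; exact: vt_inj.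
Qed.

Lemma vt_pp l l' : is_plane l -> is_plane l' -> vt l = vt l' -> l = l'.
Proof.
by move=> hl hl'; have [h1 h2] := plane_small hl; have [h3 h4] := plane_small hl'; exact: vt_inj.
Qed.

Lemma in_simE c v : (v \in sim c) = (v \in flag_verts c).
Proof. by rewrite /sim in_fset. Qed.

Lemma in_sim c v : v \in sim c <-> [\/ exists2 q, c.1.1 = Some q & v = vt [set q],
  exists2 l, c.1.2 = Some l & v = vt l | exists2 P, c.2 = Some P & v = vt P].
Proof.
rewrite in_simE /flag_verts !mem_cat; split.
  move=> /or3P[].
  - by case: c.1.1 => // q; rewrite inE => /eqP ->; constructor 1; exists q.
  - by case: c.1.2 => // q; rewrite inE => /eqP ->; constructor 2; exists q.
  - by case: c.2 => // q; rewrite inE => /eqP ->; constructor 3; exists q.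
by case=> -[q -> ->]; rewrite inE eqxx ?orbT.
Qed.

Lemma valid_line c l : valid c -> c.1.2 = Some l -> is_line l.
Proof. by move=> /and5P[_ + _ _ _] cl; rewrite cl. Qed.

Lemma valid_plane c P : valid c -> c.2 = Some P -> is_plane P.
Proof. by move=> /and5P[_ _ + _ _] cP; rewrite cP. Qed.

Lemma in_sim_point c q : valid c -> vt [set q] \in sim c -> c.1.1 = Some q.
Proof.
move=> vc /in_sim[[q' -> /vt_qq ->//]|[l cl /eqP]|[P cP /eqP]].
  by rewrite vt_ql//; exact: valid_line cl.
by rewrite vt_qp//; exact: valid_plane cP.
Qed.

Lemma in_sim_line c l : valid c -> is_line l -> vt l \in sim c -> c.1.2 = Some l.
Proof.
move=> vc hl /in_sim[[q' _ /esym/eqP]|[l' cl]|[P cP /eqP]].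
- by rewrite vt_ql.
- by move=> /vt_ll ->//; exact: valid_line cl.
- by rewrite vt_lp//; exact: valid_plane cP.
Qed.

Lemma in_sim_plane c P : valid c -> is_plane P -> vt P \in sim c -> c.2 = Some P.
Proof.
move=> vc hP /in_sim[[q' _ /esym/eqP]|[l cl /esym/eqP]|[P' cP]].
- by rewrite vt_qp.
- by rewrite vt_lp//; exact: valid_line cl.
- by move=> /vt_pp ->//; exact: valid_plane cP.
Qed.

Lemma sim_sub c c' : valid c -> valid c' -> (sim c `<=` sim c')%fset ->
  [/\ forall q, c.1.1 = Some q -> c'.1.1 = Some q,
      forall l, c.1.2 = Some l -> c'.1.2 = Some l &
      forall P, c.2 = Some P -> c'.2 = Some P].
Proof.
move=> vc vc' /fsubsetP cc'; split=> [q cq|l cl|P cP].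
- by apply: in_sim_point => //; apply: cc'; apply/in_sim; constructor 1; exists q.
- apply: in_sim_line => //; first exact: valid_line cl.
  by apply: cc'; apply/in_sim; constructor 2; exists l.
- apply: in_sim_plane => //; first exact: valid_plane cP.
  by apply: cc'; apply/in_sim; constructor 3; exists P.
Qed.

Lemma sim_inj c c' : valid c -> valid c' -> sim c = sim c' -> c = c'.
Proof.
move=> vc vc' cc'; have := sim_sub vc vc'; have := sim_sub vc' vc.
rewrite cc' fsubset_refl => /(_ isT)[h1 h2 h3] /(_ isT)[k1 k2 k3].
have oE (T : Type) (a b : option T) : (forall x, a = Some x -> b = Some x) ->
    (forall x, b = Some x -> a = Some x) -> a = b.
  by case: a b => [x|] [y|] // h k; [rewrite (h x)|have := h x erefl|have := k y erefl].
case: c c' h1 h2 h3 k1 k2 k3 {vc vc' cc'} => -[a b] d [[a' b'] d'] /=.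
by move=> h1 h2 h3 k1 k2 k3; rewrite (oE _ a a')// (oE _ b b')// (oE _ d d').
Qed.

Lemma sim_add_point (ol : option {set U}) oP q :
  sim (Some q, ol, oP) = (vt [set q] |` sim (None, ol, oP))%fset.
Proof. by apply/fsetP => v; rewrite in_fset1U !in_simE /flag_verts /= in_cons. Qed.

Lemma sim_add_line (oq : option U) oP l :
  sim (oq, Some l, oP) = (vt l |` sim (oq, None, oP))%fset.
Proof.
apply/fsetP => v; rewrite in_fset1U !in_simE /flag_verts /=.
by rewrite mem_cat in_cons mem_cat orbCA.
Qed.

Lemma sim_add_plane (oq : option U) ol P :
  sim (oq, ol, Some P) = (vt P |` sim (oq, ol, None))%fset.
Proof.
apply/fsetP => v; rewrite in_fset1U !in_simE /flag_verts /= !mem_cat inE.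
by rewrite in_nil orbF orbA orbC.
Qed.

Local Notation low c := (match_of c).1.1.
Local Notation up c := (match_of c).1.2.
Local Notation rk c := (match_of c).2.

Lemma neq_sym (a b : U) : a != b -> b != a.
Proof. by rewrite eq_sym. Qed.

Lemma line_in a q P : a != q -> flat P -> a \in P -> q \in P ->
  [/\ is_line (line a q), a \in line a q, q \in line a q & line a q \subset P].
Proof.
move=> aq fP Pa Pq; rewrite /is_line flat_line card_line// line_l line_r.
by rewrite line_sub.
Qed.

Lemma line_eq a q l : is_line l -> a != q -> a \in l -> q \in l -> l = line a q.
Proof. by move=> /andP[fl /eqP l3]; exact: flat_line_uniq. Qed.

Lemma plane_flat P : is_plane P -> flat P. Proof. by case/andP. Qed.
Lemma line_flat l : is_line l -> flat l. Proof. by case/andP. Qed.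

Lemma valid_fl oq l oP : valid (oq, Some l, oP) -> is_line l.
Proof. by move=> v; exact: (valid_line v). Qed.

Lemma valid_fp oq ol P : valid (oq, ol, Some P) -> is_plane P.
Proof. by move=> v; exact: (valid_plane v). Qed.

Lemma valid_fql q l oP : valid (Some q, Some l, oP) -> q \in l.
Proof. by case/and5P. Qed.

Lemma valid_fqp q ol P : valid (Some q, ol, Some P) -> q \in P.
Proof. by case: ol => [l|] /and5P[_ _ _ _ /andP[]]. Qed.

Lemma valid_flp oq l P : valid (oq, Some l, Some P) -> l \subset P.
Proof. by case: oq => [q|] /and5P[_ _ _ _ /andP[]]. Qed.

Ltac flag_done H := split=> //=; rewrite ?andbT ?eqxx ?H //=; first [by left | by right |
  by apply/eqP => -[] | by apply/eqP => -[/eqP]; rewrite H].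

(** Constancy of [match_of] on each pair yields the idempotence of [low] and [up] and the equality
    of ranks at once. It holds because the added vertex is forced: two points determine their line,
    and [span0 l] is the only plane through 0 containing [l]. *)
Lemma match_flags0 c : c \in flags0 -> c != origin_flag ->
  [/\ (low c \in flags0) && (low c != origin_flag),
      (up c \in flags0) && (up c != origin_flag), c = low c \/ c = up c,
      match_of (low c) = match_of c & match_of (up c) = match_of c].
Proof.
rewrite inE; case: c => -[[q|] [l|]] [P|] /andP[].
- move=> v; have hl := valid_fl v; have hP := valid_fp v; have ql := valid_fql v.
  have qP := valid_fqp v; have lP := valid_flp v.
  case: (boolP (0 \notin P)) => P0 /=.
    have Pp := ptP (plane_flat hP).
    case: (boolP (pt P \in l)) => pl /= nc _.
      have [qp|qp] := eqVneq q (pt P).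
        rewrite qp /= ?P0 ?pl ?eqxx !inE /valid /= ?hl ?hP ?pl ?Pp ?lP ?P0; flag_done (P0, pl).
      have lE : l = line (pt P) q by apply: line_eq => //; rewrite eq_sym.
      have [h1 h2 h3 h4] := line_in (neq_sym qp) (plane_flat hP) Pp qP.
      rewrite lE /= ?P0 ?h2 ?(negPf qp) !inE /valid /= ?h1 ?hP ?h2 ?h3 ?h4 ?qP ?P0.
      flag_done (P0, h2, (negPf qp)).
    have ll := ptP (line_flat hl).
    (* Any other point of [l] would make the flag critical. *)
    have qE : q = pt l by apply/eqP; apply: contraNT nc => ->; rewrite ?P0 ?pl.
    rewrite qE /= ?P0 ?(negPf pl) !inE /valid /= ?hl ?hP ?lP ?ll ?(subsetP lP _ ll) ?P0 ?pl ?eqxx.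
    flag_done (P0, (negPf pl)).
  move=> _ _; rewrite negbK in P0.
  case: (boolP (0 \notin l)) => l0 /=.
    have [h1 h2 h3 /(_ P hP P0 lP) PE] := span0P hl l0.
    rewrite PE /= ?h2 ?l0 !inE /valid /= ?hl ?h1 ?ql ?h3 ?(subsetP h3 _ ql) ?h2 /=.
    flag_done (l0, h2).
  rewrite negbK in l0.
  have [q0|q0] := eqVneq q 0.
    rewrite q0 /= ?P0 ?l0 /= ?eqxx !inE /valid /= ?hl ?hP ?l0 ?lP ?P0 /=.
    flag_done (P0, l0).
  have lE : l = line 0 q by apply: line_eq => //; rewrite eq_sym.
  have [h1 h2 h3 h4] := line_in (neq_sym q0) (plane_flat hP) P0 qP.
  rewrite /= lE ?h2 /= ?P0 ?h2 /= ?q0 !inE /valid /= ?h1 ?hP ?h3 ?qP ?h4 ?P0 /=.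
  flag_done (P0, h2, (negPf q0)).
- move=> v _ _; have hl := valid_fl v; have ql := valid_fql v.
  case: (boolP (0 \notin l)) => l0 /=.
    have [h1 h2 h3 _] := span0P hl l0.
    rewrite ?h2 ?l0 !inE /valid /= ?hl ?h1 ?ql ?h3 ?(subsetP h3 _ ql) ?h2 /=.
    flag_done (l0, h2).
  rewrite negbK in l0.
  have [q0|q0] := eqVneq q 0.
    rewrite q0 /= ?l0 /= !inE /valid /= ?hl ?l0; flag_done l0.
  have lE : l = line 0 q by apply: line_eq => //; rewrite eq_sym.
  have [h1 h2 h3 _] := line_in (neq_sym q0) (line_flat hl) l0 ql.
  rewrite /= lE ?h2 /= ?q0 !inE /valid /= ?h1 ?h3.
  flag_done (h2, (negPf q0)).
- move=> v _ _; have hP := valid_fp v; have qP := valid_fqp v.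
  have Pp := ptP (plane_flat hP).
  case: (boolP (0 \notin P)) => P0 /=.
    have [qp|qp] := eqVneq q (pt P).
      rewrite qp /= ?P0 ?eqxx !inE /valid /= ?hP ?Pp; flag_done P0.
    have [h1 h2 h3 h4] := line_in (neq_sym qp) (plane_flat hP) Pp qP.
    rewrite /= ?P0 ?h2 ?(negPf qp) !inE /valid /= ?h1 ?hP ?h2 ?h3 ?h4 ?qP ?P0.
    flag_done (P0, h2, (negPf qp)).
  rewrite negbK in P0.
  have [q0|q0] := eqVneq q 0.
    rewrite q0 /= ?P0 /= ?eqxx !inE /valid /= ?hP ?P0; flag_done P0.
  have [h1 h2 h3 h4] := line_in (neq_sym q0) (plane_flat hP) P0 qP.
  rewrite /= ?h2 /= ?P0 ?h2 /= ?q0 !inE /valid /= ?h1 ?hP ?h3 ?qP ?h4 ?P0 /=.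
  flag_done (P0, h2, (negPf q0)).
- move=> _ _ q0; have {}q0 : q != 0 by apply: contraNneq q0 => ->.
  have [h1 h2 h3 _] := line_in (neq_sym q0) (flat_line 0 q)
    (line_l _ _) (line_r _ _).
  rewrite /= ?h2 /= ?q0 !inE /valid /= ?h1 ?h3.
  flag_done (h2, (negPf q0)).
- move=> v _ _; have hl := valid_fl v; have hP := valid_fp v; have lP := valid_flp v.
  have Pp := ptP (plane_flat hP); have ll := ptP (line_flat hl).
  case: (boolP (0 \notin P)) => P0 /=.
    case: (boolP (pt P \in l)) => pl /=.
      rewrite ?P0 ?pl ?eqxx !inE /valid /= ?hl ?hP ?pl ?Pp ?lP ?P0; flag_done (P0, pl).
    rewrite ?P0 ?(negPf pl) !inE /valid /= ?hl ?hP ?lP ?ll ?(subsetP lP _ ll) ?P0 ?pl ?eqxx.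
    flag_done (P0, (negPf pl)).
  rewrite negbK in P0.
  case: (boolP (0 \notin l)) => l0 /=.
    have [h1 h2 h3 /(_ P hP P0 lP) PE] := span0P hl l0.
    rewrite PE /= ?h2 ?l0 !inE /valid /= ?hl ?h1 ?h3; flag_done (l0, h2).
  rewrite negbK in l0.
  rewrite /= ?P0 ?l0 /= ?eqxx !inE /valid /= ?hl ?hP ?l0 ?lP ?P0 /=.
  flag_done (P0, l0).
- move=> v _ _; have hl := valid_fl v.
  case: (boolP (0 \notin l)) => l0 /=.
    have [h1 h2 h3 _] := span0P hl l0.
    rewrite ?h2 ?l0 !inE /valid /= ?hl ?h1 ?h3; flag_done (l0, h2).
  rewrite negbK in l0.
  rewrite ?l0 /= !inE /valid /= ?hl ?l0; flag_done l0.
- move=> v _ _; have hP := valid_fp v.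
  have Pp := ptP (plane_flat hP).
  case: (boolP (0 \notin P)) => P0 /=.
    rewrite ?P0 ?eqxx !inE /valid /= ?hP ?Pp; flag_done P0.
  rewrite negbK in P0.
  rewrite ?P0 /= ?eqxx !inE /valid /= ?hP ?P0; flag_done P0.
- by [].
Qed.

End AffineMatching.

Section AffineMatchingAcyclic.
Local Open Scope ring_scope.
Context (r : nat).
Local Notation U := 'rV['F_3]_r.
Implicit Types (F l P : {set U}) (q : U).
Context (V : choiceType) (vt : {set U} -> V).
Hypothesis vt_inj : forall F F', flat F -> flat F' -> (#|F| <= 9)%N -> (#|F'| <= 9)%N ->
  vt F = vt F' -> F = F'.
Local Notation low c := (match_of c).1.1.
Local Notation up c := (match_of c).1.2.
Local Notation rk c := (match_of c).2.
Local Notation sim := (sim vt).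

Lemma match_low_up (c : flag r) : c != (None, None, None) ->
  [\/ exists q ol oP, low c = (None, ol, oP) /\ up c = (Some q, ol, oP),
      exists oq l oP, low c = (oq, None, oP) /\ up c = (oq, Some l, oP) |
      exists oq ol P, low c = (oq, ol, None) /\ up c = (oq, ol, Some P)].
Proof.
case: c => -[[q|] [l|]] [P|] //= _; repeat (case: ifP => _);
  by [constructor 1; do 3 eexists | constructor 2; do 3 eexists | constructor 3; do 3 eexists].
Qed.

Lemma sim_neq0 c : valid c -> sim c != fset0.
Proof.
have ne v : v \in sim c -> sim c != fset0 by move=> cv; apply/fset0Pn; exists v.
case: c ne => -[[q|] [l|]] [P|] ne // _.
all: first [by apply: (ne (vt [set q])); rewrite in_simE !inE eqxx ?orbT
  | by apply: (ne (vt l)); rewrite in_simE !inE eqxx ?orbT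
  | by apply: (ne (vt P)); rewrite in_simE !inE eqxx ?orbT].
Qed.

Lemma match_sim c : c \in flags0 r -> c != origin_flag r ->
  sim (low c) != fset0 /\
  exists2 w, w \notin sim (low c) & sim (up c) = (w |` sim (low c))%fset.
Proof.
move=> Pc cb; have [/andP[lP _] /andP[uP _] _ _ _] := match_flags0 Pc cb.
have c0 : c != (None, None, None) by move: Pc; rewrite inE => /andP[/and5P[]].
move: lP uP; rewrite inE => /andP[vl _]; rewrite inE => /andP[vu _].
split; first exact: sim_neq0.
have [[q [ol [oP [lE uE]]]]|[oq [l [oP [lE uE]]]]|[oq [ol [P [lE uE]]]]] := match_low_up c0;
  rewrite lE uE in vl vu *.
- exists (vt [set q]); last exact: sim_add_point.
  by apply/negP => /(in_sim_point vt_inj vl).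
- exists (vt l); last exact: sim_add_line.
  by apply/negP => /(in_sim_line vt_inj vl (valid_fl vu)).
- exists (vt P); last exact: sim_add_plane.
  by apply/negP => /(in_sim_plane vt_inj vl (valid_fp vu)).
Qed.

(** The ranks order the matching rules: those involving a plane missing 0 have ranks 7 to 10, all
    others at most 6, and every coface of a lower simplex outside its pair falls under a rule of
    larger rank. Rank 10 can be the top because the remaining cofaces of a line and plane with
    [pt P \notin l] are precisely the critical flags. *)
Lemma match_rank c c' : c \in flags0 r -> c' \in flags0 r -> c != origin_flag r ->
  low c = c -> (sim c `<=` sim c')%fset -> c' != c -> c' != up c ->
  c' != origin_flag r /\ (rk c < rk c')%N.
Proof.
rewrite inE => /andP[vc _]; rewrite inE => /andP[vc' nc'] cb lc cc'.
have [h1 h2 h3] := sim_sub vt_inj vc vc' cc' => c'c c'u; split.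
  apply: contraNneq cb => c'b; apply/eqP; rewrite c'b in vc' h1 h2 h3 c'c.
  case: c vc h1 h2 h3 {lc cc' c'c c'u} => -[[q|] [l|]] [P|] //= _ h1 h2 h3.
  - by have := h2 _ erefl.
  - by have := h2 _ erefl.
  - by have := h3 _ erefl.
  - by have [<-] := h1 _ erefl.
  - by have := h2 _ erefl.
  - by have := h2 _ erefl.
  - by have := h3 _ erefl.
move: c' vc' nc' h1 h2 h3 c'c c'u {cc'} => -[[oq' ol'] oP'] /=.
case: c vc cb lc => -[[q|] [l|]] [P|] vc cb lc vc' nc' h1 h2 h3 c'c c'u.
(* A full flag is never the lower simplex of its pair. *)
- by exfalso; move: lc => /=; repeat (case: ifP => _).
- move: (h1 _ erefl) (h2 _ erefl) => e1 e2; subst oq' ol'.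
  have hl := valid_fl vc; have ql := valid_fql vc.
  have l0 : 0 \notin l.
    by apply/negP => l0; move: lc; rewrite /= l0 /=; case: ifP.
  case: oP' vc' nc' c'c c'u {h1 h2 h3} => [P|] vc' nc' c'c c'u; last by rewrite eqxx in c'c.
  have [_ _ _ /(_ P (valid_fp vc'))] := span0P hl l0.
  rewrite /= in c'u *; rewrite l0 /= in c'u *; case: (boolP (0 \notin P)) => P0.
    by do 2?case: ifP => // _.
  (* A plane through 0 containing [l] is [span0 l], so the flag would be [up c]. *)
  rewrite negbK in P0 => /(_ P0 (valid_flp vc')) PE; by rewrite PE eqxx in c'u.
- move: (h1 _ erefl) (h3 _ erefl) => e1 e3; subst oq' oP'.
  have hP := valid_fp vc; have qP := valid_fqp vc.
  case: ol' vc' nc' c'c c'u {h1 h2 h3} => [l|] vc' nc' c'c c'u; last by rewrite eqxx in c'c.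
  have hl := valid_fl vc'; have ql := valid_fql vc'; have lP := valid_flp vc'.
  move: lc c'u; rewrite /=; case: (boolP (0 \notin P)) => P0.
    case: eqVneq => // qp _ c'u; case: ifPn => // pl.
    by move: c'u; rewrite -(line_eq hl (neq_sym qp) pl ql) eqxx.
  case: eqVneq => //= q0 _ c'u; case: ifPn => //= l0; rewrite negbK in l0.
  by move: c'u; rewrite -(line_eq hl (neq_sym q0) l0 ql) eqxx.
- move: (h1 _ erefl) => e1; subst oq'.
  have q0 : q != 0 by apply: contraNneq cb => ->.
  case: oP' vc' nc' c'c c'u {h1 h2 h3 lc} => [P|] vc' nc' c'c c'u /=.
    case: (boolP (0 \notin P)) => P0; first by case: ol' {vc' nc' c'c c'u} => [l|]; repeat case: ifP => // _.
    by rewrite q0; case: ol' {vc' nc' c'c c'u} => [l|] //; case: ifP.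
  case: ol' vc' nc' c'c c'u => [l|] vc' nc' c'c c'u; last by rewrite eqxx in c'c.
  case: ifPn => //= l0; rewrite negbK in l0; move: c'u => /=.
  by rewrite -(line_eq (valid_fl vc') (neq_sym q0) l0 (valid_fql vc')) eqxx.
- move: (h2 _ erefl) (h3 _ erefl) => e2 e3; subst ol' oP'.
  case: oq' vc' nc' c'c c'u {h1 h2 h3} => [q|] vc' nc' c'c c'u; last by rewrite eqxx in c'c.
  move: lc c'u nc'; rewrite /=; case: (boolP (0 \notin P)) => P0.
    case: (boolP (pt P \in l)) => pl _ /=.
      by case: (eqVneq q (pt P)) => [->|//]; rewrite eqxx.
    (* The other points of [l] give critical flags, which [flags0] excludes. *)
    by case: (eqVneq q (pt l)) => [->|//]; rewrite eqxx.
  case: ifPn => //= l0 _; case: (eqVneq q 0) => [->|//]; by rewrite eqxx.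
- move: (h2 _ erefl) => e2; subst ol'; have hl := valid_fl vc.
  case: (boolP (0 \notin l)) => l0; rewrite /= in c'u lc *; rewrite ?l0 /= in c'u lc *.
    case: oP' vc' nc' c'c c'u {h1 h2 h3} => [P|] vc' nc' c'c c'u.
      have [_ _ _ /(_ P (valid_fp vc'))] := span0P hl l0.
      case: (boolP (0 \notin P)) => P0.
        by case: oq' {vc' nc' c'c c'u} => [q|]; repeat case: ifP => // _.
      rewrite negbK in P0 => /(_ P0 (valid_flp vc')) PE.
      by case: oq' vc' nc' c'c c'u => [//|] vc' nc' c'c; rewrite PE eqxx.
    by case: oq' vc' nc' c'c c'u => [//|] vc' nc'; rewrite eqxx.
  rewrite negbK in l0; rewrite ?l0 /= in c'u lc *.
  case: oP' vc' nc' c'c c'u {h1 h2 h3} => [P|] vc' nc' c'c c'u.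
    rewrite (subsetP (valid_flp vc') _ l0) /=.
    by case: oq' {vc' nc' c'c c'u} => [q|] //; case: ifP.
  case: oq' vc' nc' c'c c'u => [q|] vc' nc' c'c c'u; last by rewrite eqxx in c'c.
  by case: (eqVneq q 0) c'u => [->|//]; rewrite eqxx.
- move: (h3 _ erefl) => e3; subst oP'; have hP := valid_fp vc.
  case: (boolP (0 \notin P)) => P0; rewrite /= in c'u lc *; rewrite ?P0 /= in c'u lc *.
    case: ol' vc' nc' c'c c'u {h1 h2 h3} => [l|] vc' nc' c'c c'u.
      by case: oq' {vc' nc' c'c c'u} => [q|]; repeat case: ifP => // _.
    case: oq' vc' nc' c'c c'u => [q|] vc' nc' c'c c'u; last by rewrite eqxx in c'c.
    by case: (eqVneq q (pt P)) c'u => [->|//]; rewrite eqxx.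
  rewrite negbK in P0; rewrite ?P0 /= in c'u lc *.
  case: ol' vc' nc' c'c c'u {h1 h2 h3} => [l|] vc' nc' c'c c'u.
    by case: oq' {vc' nc' c'c c'u} => [q|]; repeat case: ifP => // _.
  case: oq' vc' nc' c'c c'u => [q|] vc' nc' c'c c'u; last by rewrite eqxx in c'c.
  by case: (eqVneq q 0) c'u => [->|//]; rewrite eqxx.
- by [].
Qed.

Lemma origin_flag_flags0 : origin_flag r \in flags0 r.
Proof. by rewrite inE. Qed.

Lemma flags_matching : ranked_matching sim (fun c => low c) (fun c => up c)
  (fun c => rk c) (origin_flag r) (flags0 r).
Proof.
split.
- exact: origin_flag_flags0.
- by move=> c Pc cb; have [/andP[]] := match_flags0 Pc cb.
- by move=> c Pc cb; have [_ /andP[]] := match_flags0 Pc cb.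
- by move=> c Pc cb; have [] := match_flags0 Pc cb.
- by move=> c Pc cb; have [_ _ _ -> _] := match_flags0 Pc cb.
- by move=> c Pc cb; have [_ _ _ _ ->] := match_flags0 Pc cb.
- exact: match_sim.
- exact: match_rank.
- move=> c c'; rewrite inE => /andP[vc _]; rewrite inE => /andP[vc' _].
  exact: (sim_inj vt_inj).
Qed.

End AffineMatchingAcyclic.

From mathcomp Require Import generic_quotient.
From mathcomp Require Import all_classical all_reals all_analysis homotopy.
From mathcomp Require Import lra.
Import numFieldNormedType.Exports.
Local Open Scope classical_set_scope.

(** * Universal properties of free groups and Burnside groups *)

Section FreeLift.
Context (I : choiceType) (H : groupType) (f : I -> H).
Local Open Scope group_scope.

Definition letter_val (x : I * bool) : H := if x.2 then (f x.1)^-1 else f x.1.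

Definition word_val (w : seq (I * bool)) : H :=
  foldr (fun x g => letter_val x * g) 1 w.

Definition free_lift (a : free_group I) : H := word_val (word a).

Lemma letter_val_inv x : letter_val (letter_inv x) = (letter_val x)^-1.
Proof. by case: x => i [] /=; rewrite /letter_val /= ?invgK. Qed.

Lemma word_val_push x w : word_val (push x w) = letter_val x * word_val w.
Proof.
case: w => [//|y w] /=; case: eqP => [->|//].
by rewrite letter_val_inv mulVKg.
Qed.

Lemma free_liftM a b : free_lift (a * b) = free_lift a * free_lift b.
Proof.
rewrite /free_lift /=; elim: (word a) => [|x u IH] /=; first by rewrite mul1g.
by rewrite word_val_push IH mulgA.
Qed.

Lemma free_lift1 : free_lift 1 = 1. Proof. by []. Qed.

Lemma free_liftV a : free_lift a^-1 = (free_lift a)^-1.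
Proof. by apply/esym/mulg1_eq; rewrite -free_liftM mulgV. Qed.

Lemma free_liftX a n : free_lift (a ^+ n) = free_lift a ^+ n.
Proof. by elim: n => [|n IH]; rewrite ?expg0// !expgS free_liftM IH. Qed.

End FreeLift.

Section BurnsideLift.
Context (r n : nat).
Local Open Scope group_scope.

Definition burnside_proj (a : free_group 'I_r) : burnside r n := quotient_proj _ a.

Lemma burnside_projM a b : burnside_proj (a * b) = burnside_proj a * burnside_proj b.
Proof. exact/esym/quotient_mulE. Qed.

Lemma burnside_proj1 : burnside_proj 1 = 1. Proof. by []. Qed.

Lemma burnside_projV a : burnside_proj a^-1 = (burnside_proj a)^-1.
Proof. by apply/esym/mulg1_eq; rewrite -burnside_projM mulgV. Qed.

Lemma burnside_projX a k : burnside_proj (a ^+ k) = burnside_proj a ^+ k.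
Proof. by elim: k => [|k IH]; rewrite ?expg0// !expgS burnside_projM IH. Qed.

Lemma burnside_projP (g : burnside r n) : exists a, g = burnside_proj a.
Proof. by exists (repr g); rewrite /burnside_proj quotient_repr. Qed.

Lemma burnside_exp (g : burnside r n) : g ^+ n = 1.
Proof.
have [a ->] := burnside_projP g; rewrite -burnside_projX -burnside_proj1.
apply/esym/quotient_projP; rewrite invg1 mul1g /=.
by apply: sub_gen_smallest; exists a.
Qed.

Definition burnside_gen (i : 'I_r) : burnside r n :=
  burnside_proj (@FreeGroup _ [:: (i, false)] isT).

Lemma burnside_gen_ind (P : set (burnside r n)) :
  subgroup P -> (forall i, P (burnside_gen i)) -> forall g, P g.
Proof.
move=> [P1 PM PV] Pgen g; have [a ->] := burnside_projP g; case: a => w rw.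
elim: w rw => [|x w IH] rw; first by rewrite (_ : FreeGroup rw = 1)//; exact: val_inj.
have rw' : reduced w by exact: path_sorted rw.
have -> : FreeGroup rw = @FreeGroup _ [:: x] isT * FreeGroup rw'.
  by apply: val_inj; rewrite /= push_cons.
rewrite burnside_projM; apply: PM; last exact: IH.
case: x {rw} => i [|]; last exact: Pgen.
rewrite (_ : FreeGroup _ = (@FreeGroup _ [:: (i, false)] isT)^-1); last exact: val_inj.
by rewrite burnside_projV; exact/PV/Pgen.
Qed.

Section Lift.
Context (H : groupType) (f : 'I_r -> H) (expH : forall x : H, x ^+ n = 1).

Definition burnside_lift (g : burnside r n) : H := free_lift f (repr g).

Lemma burnside_lift_proj a : burnside_lift (burnside_proj a) = free_lift f a.
Proof.
have : burnside_proj (repr (burnside_proj a)) = burnside_proj a by exact: quotient_repr.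
move=> /quotient_projP /=; rewrite /burnside_lift; set b := repr _ => ba.
suff : free_lift f (b^-1 * a) = 1.
  by rewrite free_liftM free_liftV => /mulg1_eq; rewrite invgK.
(* The kernel of [free_lift f] is a subgroup containing all [n]-th powers, hence contains the power
   subgroup; the choice made by [repr] is therefore harmless. *)
move: ba; apply: (@smallest_sub _ _ _ [set c | free_lift f c = 1]).
  split=> /= [|x y hx hy|x hx]; first exact: free_lift1.
  - by rewrite free_liftM hx hy mulg1.
  - by rewrite free_liftV hx invg1.
by move=> _ [x _ <-] /=; rewrite free_liftX expH.
Qed.

Lemma burnside_liftM : {morph burnside_lift : x y / x * y}.
Proof.
move=> x y; have [a ->] := burnside_projP x; have [b ->] := burnside_projP y.
by rewrite -burnside_projM !burnside_lift_proj free_liftM.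
Qed.

Lemma burnside_lift1 : burnside_lift 1 = 1.
Proof. by rewrite -burnside_proj1 burnside_lift_proj free_lift1. Qed.

Lemma burnside_lift_gen i : burnside_lift (burnside_gen i) = f i.
Proof. by rewrite burnside_lift_proj /free_lift /= mulg1. Qed.

Lemma burnside_liftV : {morph burnside_lift : x / x^-1}.
Proof. by move=> x; apply/esym/mulg1_eq; rewrite -burnside_liftM mulgV burnside_lift1. Qed.

End Lift.
End BurnsideLift.

(** * Finiteness of B(r,3) *)

Section ExponentThreeFinite.
Context (G : groupType).
Local Open Scope group_scope.
Hypothesis exp3 : forall x : G, x ^+ 3 = 1.

Fixpoint power_products (l : seq G) : set G :=
  if l is y :: l' then [set y ^+ k * p | k in `I_3 & p in power_products l']
  else [set 1].

Lemma power_products_finite l : finite_set (power_products l).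
Proof.
elim: l => [|y l IH] /=; first exact: finite_set1.
by apply: finite_image2 => //; exact: finite_II.
Qed.

Lemma power_products1 l : power_products l 1.
Proof.
elim: l => [//|y l IH] /=.
by exists 0%N => //; exists 1 => //; rewrite expg0 mulg1.
Qed.

Lemma power_products_sub l y : y \in l -> power_products l y.
Proof.
elim: l => [//|z l IH] /=; rewrite in_cons => /predU1P[->|/IH ly].
  by exists 1%N => //; exists 1; [exact: power_products1|rewrite expg1 mulg1].
by exists 0%N => //; exists y => //; rewrite expg0 mul1g.
Qed.

Lemma power_products_commute l x p :
  (forall y, y \in l -> commute x y) -> power_products l p -> commute x p.
Proof.
elim: l p => [|z l IH] p /= xl; first by move=> ->; exact: commute1.
case=> k _ [q lq <-]; apply: commuteM; first by apply/commuteX/xl; rewrite mem_head.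
by apply: IH lq => y ly; apply: xl; rewrite in_cons ly orbT.
Qed.

Lemma power_products_mul l : (forall x y, x \in l -> y \in l -> commute x y) ->
  forall p q, power_products l p -> power_products l q -> power_products l (p * q).
Proof.
elim: l => [_ p q /= -> ->|z l IH cl p q /=]; first by rewrite mulg1.
move=> [i _ [p' lp <-]] [j _ [q' lq <-]].
exists ((i + j) %% 3)%N; first by rewrite /= ltn_mod.
exists (p' * q').
  by apply: IH => // x y lx ly; apply: cl; rewrite in_cons ?lx ?ly orbT.
have -> : z ^+ ((i + j) %% 3) = z ^+ (i + j).
  by rewrite [in RHS](divn_eq (i + j) 3) expgnDr mulnC expgnA exp3 expg1n mul1g.
have : commute p' (z ^+ j).
  apply/commuteX/commute_sym/(power_products_commute _ lp) => y ly.
  by apply: cl; rewrite in_cons ?eqxx ?ly ?orbT.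
by rewrite /commute expgnDr -!mulgA => c; congr (_ * _); rewrite !mulgA c.
Qed.

(** The finitely many conjugates [x ^ h] with [h] in [H] commute, so their products form a finite
    abelian subgroup [N] normalized by [H]; the product of [H] and [N] is the subgroup sought.
    Adjoining the generators one by one then exhausts B(r,3). *)
Lemma finite_subgroup_adjoin (H : set G) x : subgroup H -> finite_set H ->
  exists K : set G, [/\ subgroup K, finite_set K, H `<=` K & K x].
Proof.
move=> [H1 HM HV] finH.
have [l lE] : exists l : seq G, [set x ^ h | h in H] = [set` l].
  by apply/finite_seqP/finite_image.
have memlP y : y \in l <-> exists2 h, H h & x ^ h = y.
  by rewrite (_ : y \in l <-> [set` l] y)// -lE.
pose N := power_products l.
have cl y z : y \in l -> z \in l -> commute y z.
  move=> /memlP[h _ <-] /memlP[k _ <-].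
  by apply: (normal_closure_commute exp3 (x := x)); exact: NormalClosureJ.
have NM : forall p q, N p -> N q -> N (p * q) by exact: power_products_mul.
have NV p : N p -> N p^-1 by move=> Np; rewrite -exp3_sqr//; exact: NM.
have NX p k : N p -> N (p ^+ k).
  move=> Np; elim: k => [|k IH]; first by rewrite expg0; exact: power_products1.
  by rewrite expgS; exact: NM.
have NJ p h : H h -> N p -> N (p ^ h).
  move=> Hh; suff NJ' (l' : seq G) : {subset l' <= l} ->
      forall p, power_products l' p -> N (p ^ h) by exact: NJ'.
  elim: l' => [_ q -> /=|y l' IH sub q /= [k _ [q' lq <-]]].
    by rewrite conj1g; exact: power_products1.
  rewrite (conjMg (y ^+ k)) conjXg; apply: NM; last first.
    by apply: IH => // z lz; apply: sub; rewrite in_cons lz orbT.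
  apply/NX/power_products_sub; have /memlP[k' Hk <-] := sub _ (mem_head _ _).
  by apply/memlP; exists (k' * h); [exact: HM|rewrite conjgM].
exists [set h * p | h in H & p in N]; split.
- split=> /= [|_ _ [h Hh [p Np <-]] [k Hk [q Nq <-]]|_ [h Hh [p Np <-]]].
  + by exists 1 => //; exists 1; [exact: power_products1|rewrite mulg1].
  + exists (h * k); first exact: HM.
    exists (p ^ k * q); first by apply: NM => //; exact: NJ.
    by rewrite -mulgA (mulgA k) -conjgC !mulgA.
  + exists h^-1; first exact: HV.
    exists (p^-1 ^ h^-1); first by apply: NJ; [exact: HV|exact: NV].
    by rewrite -conjgC invgM.
- exact/finite_image2/power_products_finite.
- by move=> h Hh; exists h => //; exists 1; [exact: power_products1|rewrite mulg1].
- exists 1 => //; exists x; last by rewrite mul1g.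
  by apply/power_products_sub/memlP; exists 1; rewrite ?conjg1.
Qed.

End ExponentThreeFinite.

Lemma burnside3_finite r : finite_set [set: burnside r 3].
Proof.
have [K [sK fK gK]] : exists K : set (burnside r 3),
    [/\ subgroup K, finite_set K & forall i : 'I_r, K (burnside_gen 3 i)].
  suff: forall s : seq 'I_r, exists K : set (burnside r 3),
      [/\ subgroup K, finite_set K & forall i, i \in s -> K (burnside_gen 3 i)].
    by move=> /(_ (enum 'I_r)) [K [? ? K3]]; exists K; split=> // i; apply: K3; rewrite mem_enum.
  elim=> [|i s [K [sK fK Ks]]].
    exists [set 1%g]; split=> //.
    by split=> [//|x y -> ->|x ->]; rewrite ?mulg1 ?invg1.
  have [L [sL fL KL Li]] :=
    finite_subgroup_adjoin (@burnside_exp r 3) (burnside_gen 3 i) sK fK.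
  by exists L; split=> // j; rewrite in_cons => /predU1P[->//|/Ks/KL].
by apply: sub_finite_set fK => g _; exact: (burnside_gen_ind sK gK).
Qed.

(* [Unip x1 x2 x3 p q u w] encodes the unipotent 5x5 matrix with rows
   (1,x1,p,q,w), (0,1,x2,x3,u), (0,0,1,0,x3), (0,0,0,1,-x2), (0,0,0,0,1).
   If [1 + n] is such a matrix then [n^3 = 0], whence exponent 3. *)
Section FreeBurnside33.
Local Open Scope ring_scope.
Local Notation F := 'F_3.

Record unip := Unip { ux1 : F; ux2 : F; ux3 : F; up : F; uq : F; uu : F; uw : F }.

Definition unip_tuple (x : unip) : F * F * F * F * F * F * F :=
  (ux1 x, ux2 x, ux3 x, up x, uq x, uu x, uw x).
Definition tuple_unip (t : F * F * F * F * F * F * F) : unip :=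
  let: (a, b, c, d, e, f, g) := t in Unip a b c d e f g.
Lemma unip_tupleK : cancel unip_tuple tuple_unip. Proof. by case. Qed.

HB.instance Definition _ := Choice.copy unip (can_type unip_tupleK).

Definition unip_mul (x y : unip) : unip :=
  Unip (ux1 x + ux1 y) (ux2 x + ux2 y) (ux3 x + ux3 y)
    (up x + up y + ux1 x * ux2 y) (uq x + uq y + ux1 x * ux3 y)
    (uu x + uu y + ux2 x * ux3 y - ux3 x * ux2 y)
    (uw x + uw y + ux1 x * uu y + up x * ux3 y - uq x * ux2 y).

Definition unip_one : unip := Unip 0 0 0 0 0 0 0.

Definition unip_inv (x : unip) : unip := unip_mul x x.

Lemma unip_mulA : associative unip_mul.
Proof.
move=> [a1 a2 a3 a4 a5 a6 a7] [b1 b2 b3 b4 b5 b6 b7] [c1 c2 c3 c4 c5 c6 c7].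
by rewrite /unip_mul /=; congr Unip; ring.
Qed.

Lemma unip_mul1 : left_id unip_one unip_mul.
Proof. by case=> *; rewrite /unip_mul /=; congr Unip; ring. Qed.

Lemma unip_mulr1 : right_id unip_one unip_mul.
Proof. by case=> *; rewrite /unip_mul /=; congr Unip; ring. Qed.

Lemma F3_mul3 (x : F) : 3%:R * x = 0.
Proof. by rewrite (_ : 3%:R = 0 :> F) ?mul0r//; exact/val_inj. Qed.

Lemma unip_mul_cube x : unip_mul x (unip_mul x x) = unip_one.
Proof.
case: x => a1 a2 a3 a4 a5 a6 a7; rewrite /unip_mul /unip_one /=.
(* Since [(1 + n)^3 = 1 + 3 (n + n^2)] when [n^3 = 0], the witnesses below are the entries of
   [n + n^2]. *)
have F3 (y z : F) : y = 3%:R * z -> y = 0 by rewrite F3_mul3.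
congr Unip.
- by apply: (F3 _ a1); ring.
- by apply: (F3 _ a2); ring.
- by apply: (F3 _ a3); ring.
- by apply: (F3 _ (a4 + a1 * a2)); ring.
- by apply: (F3 _ (a5 + a1 * a3)); ring.
- by apply: (F3 _ a6); ring.
- by apply: (F3 _ (a7 + a1 * a6 + a4 * a3 - a5 * a2)); ring.
Qed.

Lemma unip_mulV : left_inverse unip_one unip_inv unip_mul.
Proof. by move=> x; rewrite -unip_mulA unip_mul_cube. Qed.

Lemma unip_mulrV : right_inverse unip_one unip_inv unip_mul.
Proof. exact: unip_mul_cube. Qed.

HB.instance Definition _ := isGroup.Build unip
  unip_mulA unip_mul1 unip_mulr1 unip_mulV unip_mulrV.

Lemma unip_exp3 (x : unip) : (x ^+ 3)%g = 1%g.
Proof. exact: unip_mul_cube. Qed.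

(** The commutator [c] of [x] and [y] has its first three coordinates 0 and [up c = 1]. If it
    commuted with [z], comparing the corner entries [uw] would give [up c * ux3 z = 0]. *)
Lemma unip_class3 (x y z : unip) :
  [/\ ux1 x = 1, ux2 x = 0 & ux3 x = 0] -> [/\ ux1 y = 0, ux2 y = 1 & ux3 y = 0] ->
  [/\ ux1 z = 0, ux2 z = 0 & ux3 z = 1] -> [~ x, y, z]%g <> 1%g.
Proof.
move=> [x1 x2 x3] [y1 y2 y3] [z1 z2 z3] /eqP/commgP; move: (commgC x y); move: [~ x, y]%g => c h k.
have h1 : ux1 x + ux1 y = ux1 y + ux1 x + ux1 c := congr1 ux1 h.
have h2 : ux2 x + ux2 y = ux2 y + ux2 x + ux2 c := congr1 ux2 h.
have h3 : ux3 x + ux3 y = ux3 y + ux3 x + ux3 c := congr1 ux3 h.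
have h4 : up x + up y + ux1 x * ux2 y =
    up y + up x + ux1 y * ux2 x + up c + (ux1 y + ux1 x) * ux2 c := congr1 up h.
have h7 : uw c + uw z + ux1 c * uu z + up c * ux3 z - uq c * ux2 z =
    uw z + uw c + ux1 z * uu c + up z * ux3 c - uq z * ux2 c := congr1 uw k.
move: h1 h2 h3 h4 h7; rewrite x1 x2 x3 y1 y2 y3 z1 z2 z3 => h1 h2 h3 h4 h7.
have c0 (a b d : F) : a + b = b + a + d -> d = 0.
  by rewrite (addrC b) -[X in X = _]addr0 => /addrI.
rewrite (c0 _ _ _ h1) (c0 _ _ _ h2) (c0 _ _ _ h3) in h4 h7.
have c4 : up c = 1.
  move: h4; rewrite !mulr0 mulr1 !addr0 (addrC (up y)).
  by move=> /addrI.
move: h7; rewrite c4 !mul0r !mulr0 !subr0 !addr0 mulr1 (addrC (uw z)).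
by rewrite -[RHS]addr0 => /addrI/eqP; rewrite oner_eq0.
Qed.
End FreeBurnside33.

(** * Triple commutators as alternating forms on the abelianization *)

Section Abelianization.
Context (r : nat).
Local Notation G := (burnside r 3).
Local Notation U := 'rV['F_3]_r.
Local Notation exp3 := (@burnside_exp r 3).

Lemma rV3_exp (u : U) : (u ^+ 3)%g = 1%g.
Proof.
change (u + (u + u) = 0)%R.
by apply/rowP => i; rewrite !mxE -(F3_mul3 (u ord0 i)) -mulr_natl; ring.
Qed.

Definition abelianization : G -> U :=
  burnside_lift (fun i => delta_mx ord0 i).
Local Notation pi := abelianization.

Lemma abelianizationM x y : pi (x * y)%g = (pi x + pi y)%R.
Proof. exact: burnside_liftM rV3_exp _ _. Qed.

Lemma abelianization1 : pi 1%g = 0%R.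
Proof. exact: burnside_lift1 rV3_exp. Qed.

Lemma abelianizationV x : pi x^-1%g = (- pi x)%R.
Proof. exact: burnside_liftV rV3_exp _. Qed.

Lemma abelianizationX x n : pi (x ^+ n)%g = (pi x *+ n)%R.
Proof.
elim: n => [|n IH]; first by rewrite expg0 abelianization1.
by rewrite expgS abelianizationM IH mulrS.
Qed.

Lemma abelianization_gen i : pi (burnside_gen 3 i) = delta_mx ord0 i.
Proof. exact: burnside_lift_gen rV3_exp _. Qed.

Lemma F3_scale (a : 'F_3) (u : U) : (a *: u = u *+ a)%R.
Proof. by rewrite -[in LHS](natr_Zp a) scaler_nat. Qed.

Lemma abelianization_surj u : exists g, pi g = u.
Proof.
exists (\prod_(i < r) burnside_gen 3 i ^+ (u ord0 i))%g.
rewrite [RHS]row_sum_delta.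
apply: (big_ind2 (fun g v => pi g = v)); first exact: abelianization1.
- by move=> x _ y _ <- <-; rewrite abelianizationM.
- by move=> i _; rewrite abelianizationX abelianization_gen F3_scale.
Qed.

(** For fixed [x] and [y], [[~ x, y, g]] is multiplicative in [g] and its values on the generators
    commute and have exponent 3. It is thus the product of these values raised to the coordinates of
    [pi g]. *)
Lemma commg_abelianization x y z : pi z = 0%R -> [~ x, y, z]%g = 1%g.
Proof.
pose c i := [~ x, y, burnside_gen 3 i]%g.
have cc i j : commute (c i) (c j).
  by apply: (normal_closure_commute exp3 (x := x));
    do 2 apply: normal_closure_commg; exact: normal_closure_self.
have key g : [~ x, y, g]%g = (\prod_(i < r) c i ^+ (pi g ord0 i))%g.
  have M (a b : G) :
      [~ x, y, a]%g = (\prod_(i < r) c i ^+ (pi a ord0 i))%g ->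
      [~ x, y, b]%g = (\prod_(i < r) c i ^+ (pi b ord0 i))%g ->
      [~ x, y, (a * b)%g]%g = (\prod_(i < r) c i ^+ (pi (a * b)%g ord0 i))%g.
    move=> ha hb; rewrite exp3_commgM ?ha ?hb; last exact: burnside_exp.
    rewrite -prodgM_commute; last by move=> i j _ _; exact: commuteX2.
    apply: eq_bigr => i _; rewrite abelianizationM mxE /= -expgnDr.
    (* Coordinates add modulo 3, which the exponent of [c i] absorbs. *)
    rewrite [in LHS](divn_eq (_ + _) 3) expgnDr mulnC expgnA.
    by rewrite (exp3 (c i)) expg1n mul1g.
  apply: (@burnside_gen_ind r 3 [set g | [~ x, y, g]%g =
    (\prod_(i < r) c i ^+ (pi g ord0 i))%g]) => /=.
    split=> //= [|a ha].
      rewrite commg1 big1// => i _; rewrite abelianization1 mxE expg0//.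
    by rewrite -(exp3_sqr exp3); exact: M.
  move=> j; rewrite abelianization_gen.
  rewrite (eq_bigr (fun i => if i == j then c i else 1%g)); last first.
    by move=> i _; rewrite mxE eqxx /=; case: (i == j).
  by rewrite -big_mkcond big_pred1_eq.
move=> z0; rewrite key big1// => i _; by rewrite z0 mxE expg0.
Qed.

(** If the coefficient [c] of [z] is nonzero, [x ^+ a * y ^+ b * z ^+ c] dies in the abelianization,
    and its commutator with [[~ x, y]] reduces to [[~ x, y, z] ^+ c] because repeated arguments
    vanish. Otherwise the arguments are permuted to bring a nonzero coefficient last. *)
Lemma commg_dependent x y z : ~ independent3 (pi x) (pi y) (pi z) ->
  [~ x, y, z]%g = 1%g.
Proof.
have key (a b c : 'F_3) (x' y' z' : G) : c != 0%R ->
    (a *: pi x' + b *: pi y' + c *: pi z' = 0)%R -> [~ x', y', z']%g = 1%g.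
  move=> c0; rewrite !F3_scale -!abelianizationX -!abelianizationM.
  move=> /(@commg_abelianization x' y'); rewrite !(exp3_commgM exp3) !(exp3_commgX exp3).
  rewrite exp3_engel ?(exp3_commg_cycle exp3 x' y' x') ?exp3_engel ?expg1n; try exact: exp3.
  rewrite !mul1g; case: c c0 => -[//|[//|[|//]]] ? _ /=.
  by move=> h; apply: invg_inj; rewrite -(exp3_sqr exp3) invg1; exact: h.
move=> /existsNP[a /existsNP[b /existsNP[c /not_implyP[abc nabc]]]].
have [c0|c0] := eqVneq c 0%R; last exact: (key a b c).
have [b0|b0] := eqVneq b 0%R.
  have a0 : a != 0%R by apply/negP => /eqP a0; apply: nabc.
  rewrite (exp3_commg_cycle exp3); apply: (key b c a) => //.
  by rewrite addrC addrA.
rewrite (exp3_commg_swap23 exp3); rewrite (key a c b) ?invg1//.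
by rewrite addrAC.
Qed.

(** A right inverse [B] of the matrix with rows [pi x], [pi y], [pi z] acts as a change of
    coordinates: sending generator [i] to the unipotent element whose first coordinates are row [i]
    of [B] maps [x], [y], [z] to elements whose first coordinates form the standard basis. *)
Lemma commg_independent x y z : independent3 (pi x) (pi y) (pi z) ->
  [~ x, y, z]%g <> 1%g.
Proof.
move=> ind; pose v (i : 'I_3) := tnth [tuple pi x; pi y; pi z] i.
pose M := (\matrix_(i < 3) v i)%R.
have [B MB] : exists B, (M *m B = 1%:M)%R.
  apply/row_freeP; rewrite -kermx_eq0; apply/rowV0P => w /sub_kermxP wM.
  have : (w ord0 ord0 *: pi x + w ord0 1%R *: pi y + w ord0 2%R *: pi z = 0)%R.
    rewrite -wM; apply/rowP => j; rewrite !mxE !big_ord_recl big_ord0 addr0 addrA !mxE /=.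
    congr (_ + _ * _ + _ * _)%R; congr (w _ _); exact/val_inj.
  move=> /ind[w0 w1 w2]; apply/rowP => -[[|[|[|//]]] i3]; rewrite mxE -[RHS]/0%R.
  - by rewrite -[RHS]w0; congr (w _ _); exact/val_inj.
  - by rewrite -[RHS]w1; congr (w _ _); exact/val_inj.
  - by rewrite -[RHS]w2; congr (w _ _); exact/val_inj.
pose f i := Unip (B i ord0) (B i 1%R) (B i 2%R) 0%R 0%R 0%R 0%R.
pose th := @burnside_lift r 3 unip f.
have thM : {morph th : a b / (a * b)%g} by exact: burnside_liftM unip_exp3.
have thV : {morph th : a / (a^-1)%g} by exact: burnside_liftV unip_exp3.
have th1 : th 1%g = 1%g by exact: burnside_lift1 unip_exp3.
have thE (p : unip -> 'F_3) (k : 'I_3) :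
    (forall c d : unip, p (c * d)%g = p c + p d)%R -> (forall i, p (f i) = B i k) ->
    forall g, p (th g) = (pi g *m B)%R ord0 k.
  move=> pM pf.
  have p1 : p 1%g = 0%R by apply: (addrI (p 1%g)); rewrite -pM mulg1 addr0.
  apply: (@burnside_gen_ind r 3 [set g | p (th g) = (pi g *m B)%R ord0 k]) => /=.
    have thpM (a b : G) :
        p (th a) = (pi a *m B)%R ord0 k -> p (th b) = (pi b *m B)%R ord0 k ->
        p (th (a * b)%g) = (pi (a * b)%g *m B)%R ord0 k.
      by move=> pa pb; rewrite thM pM pa pb abelianizationM mulmxDl [RHS]mxE.
    split=> //= [|a ha]; first by rewrite th1 p1 abelianization1 mul0mx mxE.
    by rewrite -(exp3_sqr exp3); exact: thpM.
  move=> i; rewrite /th burnside_lift_gen; last exact: unip_exp3.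
  by rewrite pf abelianization_gen -rowE mxE.
have MBE (i k : 'I_3) : (v i *m B)%R ord0 k = (i == k)%:R%R.
  by have := congr1 (fun A : 'M['F_3]_3 => A i k) MB; rewrite -(rowK v i) -/M -row_mul !mxE.
have e1 := thE ux1 ord0 (fun _ _ => erefl) (fun=> erefl).
have e2 := thE ux2 1%R (fun _ _ => erefl) (fun=> erefl).
have e3 := thE ux3 2%R (fun _ _ => erefl) (fun=> erefl).
have thR a b : th [~ a, b]%g = [~ th a, th b]%g.
  by rewrite !commgEl !conjgE !thM !thV.
have := @unip_class3 (th x) (th y) (th z).
rewrite !e1 !e2 !e3.
rewrite -[pi x]/(v ord0) -[pi y]/(v 1%R) -[pi z]/(v 2%R) !MBE => /=.
move=> h xyz1; apply: h => //.
by rewrite -!thR xyz1 th1.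
Qed.

Lemma nilpotent2P (H : set G) : subgroup H ->
  nilpotent_subgroups G 2 H <->
  (forall x y z, H x -> H y -> H z -> ~ independent3 (pi x) (pi y) (pi z)).
Proof.
move=> sH; have [H1 HM HV] := sH; split.
  move=> [_ H2] x y z Hx Hy Hz /commg_independent; apply.
  suff : lower_central H 2 [~ x, y, z]%g by rewrite H2.
  apply: sub_gen_smallest; exists ([~ x, y]%g, z) => //; split => //=.
  by apply: sub_gen_smallest; exists (x, y).
move=> dep; split=> //; apply/seteqP; split=> [g|_ ->]; last first.
  by have [] := generated_subgroup [set [~ p.1, p.2]%g | p in (lower_central H 1) `*` H].
apply: (@smallest_sub _ _ _ [set 1%g]).
  by split=> [//|x y -> ->|x ->]; rewrite /= ?mulg1 ?invg1.
move=> _ [[c z] [/= Hc Hz] <-]; apply/eqP/commgP; move: c Hc.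
apply: (@smallest_sub _ _ _ [set c | commute c z]).
  split=> /= [|x y hx hy|x hx]; first exact/commute_sym/commute1.
  - by apply/commute_sym/commuteM; exact/commute_sym.
  - by apply/commute_sym/commuteV/commute_sym.
move=> _ [[x y] [/= Hx Hy] <-]; apply/commgP/eqP/commg_dependent.
exact: dep.
Qed.
End Abelianization.

(** * Cosets of subgroups of class at most 2 and their images as flats *)

Section CosetFlats.
Context (r : nat).
Local Notation G := (burnside r 3).
Local Notation U := 'rV['F_3]_r.
Local Notation pi := (@abelianization r).
Local Notation C := (coset_poset (nilpotent_subgroups G 2)).
Implicit Types (F : {set U}) (v w : C).

Definition abel_image (S : set G) : {set U} :=
  [set u | `[< exists2 g, S g & pi g = u >]]%SET.

Lemma abel_imageP (S : set G) u : u \in abel_image S <-> exists2 g, S g & pi g = u.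
Proof. by rewrite inE; split=> [/asboolP|?]; last exact/asboolP. Qed.

Definition abel_preimage F : set G := [set g | pi g \in F].

Lemma abel_imageK F : abel_image (abel_preimage F) = F.
Proof.
apply/setP => u; apply/idP/idP => [/abel_imageP[g Fg <-]//|Fu].
have [g gu] := abelianization_surj u; apply/abel_imageP; exists g => //.
by rewrite /abel_preimage /= gu.
Qed.

Lemma coset_image (S : set G) : is_coset_of (nilpotent_subgroups G 2) S ->
  flat (abel_image S) /\ (#|abel_image S| <= 9)%N.
Proof.
move=> [g [H [nH ->]]]; have [sH _] := nH; have [H1 HM HV] := sH.
have memW u : u \in abel_image H <-> exists2 h, H h & pi h = u by exact: abel_imageP.
have memC u : u \in abel_image (lcoset g H) <-> (u - pi g)%R \in abel_image H.
  split=> [/abel_imageP[_ [h Hh <-] <-]|/memW[h Hh hu]].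
    by apply/memW; exists h; rewrite // abelianizationM addrC addKr.
  apply/abel_imageP; exists (g * h)%g; first by exists h.
  by rewrite abelianizationM hu addrC subrK.
have W0 : 0%R \in abel_image H by apply/memW; exists 1%g => //; exact: abelianization1.
have WD a b : a \in abel_image H -> b \in abel_image H -> (a + b)%R \in abel_image H.
  move=> /memW[h Hh <-] /memW[k Hk <-]; apply/memW; exists (h * k)%g; first exact: HM.
  exact: abelianizationM.
have WN a : a \in abel_image H -> (- a)%R \in abel_image H.
  by move=> Wa; rewrite rV3_opp; exact: WD.
have CE : abel_image (lcoset g H) = [set (x + pi g)%R | x in abel_image H]%SET.
  apply/setP => u; apply/idP/imsetP => [/memC Wu|[x Wx ->]].
    by exists (u - pi g)%R; rewrite // subrK.
  by apply/memC; rewrite addrK.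
split.
  apply/flatP; split; first by exists (pi g); apply/memC; rewrite subrr.
  move=> a b /memC Wa /memC Wb; apply/memC.
  (* In characteristic 3, [- pi g] is [pi g + pi g]. *)
  have -> : (- a - b - pi g = - (a - pi g) - (b - pi g))%R.
    by rewrite !opprB [RHS]addrACA addrC (rV3_opp (pi g)).
  by apply: WD; exact: WN.
rewrite CE card_imset; last exact: addIr.
apply/subgroup_independent3 => // a b c /memW[x Hx <-] /memW[y Hy <-] /memW[z Hz <-].
by have /(nilpotent2P sH) := nH; exact.
Qed.

(** The criterion for class at most 2 depends only on images under [pi], so the full preimage of the
    direction space [W] still satisfies it. This is what allows every coset in the poset to be
    enlarged to a saturated one. *)
Lemma flat_coset F : flat F -> (#|F| <= 9)%N ->
  is_coset_of (nilpotent_subgroups G 2) (abel_preimage F).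
Proof.
move=> fF F9; have /flatP[[a Fa] FF] := fF; have [g ga] := abelianization_surj a.
pose W : {set U} := [set (x - a)%R | x in F]%SET.
have memW (u : U) : u \in W = ((u + a)%R \in F).
  apply/imsetP/idP => [[x Fx ->]|Fu]; first by rewrite subrK.
  by exists (u + a)%R; rewrite // addrK.
have W0 : 0%R \in W by rewrite memW add0r.
have WD (a' b' : U) : a' \in W -> b' \in W -> (a' + b')%R \in W.
  rewrite !memW => Fu Fv; have := flat_add3 fF Fu Fv Fa.
  by rewrite addrACA addrA addrK.
have WN (u : U) : u \in W -> (- u)%R \in W by move=> Wu; rewrite rV3_opp; exact: WD.
exists g, (abel_preimage W); split.
  have sW : subgroup (abel_preimage W).
    split=> [|x y Wx Wy|x Wx]; rewrite /abel_preimage /=.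
    - by rewrite abelianization1.
    - by rewrite abelianizationM; exact: WD.
    - by rewrite abelianizationV; exact: WN.
  apply/(nilpotent2P sW) => x y z Wx Wy Wz.
  have W9 : (#|W| <= 9)%N by rewrite card_imset//; exact: addIr.
  by move/(subgroup_independent3 W0 WD): W9; exact.
apply/seteqP; split=> [h Fh|_ [h Wh <-]].
  exists (g^-1 * h)%g; last by rewrite mulVKg.
  rewrite /abel_preimage /= memW abelianizationM abelianizationV ga addrC addNKr.
  exact: Fh.
by move: Wh; rewrite /abel_preimage /= memW abelianizationM ga addrC.
Qed.

Lemma coset_poset_le v w : (v <= w)%O = `[< val v `<=` val w >].
Proof. by rewrite leEsub. Qed.

Lemma coset_poset_finite : exists E : {fset C}, forall v, v \in E.
Proof.
have /finite_seqP[s sE] := burnside3_finite r.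
pose f v : (size s).-tuple bool := [tuple `[< val v (tnth (in_tuple s) i) >] | i < size s].
have f_sub v w : f v = f w -> val v `<=` val w.
  move=> vw g vg; have gs : g \in in_tuple s.
    suff : [set` s] g by [].
    by rewrite -sE.
  have [i gi] := tnthP _ _ gs.
  have := congr1 (fun t => tnth t i) vw; rewrite !tnth_mktuple -gi => e.
  by apply/asboolP; rewrite -e; apply/asboolP.
have f_inj : injective f.
  by move=> v w vw; apply: val_inj; apply/seteqP; split; exact: f_sub.
have : finite_set (f @^-1` setT).
  by apply: finite_preimage => [v w _ _|]; [exact: f_inj|exact: finite_finset].
rewrite preimage_setT => /finite_fsetP[E EE]; exists E => v.
by have : [set: C] v by []; rewrite EE.
Qed.

End CosetFlats.

Local Open Scope ring_scope.

(** * Pointwise continuity and realizations on finitely many vertices *)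

Lemma ptws_continuous (T S : topologicalType) (V : eqType) (h : T -> {ptws V -> S}) :
  (forall v, continuous (fun t => h t v)) -> continuous h.
Proof.
move=> ch x; apply/cvg_sup => v; move: x.
apply/(@continuousP _ (initial_topology (fun f : V -> S => f v))) => A [B oB <-].
exact: (open_comp _ oB).
Qed.

Lemma eval_continuous (S : topologicalType) (V : eqType) (v : V) :
  continuous (fun f : {ptws V -> S} => f v).
Proof. exact: (@proj_continuous V (fun=> S) v). Qed.

Lemma sum_continuous (R : realType) (T : topologicalType) (I : Type) (s : seq I) (P : pred I)
    (f : I -> T -> R) :
  (forall i, continuous (f i)) -> continuous (fun t => \sum_(i <- s | P i) f i t).
Proof.
move=> cf; apply: (@continuous_big R I) => //.
by move=> [a b]; apply: cvgD; [exact: cvg_fst|exact: cvg_snd].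
Qed.

Section FiniteRealization.
Context (R : realType) (V : choiceType) (K : set {fset V}) (E : {fset V}).
Hypothesis allE : forall v, v \in E.
Hypothesis Ksub : forall s t : {fset V}, K s -> t != fset0 -> (t `<=` s)%fset -> K t.
Local Notation X := (realization R K).
Implicit Types (x y : X) (s t : {fset V}).

Definition supp (x : V -> R) : {fset V} := [fset v in E | x v != 0]%fset.

Lemma in_supp (x : V -> R) v : (v \in supp x) = (x v != 0).
Proof. by rewrite !inE allE. Qed.

Lemma sum_supp (x : V -> R) s : (supp x `<=` s)%fset ->
  \sum_(v <- s) x v = \sum_(v <- supp x) x v.
Proof.
by move=> xs; rewrite (big_fset_incl _ xs)// => v _; rewrite in_supp negbK => /eqP.
Qed.

Lemma suppE (x : V -> R) : (supp x `<=` E)%fset.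
Proof. by apply/fsubsetP => v _; exact: allE. Qed.

Lemma sum_E (x : V -> R) s : (supp x `<=` s)%fset -> \sum_(v <- E) x v = \sum_(v <- s) x v.
Proof. by move=> xs; rewrite (sum_supp xs) (sum_supp (suppE x)). Qed.

Lemma closed_simplexP s (x : V -> R) :
  closed_simplex s x <->
  [/\ forall v, 0 <= x v, \sum_(v <- E) x v = 1 & (supp x `<=` s)%fset].
Proof.
split=> [[x0 xs x1]|[x0 x1 xs]].
  have ss : (supp x `<=` s)%fset.
    by apply/fsubsetP => v; rewrite in_supp; apply: contra_neqT => /xs.
  by split=> //; rewrite (sum_E ss).
split=> // [v vs|]; last by rewrite -(sum_E xs).
by apply/eqP; apply: contraNT vs; rewrite -in_supp; exact: (fsubsetP xs).
Qed.

Lemma real_ge0 x v : 0 <= x v.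
Proof. by have [s _ /closed_simplexP[]] := realizationP x. Qed.

Lemma real_sum1 x : \sum_(v <- E) x v = 1.
Proof. by have [s _ /closed_simplexP[]] := realizationP x. Qed.

Lemma supp_neq0 (x : V -> R) : \sum_(v <- E) x v = 1 -> supp x != fset0.
Proof.
move=> x1; apply/negP => /eqP x0; move: x1; rewrite (sum_supp (suppE x)) x0 big_seq_fset0.
by move/eqP; rewrite eq_sym oner_eq0.
Qed.

Lemma real_supp x : K (supp x).
Proof.
have [s Ks /closed_simplexP[_ x1 xs]] := realizationP x.
exact: Ksub Ks (supp_neq0 x1) xs.
Qed.

Lemma mk_real_subproof (x : V -> R) : (forall v, 0 <= x v) ->
  \sum_(v <- E) x v = 1 -> K (supp x) -> exists2 s, K s & closed_simplex s x.
Proof. by move=> x0 x1 xK; exists (supp x) => //; apply/closed_simplexP; split. Qed.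

Definition mk_real (x : V -> R) (x0 : forall v, 0 <= x v)
    (x1 : \sum_(v <- E) x v = 1) (xK : K (supp x)) : X :=
  Realization (mk_real_subproof x0 x1 xK).

Lemma real_inj x y : (forall v, x v = y v) -> x = y.
Proof.
case: x y => [x px] [y py] /= /funext xy; case: _ / xy in py *.
by congr Realization; exact: Prop_irrelevance.
Qed.

Lemma real_le1 x v : x v <= 1.
Proof.
rewrite -(real_sum1 x) (big_fsetD1 v)//= lerDl.
by apply: sumr_ge0 => u _; exact: real_ge0.
Qed.

Lemma real_openE (U : set X) : open U = realization_open U.
Proof. by []. Qed.

Lemma coord_continuous v : continuous (fun x => x v).
Proof.
apply/continuousP => A oA; rewrite real_openE => s Ks.
exists [set f : {ptws V -> R} | A (f v)] => //.
by apply: (open_comp _ oA) => f _; exact: eval_continuous.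
Qed.

Lemma closed_closed_simplex s : closed (closed_simplex s : set {ptws V -> R}).
Proof.
rewrite (_ : closed_simplex s =
  (\bigcap_v [set f : {ptws V -> R} | 0 <= f v]) `&`
  ((\bigcap_(v in [set v | v \notin s]) [set f : {ptws V -> R} | f v = 0]) `&`
  [set f : {ptws V -> R} | \sum_(v <- s) f v = 1])); last first.
  apply/seteqP; split=> f /= [f0].
    by move=> fs f1; split=> // v _; exact: f0.
  by case=> fs f1; split=> // v; exact: f0.
apply: closedI; first apply: closed_bigI => v _.
  apply: (@preimage_closed _ _ (fun f : {ptws V -> R} => f v) [set y | 0 <= y]).
    by move=> f _; exact: eval_continuous.
  exact: closed_ge.
apply: closedI; first apply: closed_bigI => v _.
  apply: (@preimage_closed _ _ (fun f : {ptws V -> R} => f v) [set y | y = 0]).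
    by move=> f _; exact: eval_continuous.
  exact: closed_eq.
apply: (@preimage_closed _ _ (fun f : {ptws V -> R} => \sum_(v <- s) f v) [set y | y = 1]).
  by move=> f _; apply: sum_continuous => v; exact: eval_continuous.
exact: closed_eq.
Qed.

(** There are finitely many simplices, so the preimage of a closed set is a finite union of
    preimages of closed sets of [{ptws V -> R}], one for each simplex. Maps into the weak topology
    can therefore be tested coordinate by coordinate. *)
Lemma real_continuous (T : topologicalType) (h : T -> X) :
  (forall v, continuous (fun u : T => h u v)) -> continuous h.
Proof.
move=> ch; apply/continuous_closedP => C cC.
have /choice[W WP] : forall s, exists W : set {ptws V -> R},
    closed W /\ (K s -> forall x, closed_simplex s x -> C x <-> W x).
  move=> s; have [Ks|nKs] := pselect (K s); last by exists set0; split=> //; exact: closed0.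
  have oC : open (~` C) by rewrite openC.
  have oC' : realization_open (~` C) by rewrite -real_openE.
  have [W oW WE] := oC' s Ks; exists (~` W); split; first by rewrite closedC.
  move=> _ x xs; split=> [Cx /(WE x xs)//|nWx].
  by apply: contrapT => nCx; exact/nWx/(WE x xs).
pose h' : T -> {ptws V -> R} := fun u : T => h u : V -> R.
have ch' : continuous h' by exact: ptws_continuous.
rewrite (_ : h @^-1` C = \bigcup_(s in [set` [fset s in fpowerset E | `[< K s >]]%fset])
    (h' @^-1` (W s `&` closed_simplex s))); last first.
  apply/seteqP; split=> t /=.
    move=> Ct; have xs : closed_simplex (supp (h t)) (h t).
      apply/closed_simplexP; split=> //; first exact: real_ge0.
      exact: real_sum1.
    exists (supp (h t)); first by rewrite /= !inE fpowersetE suppE; apply/asboolP/real_supp.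
    by split=> //; apply/((WP _).2 (real_supp _)).
  move=> [s]; rewrite /= !inE => /andP[_ /asboolP Ks] [Wt st].
  exact/((WP s).2 Ks).
rewrite bigcup_fset; apply: closed_bigsetU => s _.
apply: preimage_closed => [t _|]; first exact: ch'.
by apply: closedI; [case: (WP s)|exact: closed_closed_simplex].
Qed.

Definition in_complex (B : set {fset V}) : set X := [set x | B (supp x)].

(** The closed simplices of [B] form a closed subset [D] of a product of unit intervals, compact by
    Tychonoff, and the set in question is its continuous image. *)
Lemma in_complex_compact (B : set {fset V}) : B `<=` K ->
  (forall s t : {fset V}, B s -> t != fset0 -> (t `<=` s)%fset -> B t) ->
  compact (in_complex B).
Proof.
move=> BK Bsub.
pose D := \bigcup_(s in [set` [fset s in fpowerset E | `[< B s >]]%fset])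
  (closed_simplex s : set {ptws V -> R}).
have [[x0 _]|nX] := pselect (exists x : X, True); last first.
  rewrite (_ : in_complex B = set0); first exact: compact0.
  by apply/seteqP; split=> x // _; apply: nX; exists x.
(* Off the simplices of [K] the value [x0] is arbitrary; continuity is claimed only on the subspace
   [D]. *)
pose g (f : {ptws V -> R}) : X :=
  if pselect (exists2 s, K s & closed_simplex s f) is left p then Realization p else x0.
have DP f : D f -> exists2 s, B s & closed_simplex s f.
  by move=> [s]; rewrite /= !inE => /andP[_ /asboolP Bs] fs; exists s.
have gE f : D f -> forall v, g f v = f v.
  move=> /DP[s Bs fs] v; rewrite /g; case: pselect => // nf.
  by exfalso; apply: nf; exists s => //; exact: BK.
rewrite (_ : in_complex B = g @` D); last first.
  apply/seteqP; split=> [x Bx|_ [f Df <-]].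
    have Dx : D (x : V -> R).
      exists (supp x); first by rewrite /= !inE fpowersetE suppE; apply/asboolP.
      by apply/closed_simplexP; split=> //; [exact: real_ge0|exact: real_sum1].
    by exists (x : V -> R) => //; apply: real_inj => v; rewrite gE.
  have [s Bs /closed_simplexP[_ f1 fs]] := DP _ Df.
  rewrite /in_complex /= (_ : supp (g f) = supp f).
    exact: Bsub Bs (supp_neq0 f1) fs.
  by apply/fsetP => v; rewrite !in_supp gE.
apply: continuous_compact.
  apply: (@real_continuous (subspace D) g) => v.
  apply: (@subspace_eq_continuous _ D _ (fun f : {ptws V -> R} => f v)).
    by move=> f Df /=; rewrite gE//; exact: set_mem.
  by apply: continuous_subspaceT => f; exact: eval_continuous.
have cube : compact [set f : {ptws V -> R} | forall v, `[0%R, 1%R]%classic (f v)].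
  apply: (@tychonoff V (fun=> R) (fun=> `[0%R, 1%R]%classic)) => v.
  exact: segment_compact.
apply: subclosed_compact cube _.
  rewrite /D bigcup_fset; apply: closed_bigsetU => s _; exact: closed_closed_simplex.
move=> f /DP[s Bs fs] v /=; rewrite in_itv /=.
have := real_ge0 (Realization (ex_intro2 _ _ s (BK _ Bs) fs)) v.
have := real_le1 (Realization (ex_intro2 _ _ s (BK _ Bs) fs)) v.
by move=> /= -> ->.
Qed.

End FiniteRealization.

Section ContinuousOperations.
Context (R : realType) (T : topologicalType).
Implicit Types f g : T -> R.

Lemma continuousD_fun f g : continuous f -> continuous g ->
  continuous (fun z => f z + g z).
Proof. by move=> cf cg z; apply: cvgD; [exact: cf|exact: cg]. Qed.

Lemma continuousB_fun f g : continuous f -> continuous g ->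
  continuous (fun z => f z - g z).
Proof. by move=> cf cg z; apply: cvgB; [exact: cf|exact: cg]. Qed.

Lemma continuousM_fun f g : continuous f -> continuous g ->
  continuous (fun z => f z * g z).
Proof. by move=> cf cg z; apply: cvgM; [exact: cf|exact: cg]. Qed.

Lemma continuous_min_fun f g : continuous f -> continuous g ->
  continuous (fun z => Num.min (f z) (g z)).
Proof. by move=> cf cg z; apply: continuous_min; [exact: cf|exact: cg]. Qed.

Lemma continuous_max_fun f g : continuous f -> continuous g ->
  continuous (fun z => Num.max (f z) (g z)).
Proof. by move=> cf cg z; apply: continuous_max; [exact: cf|exact: cg]. Qed.

Lemma continuous_cst_fun (c : R) : continuous (fun _ : T => c).
Proof. by move=> z; exact: cvg_cst. Qed.

End ContinuousOperations.

(** Applied to the time parameter, it makes the homotopies below continuous on all of [X * R], so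
    that they compose without restriction to the unit interval. *)
Definition clamp (R : realType) (t : R) : R := Num.max 0 (Num.min 1 t).

Section Clamp.
Context (R : realType).
Implicit Types t : R.

Lemma clamp_continuous : continuous (@clamp R).
Proof.
apply: continuous_max_fun; first exact: continuous_cst_fun.
by apply: continuous_min_fun; [exact: continuous_cst_fun|move=> ?; exact: cvg_id].
Qed.

Lemma clamp_ge0 t : 0 <= clamp t.
Proof. by rewrite /clamp le_max lexx. Qed.

Lemma clamp_le1 t : clamp t <= 1.
Proof. by rewrite /clamp ge_max ler01 ge_min lexx. Qed.

Lemma clamp0 : clamp 0 = 0 :> R.
Proof. by rewrite /clamp min_r ?ler01// maxxx. Qed.

Lemma clamp1 : clamp 1 = 1 :> R.
Proof. by rewrite /clamp minxx max_r ?ler01. Qed.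

End Clamp.

Lemma bigmin_attained (R : realType) (V : eqType) (r : seq V) (f : V -> R) :
  (exists2 v, v \in r & \big[Num.min/1]_(i <- r) f i = f v) \/
  (\big[Num.min/1]_(i <- r) f i = 1 /\ forall v, v \in r -> 1 <= f v).
Proof.
elim: r => [|v r IH]; first by right; rewrite big_nil.
rewrite big_cons; case: (leP (f v) (\big[Num.min/1]_(j <- r) f j)) => h.
  by left; exists v; rewrite ?mem_head.
case: IH => [[u ur uE]|[r1 hr]].
  by left; exists u; rewrite // in_cons ur orbT.
right; split=> // u; rewrite in_cons => /predU1P[->|/hr//].
by rewrite -r1 ltW.
Qed.

(** * The deformation realizing an elementary collapse *)

Section Push.
Context (R : realType) (V : choiceType) (K : set {fset V}) (E : {fset V}).
Hypothesis allE : forall v, v \in E.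
Hypothesis Ksub : forall s t : {fset V}, K s -> t != fset0 -> (t `<=` s)%fset -> K t.
Local Notation X := (realization R K).
Local Notation supp := (@supp R V E).
Implicit Types (x y : X) (v : V).

Context (s : {fset V}) (w : V).
Hypothesis s0 : s != fset0.
Hypothesis ws : w \notin s.
Hypothesis Kws : K (w |` s)%fset.

Let n : R := #|` s|%:R.
Let minc (x : V -> R) : R := \big[Num.min/1]_(i <- s) x i.
(** This vanishes unless all of [s] is in the support, so points outside the open star of [s] stay
    fixed. The factor [n] is such that at time 1, with no mass outside [w] and [s], each vertex of
    [s] loses exactly [minc x]; the smallest coordinate on [s] then becomes 0. *)
Let push_amount (x : V -> R) (t : R) : R := n * clamp t * minc x.
Let outside (x : V -> R) : R := \sum_(q <- E | q \notin (w |` s)%fset) x q.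
Let excess (x : V -> R) (t : R) : R := Num.max 0 (push_amount x t - outside x).
Let loss (x : V -> R) (t : R) : R :=
  \sum_(q <- E | q \notin (w |` s)%fset) Num.min (x q) (push_amount x t).

(* A point is moved away from the vertices outside [s] and [w] towards [s];
   once these are exhausted, the motion continues from [s] towards [w]. *)
Let push_fun (x : V -> R) (t : R) (v : V) : R :=
  x v + (if v \in s then (loss x t - excess x t) / n else 0)
      + (if v == w then excess x t else 0)
      - (if v \notin (w |` s)%fset then Num.min (x v) (push_amount x t) else 0).

Let n0 : 0 < n. Proof. by rewrite ltr0n cardfs_gt0. Qed.

Let minc_le x v : v \in s -> minc x <= x v.
Proof.
rewrite /minc -[v \in s]/(v \in enum_fset s); elim: (enum_fset s) => // u r IH.
by rewrite in_cons big_cons ge_min => /predU1P[->|/IH ->]; rewrite ?lexx ?orbT.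
Qed.

Let minc_ge0 x : 0 <= minc x.
Proof.
rewrite /minc; apply: (big_ind (fun a => 0 <= a)) => // [a b a0 b0|v _].
  by rewrite le_min a0.
exact: (real_ge0 allE).
Qed.

Let minc_ex x : exists2 v, v \in s & minc x = x v.
Proof.
have [//|[m1 xs1]] := bigmin_attained (enum_fset s) x.
have [v vs] := fset0Pn _ s0; exists v => //; rewrite /minc m1; apply/eqP.
by rewrite eq_le xs1// (real_le1 allE).
Qed.

Let amount_ge0 x t : 0 <= push_amount x t.
Proof. by rewrite /push_amount mulr_ge0// mulr_ge0 ?clamp_ge0// ltW. Qed.

Let outside_ge0 x : 0 <= outside x.
Proof. by apply: sumr_ge0 => v _; exact: (real_ge0 allE). Qed.

Let loss_ge0 x t : 0 <= loss x t.
Proof. by apply: sumr_ge0 => v _; rewrite le_min (real_ge0 allE) amount_ge0. Qed.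

Let excess_le x t : excess x t <= n * minc x.
Proof.
have am : push_amount x t <= n * minc x.
  rewrite /push_amount -mulrA ler_pM2l//.
  by rewrite -[leRHS]mul1r ler_wpM2r ?clamp_le1.
rewrite /excess ge_max; apply/andP; split; first by rewrite mulr_ge0// ltW.
by rewrite lerBlDr (le_trans am)// lerDl outside_ge0.
Qed.

Let push_ge0 x t v : 0 <= push_fun x t v.
Proof.
rewrite /push_fun; have xv := real_ge0 allE x v.
have ex0 : 0 <= excess x t by rewrite le_max lexx.
case: ifPn => vs.
  have -> : v \in (w |` s)%fset by rewrite !inE vs orbT.
  have -> : (v == w) = false by apply: contraNF ws => /eqP <-.
  rewrite /= subr0 addr0 mulrBl addrA subr_ge0.
  rewrite (@le_trans _ _ (minc x))//.
    by rewrite ler_pdivrMr// mulrC excess_le.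
  by rewrite (le_trans (minc_le x vs))// lerDl divr_ge0 ?loss_ge0 ?ltW.
rewrite addr0 in_fset1U negb_or vs andbT.
have [_|_] := eqVneq v w; first by rewrite subr0 addr_ge0.
by rewrite addr0 subr_ge0 ge_min lexx.
Qed.

Let push_sum x t : \sum_(v <- E) push_fun x t v = 1.
Proof.
rewrite /push_fun big_split /= sumrN !big_split /= -!big_mkcond /=.
have -> : \sum_(v <- E | v \in s) (loss x t - excess x t) / n = loss x t - excess x t.
  rewrite big_mkcond (sum_E allE (s := s)); last first.
    by apply/fsubsetP => v; rewrite in_supp//; case: ifP; rewrite ?eqxx.
  rewrite big_seq (eq_bigr (fun=> (loss x t - excess x t) / n)); last by move=> v ->.
  rewrite -big_seq big_const_seq count_predT iter_addr_0 -mulr_natr -mulrA mulVf ?mulr1//.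
  by rewrite gt_eqF.
have -> : \sum_(v <- E | v == w) excess x t = excess x t.
  rewrite big_mkcond (sum_E allE (s := [fset w]%fset)); last first.
    by apply/fsubsetP => v; rewrite in_supp// inE; case: ifP; rewrite ?eqxx.
  by rewrite big_seq_fset1 eqxx.
by rewrite (real_sum1 allE) -/(loss x t); ring.
Qed.

(** As long as [push_amount x t] does not exceed the outside mass, [w] receives nothing and no new
    vertex appears. Beyond that every outside vertex has been emptied. *)
Let push_supp x t : (supp (push_fun x t) `<=` supp x)%fset \/
  (supp (push_fun x t) `<=` w |` s)%fset.
Proof.
have [S0|S0] := eqVneq (push_amount x t) 0.
  left; apply/fsubsetP => v; rewrite !in_supp//; apply: contraNN => /eqP xv.
  have l0 : loss x t = 0.
    by rewrite /loss big1// => q _; rewrite S0; apply/min_r/(real_ge0 allE).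
  have e0 : excess x t = 0 by rewrite /excess S0 sub0r max_l// oppr_le0.
  rewrite /push_fun xv l0 e0 S0 minxx subrr mul0r.
  by rewrite !if_same subr0 !addr0.
have Sp : 0 < push_amount x t by rewrite lt_neqAle eq_sym S0 amount_ge0.
have xs v : v \in s -> x v != 0.
  move=> vs; rewrite gt_eqF// (lt_le_trans _ (minc_le x vs))//.
  rewrite lt_neqAle minc_ge0 andbT; apply: contra_neq S0 => m0.
  by rewrite /push_amount -m0 mulr0.
have [eQ|Qe] := leP (push_amount x t) (outside x).
  left; have e0 : excess x t = 0 by rewrite /excess max_l// subr_le0.
  apply/fsubsetP => v; rewrite !in_supp//; apply: contraNN => /eqP xv.
  have vs : v \notin s by apply/negP => /xs; rewrite xv eqxx.
  rewrite /push_fun xv e0 (negPf vs) if_same !addr0 min_l ?amount_ge0//.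
  by rewrite if_same subr0.
right; apply/fsubsetP => v; rewrite in_supp//; apply: contraNT => vws.
rewrite /push_fun vws; move: (vws); rewrite in_fset1U negb_or => /andP[/negPf-> /negPf->].
rewrite !addr0 min_l ?subrr// (le_trans _ (ltW Qe))//.
rewrite /outside big_mkcond (big_fsetD1 v)//= vws lerDl.
by apply: sumr_ge0 => u _; case: ifP => // _; exact: (real_ge0 allE).
Qed.

Let push_K x t : K (supp (push_fun x t)).
Proof.
have ne : supp (push_fun x t) != fset0 by apply: supp_neq0 => //; exact: push_sum.
case: (push_supp x t) => h; first exact: Ksub (real_supp allE Ksub x) ne h.
exact: Ksub Kws ne h.
Qed.

(** In its application [s] is a free face of a subcomplex only, and other simplices of [K] may
    contain it. Emptying their remaining vertices before feeding [w] keeps such points in the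
    complex, so the collapse extends to the whole realization. *)
Lemma push_deformation : exists H : X * R -> X,
  [/\ continuous H, forall x, H (x, 0) = x,
      forall x t, ~~ (s `<=` supp x)%fset -> H (x, t) = x,
      forall x t, (supp (H (x, t)) `<=` supp x)%fset \/
        (supp (H (x, t)) `<=` w |` s)%fset &
      forall x, (supp x `<=` w |` s)%fset ->
        (supp (H (x, 1)) `<=` w |` s)%fset /\ ~~ (s `<=` supp (H (x, 1)))%fset].
Proof.
pose H (z : X * R) : X := mk_real allE (push_ge0 z.1 z.2) (push_sum z.1 z.2) (push_K z.1 z.2).
have H0 x t : push_amount x t = 0 -> H (x, t) = x.
  move=> S0; apply: real_inj => v /=.
  have l0 : loss x t = 0.
    by rewrite /loss big1// => q _; rewrite S0; apply/min_r/(real_ge0 allE).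
  have e0 : excess x t = 0 by rewrite /excess S0 sub0r max_l// oppr_le0.
  rewrite /push_fun l0 e0 S0 min_r ?(real_ge0 allE)// subrr mul0r.
  by rewrite !if_same subr0 !addr0.
exists H; split.
- apply: (real_continuous allE Ksub) => v.
  have cx u : continuous (fun z : X * R => z.1 u).
    move=> z; apply: (@continuous_comp _ _ _ fst (fun x : X => x u)).
      exact: cvg_fst.
    exact: coord_continuous.
  have ct : continuous (fun z : X * R => clamp z.2).
    move=> z; apply: (@continuous_comp _ _ _ snd (@clamp R)); first exact: cvg_snd.
    exact: clamp_continuous.
  have cm : continuous (fun z : X * R => minc z.1).
    rewrite /minc; apply: (@continuous_big R V Num.min 1 xpredT _ (X * R)%type s
      (fun i (z : X * R) => z.1 i)) => //.
    by apply: continuous_min_fun => z; [exact: cvg_fst|exact: cvg_snd].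
  have cS : continuous (fun z : X * R => push_amount z.1 z.2).
    by apply: continuousM_fun => //; apply: continuousM_fun => //; exact: continuous_cst_fun.
  have cmin u : continuous (fun z : X * R => Num.min (z.1 u) (push_amount z.1 z.2)).
    exact: continuous_min_fun.
  have cl : continuous (fun z : X * R => loss z.1 z.2).
    exact: sum_continuous.
  have ce : continuous (fun z : X * R => excess z.1 z.2).
    apply: continuous_max_fun; first exact: continuous_cst_fun.
    by apply: continuousB_fun => //; exact: sum_continuous.
  have c0 := @continuous_cst_fun R (X * R)%type 0.
  apply: continuousB_fun; last by case: (v \notin (w |` s)%fset).
  apply: continuousD_fun; last by case: (v == w).
  apply: continuousD_fun => //; case: (v \in s) => //.
  by apply: continuousM_fun; [exact: continuousB_fun|exact: continuous_cst_fun].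
- by move=> x; apply: H0; rewrite /push_amount clamp0 mulr0 mul0r.
- move=> x t /fsubsetPn[v vs]; rewrite in_supp// negbK => /eqP xv; apply: H0.
  have m0 : minc x = 0.
    by apply/eqP; rewrite eq_le minc_ge0 andbT -[leRHS]xv; exact: minc_le.
  by rewrite /push_amount m0 mulr0.
- by move=> x t; exact: push_supp.
- move=> x xws; split.
    by case: (push_supp x 1) => // h; exact: fsubset_trans h xws.
  have Q0 : outside x = 0.
    rewrite /outside big1// => q qws; apply/eqP; apply: contraNT qws => xq.
    by apply: (fsubsetP xws); rewrite in_supp.
  have l0 : loss x 1 = 0.
    rewrite /loss big1// => q qws; rewrite min_l; last first.
      rewrite (_ : x q = 0) ?amount_ge0//; apply/eqP; apply: contraNT qws => xq.
      by apply: (fsubsetP xws); rewrite in_supp.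
    by apply/eqP; apply: contraNT qws => xq; apply: (fsubsetP xws); rewrite in_supp.
  have [v vs mv] := minc_ex x.
  apply/fsubsetPn; exists v => //; rewrite in_supp// negbK /= /push_fun vs.
  have -> : (v == w) = false by apply: contraNF ws => /eqP <-.
  have -> : v \in (w |` s)%fset by rewrite !inE vs orbT.
  rewrite l0 sub0r /excess Q0 [push_amount x 1 - 0]subr0 (max_r (amount_ge0 x 1)) /push_amount clamp1 mulr1 mv.
  by rewrite addr0 subr0 mulNr mulrAC divff ?(gt_eqF n0)// mul1r subrr.
Qed.

End Push.

Section OrderComplex.
Context (d : Order.disp_t) (V : porderType d).

Lemma order_complex_sub (s t : {fset V}) : order_complex V s -> t != fset0 ->
  (t `<=` s)%fset -> order_complex V t.
Proof.
move=> [_ sc] t0 /fsubsetP ts; split=> // u v tu tv.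
by apply: sc; exact: ts.
Qed.

End OrderComplex.

(** * Deformation along a closure operator *)

Section ClosureDeformation.
Context (R : realType) (d : Order.disp_t) (V : porderType d) (E : {fset V}).
Hypothesis allE : forall v, v \in E.
Local Notation K := (order_complex V).
Local Notation X := (realization R K).
Local Notation supp := (@supp R V E).
Implicit Types (x y : X) (v u : V).

Context (cl : V -> V).
Hypothesis cl_ge : forall v, (v <= cl v)%O.
Hypothesis cl_homo : forall u v, (u <= v)%O -> (cl u <= cl v)%O.
Hypothesis cl_idem : forall v, cl (cl v) = cl v.

(* Mass is moved from [v] to [cl v] starting with the largest vertices, so that
   at each time the vertices left and the closures reached form a chain. *)
Let above (x : V -> R) v : R := \sum_(u <- E | (v < u)%O) x u.
Let moved (x : V -> R) (t : R) v : R := Num.min (x v) (Num.max 0 (clamp t - above x v)).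
Let close_fun (x : V -> R) (t : R) v : R :=
  x v - moved x t v + \sum_(u <- E | cl u == v) moved x t u.

Let above_ge0 x v : 0 <= above x v.
Proof. by apply: sumr_ge0 => u _; exact: (real_ge0 allE). Qed.

Let moved_ge0 x t v : 0 <= moved x t v.
Proof. by rewrite /moved le_min (real_ge0 allE) le_max lexx. Qed.

Let moved_le x t v : moved x t v <= x v.
Proof. by rewrite /moved ge_min lexx. Qed.

Let moved_eq0 x t v : x v = 0 -> moved x t v = 0.
Proof. by move=> xv; apply/eqP; rewrite eq_le moved_ge0 andbT -[leRHS]xv moved_le. Qed.

Let close_ge0 x t v : 0 <= close_fun x t v.
Proof. by rewrite addr_ge0 ?subr_ge0 ?moved_le//; apply: sumr_ge0 => u _; exact: moved_ge0. Qed.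

Let close_sum x t : \sum_(v <- E) close_fun x t v = 1.
Proof.
rewrite /close_fun !big_split /= sumrN (real_sum1 allE).
rewrite (exchange_big_dep xpredT)//=.
rewrite [X in _ + X](eq_bigr (fun u => moved x t u)) ?addrNK// => u _.
rewrite big_mkcond (sum_E allE (s := [fset cl u]%fset)); last first.
  apply/fsubsetP => v; rewrite in_supp// inE; by case: (eqVneq (cl u) v) => _; rewrite ?eqxx.
by rewrite big_seq_fset1 eqxx.
Qed.

Let close_suppP x t v : close_fun x t v != 0 ->
  (0 < x v /\ clamp t < x v + above x v) \/
  exists u, [/\ cl u = v, 0 < x u & above x u < clamp t].
Proof.
have [h1|h1] := boolP (x v - moved x t v == 0); last first.
  move=> _; left.
  have h : moved x t v < x v by rewrite lt_neqAle moved_le andbT eq_sym -subr_eq0.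
  split; first exact: le_lt_trans h.
  move: h; rewrite /moved gt_min ltxx /= gt_max ltrBlDr => /andP[_].
  by [].
rewrite /close_fun (eqP h1) add0r => h2; right; apply: contrapT => nu.
move/eqP: h2; apply; apply: big1 => u /eqP uv; apply/eqP.
rewrite eq_le moved_ge0 andbT leNgt; apply/negP => mu; apply: nu; exists u.
move: mu; rewrite /moved lt_min => /andP[xu]; rewrite lt_max ltxx /= subr_gt0 => tu.
by split.
Qed.

Let close_K x t : K (supp (close_fun x t)).
Proof.
split; first by apply: supp_neq0 => //; exact: close_sum.
have [_ xc] := real_supp allE (@order_complex_sub _ V) x.
have cmp u v : 0 < x u -> 0 < x v -> (u >=< v)%O.
  by move=> u0 v0; apply: xc; rewrite in_supp// gt_eqF.
(* If [v < u], the mass above [v] includes that of [u] and of everything above [u], so [v] starts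
   moving only once [u] is exhausted. Hence [u <= v <= cl v]. *)
have stay_move u v : 0 < x u -> clamp t < x u + above x u -> 0 < x v ->
    above x v < clamp t -> (u <= cl v)%O.
  move=> u0 tu v0 tv; case: (comparable_leP (cmp _ _ u0 v0)) => uv.
    exact: le_trans uv (cl_ge v).
  exfalso; have := lt_trans tv tu; apply/negP; rewrite -leNgt.
  rewrite /above [leRHS]big_mkcond (big_fsetD1 u)//= uv lerD2l.
  rewrite big_mkcond (big_fsetD1 u)//= ltxx add0r; apply: ler_sum => w _.
  case: ifPn => [uw|_]; first by rewrite (lt_trans uv uw).
  by case: ifP => // _; exact: (real_ge0 allE).
move=> u v; rewrite !in_supp// => /close_suppP[[u0 tu]|[u' [<- u0 tu]]]
  /close_suppP[[v0 tv]|[v' [<- v0 tv]]].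
- exact: cmp.
- by rewrite /Order.comparable stay_move.
- by rewrite /Order.comparable orbC stay_move.
- by have /orP[h|h] := cmp _ _ u0 v0; rewrite /Order.comparable (cl_homo h) ?orbT.
Qed.

(** For [u < v] in a chain, [cl u] and [v] need not be comparable, so the straight-line homotopy
    from a point to its closure may leave the complex. *)
Lemma closure_deformation : exists H : X * R -> X,
  [/\ continuous H, forall x, H (x, 0) = x,
      forall x v, v \in supp (H (x, 1)) -> cl v = v &
      forall x t, (forall v, v \in supp x -> cl v = v) -> H (x, t) = x].
Proof.
pose H (z : X * R) : X :=
  mk_real allE (close_ge0 z.1 z.2) (close_sum z.1 z.2) (close_K z.1 z.2).
exists H; split.
- apply: (real_continuous allE (@order_complex_sub _ V)) => v.
  have cx u : continuous (fun z : X * R => z.1 u).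
    move=> z; apply: (@continuous_comp _ _ _ fst (fun x : X => x u)).
      exact: cvg_fst.
    exact: coord_continuous.
  have ct : continuous (fun z : X * R => clamp z.2).
    move=> z; apply: (@continuous_comp _ _ _ snd (@clamp R)); first exact: cvg_snd.
    exact: clamp_continuous.
  have cm u : continuous (fun z : X * R => moved z.1 z.2 u).
    apply: continuous_min_fun => //; apply: continuous_max_fun.
      exact: continuous_cst_fun.
    by apply: continuousB_fun => //; exact: sum_continuous.
  by apply: continuousD_fun; [exact: continuousB_fun|exact: sum_continuous].
- move=> x; apply: real_inj => v /=; rewrite /close_fun.
  have m0 u : moved x 0 u = 0.
    rewrite /moved clamp0 sub0r [Num.max _ _]max_l ?oppr_le0 ?above_ge0//.
    by rewrite min_r// (real_ge0 allE).
  by rewrite m0 subr0 big1 ?addr0.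
- move=> x v; rewrite in_supp// => /close_suppP[[xv]|[u [<- _ _]]]; last exact: cl_idem.
  (* At time 1, mass left at [v] would require [1 < x v + above x v], more than the total mass. *)
  rewrite clamp1 ltNge -[X in _ <= X](real_sum1 allE x) (big_fsetD1 v)//= lerD2l.
  rewrite /above big_mkcond (big_fsetD1 v)//= ltxx add0r => /negP[].
  by apply: ler_sum => w _; case: ifP => // _; exact: (real_ge0 allE).
- move=> x t xcl; apply: real_inj => v /=; rewrite /close_fun.
  rewrite big_mkcond (sum_E allE (s := [fset v]%fset)); last first.
    apply/fsubsetP => u; rewrite in_supp// inE; case: (eqVneq (cl u) v) => [uv mu|_]; last first.
      by rewrite eqxx.
    rewrite -uv xcl// in_supp//; apply: contra_neq mu.
    exact: moved_eq0.
  rewrite big_seq_fset1; have [xv|xv] := eqVneq (x v) 0.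
    by rewrite xv moved_eq0// if_same addr0 subr0.
  by rewrite xcl ?in_supp// eqxx subrK.
Qed.

End ClosureDeformation.

Definition subcomplex (V : choiceType) (A : set {fset V}) : Prop :=
  forall s t : {fset V}, A s -> t != fset0 -> (t `<=` s)%fset -> A t.

(** * Deformations following a sequence of collapses *)

Section CollapseDeformation.
Context (R : realType) (V : choiceType) (K : set {fset V}) (E : {fset V}).
Hypothesis allE : forall v, v \in E.
Hypothesis Ksub : subcomplex K.
Local Notation X := (realization R K).
Local Notation supp := (@supp R V E).

(** The last clause stands in for homotopy extension: the deformation also moves points outside [B],
    yet preserves every subcomplex containing [B], since each push either shrinks the support or
    lands in a simplex of [B]. *)
Lemma collapse_deformation (B B' : {fset {fset V}}) : collapse B B' ->
  [set` B] `<=` K -> subcomplex [set` B] -> exists H : X * R -> X,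
  [/\ continuous H, forall x, H (x, 0) = x,
      forall x : X, supp x \in B -> supp (H (x, 1)) \in B' &
      forall A, subcomplex A -> [set` B] `<=` A ->
        forall (x : X) t, A (supp x) -> A (supp (H (x, t)))].
Proof.
elim=> {B B'} [B BK Bsub|B B' s w s0 ws wsB free _ IH BK Bsub].
  exists fst; split=> // z; exact: cvg_fst.
set B1 := (B `\ s `\ (w |` s))%fset.
have inB1 t : t \in B1 <-> t \in B /\ ~~ (s `<=` t)%fset.
  rewrite !inE; split=> [/and3P[t1 t2 tB]|[tB st]].
    split=> //; apply/negP => /(free _ tB)[/eqP|/eqP]; first by rewrite (negPf t2).
    by rewrite (negPf t1).
  rewrite tB andbT; apply/andP; split; apply: contraNneq st => ->; last exact: fsubset_refl.
  exact: fsubsetUr.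
have B1B : [set` B1] `<=` [set` B] by move=> t /inB1[].
have B1sub : subcomplex [set` B1].
  move=> t u /inB1[tB st] u0 ut; apply/inB1; split; first exact: Bsub ut.
  by apply: contra st => /fsubset_trans; exact.
have [H2 [cH2 H20 H21 H2A]] := IH (subset_trans B1B BK) B1sub.
have [H1 [cH1 H10 H1fix H1sub H11]] := push_deformation R allE Ksub s0 ws (BK _ wsB).
exists (fun z => H2 (H1 z, z.2)); split.
- move=> z; apply: (@continuous_comp _ _ _ (fun z => (H1 z, z.2)) H2); last exact: cH2.
  apply: (@cvg_pair _ _ _ (nbhs z) (nbhs (H1 z)) (nbhs z.2)); first exact: cH1.
  exact: cvg_snd.
- by move=> x /=; rewrite H10 H20.
- move=> x xB /=; apply: H21; apply/inB1.
  have [sx|sx] := boolP (s `<=` supp x)%fset; last by rewrite H1fix.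
  have xws : (supp x `<=` w |` s)%fset.
    by have [->|->] := free _ xB sx; [exact: fsubsetUr|exact: fsubset_refl].
  have [h1 h2] := H11 _ xws; split=> //; apply: Bsub wsB _ h1.
  by apply: supp_neq0 => //; exact: real_sum1.
- move=> A Asub BA x t Ax /=; apply: H2A => //; first exact: subset_trans BA.
  have ne : supp (H1 (x, t)) != fset0 by apply: supp_neq0 => //; exact: real_sum1.
  by case: (H1sub x t) => h; [exact: Asub Ax ne h|exact: Asub (BA _ wsB) ne h].
Qed.

End CollapseDeformation.

(** * The triangle modulo its boundary as the 2-sphere *)

Section TriangleSphere.
Context (R : realType).
Implicit Types a b c m : R.

Definition min3 a b c : R := Num.min a (Num.min b c).

Lemma min3_le a b c : [/\ min3 a b c <= a, min3 a b c <= b & min3 a b c <= c].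
Proof. by rewrite /min3; split; rewrite !ge_min lexx ?orbT. Qed.

Lemma min3_cases a b c : [\/ min3 a b c = a, min3 a b c = b | min3 a b c = c].
Proof.
rewrite /min3; case: (leP a (Num.min b c)) => _; first by constructor 1.
by case: (leP b c) => _; [constructor 2|constructor 3].
Qed.

Lemma min3_gt0 a b c : (0 < min3 a b c) = [&& 0 < a, 0 < b & 0 < c].
Proof. by rewrite /min3 !lt_min. Qed.

Definition tri_den a b m : R := (a - 3^-1) ^+ 2 + (b - 3^-1) ^+ 2 + m ^+ 2.

(* Inverse stereographic projection of the point [((a - 1/3) / m, (b - 1/3) / m)];
   the radial map [d |-> d / m] about the barycentre, where [m] is the distance
   to the boundary, identifies the open triangle with the plane. *)
Definition tri_vec a b m : 'rV[R]_3 :=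
  \row_i nth 0 [:: ((a - 3^-1) ^+ 2 + (b - 3^-1) ^+ 2 - m ^+ 2) / tri_den a b m;
    2 * (a - 3^-1) * m / tri_den a b m; 2 * (b - 3^-1) * m / tri_den a b m] i.

(** The default covers coordinates at which [tri_den] vanishes, which can happen only when they do
    not sum to 1. *)
Definition tri_sphere a b c : sphere R 2 :=
  insubd (sphere_base R 2) (tri_vec a b (min3 a b c)).

Lemma sphereE (y : 'rV[R]_3) : (y \in @unit_sphere R 2) =
  (y ord0 0 ^+ 2 + y ord0 1 ^+ 2 + y ord0 2 ^+ 2 == 1).
Proof.
apply/idP/eqP; rewrite inE /unit_sphere /= !big_ord_recl big_ord0 addr0 addrA => h.
  by rewrite -[RHS]h; congr (_ ^+ 2 + _ ^+ 2 + _ ^+ 2); congr (y _ _); exact/val_inj.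
by rewrite -[RHS]h; congr (_ ^+ 2 + _ ^+ 2 + _ ^+ 2); congr (y _ _); exact/val_inj.
Qed.

Lemma tri_vec_sphere a b m : tri_den a b m != 0 -> tri_vec a b m \in @unit_sphere R 2.
Proof.
rewrite sphereE !mxE /= /tri_den; move: (a - 3^-1) (b - 3^-1) => u v D0.
by apply/eqP; field.
Qed.

(** Vanishing would mean being at the barycentre with [m = 0], whereas [m] is 1/3 there. *)
Lemma tri_den_gt0 a b c : a + b + c = 1 -> 0 < tri_den a b (min3 a b c).
Proof.
move=> abc; have [D0|D0] := eqVneq (tri_den a b (min3 a b c)) 0; last first.
  by rewrite lt_neqAle eq_sym D0 /tri_den !addr_ge0 ?sqr_ge0.
exfalso; move: D0 => /eqP; rewrite /tri_den paddr_eq0 ?addr_ge0 ?sqr_ge0//.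
rewrite paddr_eq0 ?sqr_ge0// !sqrf_eq0 => /andP[/andP[/eqP ha /eqP hb] /eqP hm].
by have [h|h|h] := min3_cases a b c; move: h; rewrite hm; lra.
Qed.

Lemma val_tri_sphere a b c : tri_den a b (min3 a b c) != 0 ->
  val (tri_sphere a b c) = tri_vec a b (min3 a b c).
Proof. by move=> D0; rewrite insubdK//; exact: tri_vec_sphere. Qed.

Lemma sphere_eqP (y z : sphere R 2) :
  (forall i, val y ord0 i = val z ord0 i) -> y = z.
Proof. by move=> yz; apply: val_inj; apply/rowP. Qed.

Lemma tri_sphere_base a b c : a + b + c = 1 -> min3 a b c = 0 ->
  tri_sphere a b c = sphere_base R 2.
Proof.
move=> abc m0; have := tri_den_gt0 abc; rewrite lt_def => /andP[D0 _].
apply: val_inj; rewrite val_tri_sphere//=; move: D0; rewrite m0 /tri_den => D0.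
apply/rowP => -[[|[|[|//]]] i3]; rewrite !mxE /tri_den /=.
- by rewrite expr0n /= subr0 addr0 divff//; move: D0; rewrite expr0n /= addr0.
- by rewrite mulr0 mul0r.
- by rewrite mulr0 mul0r.
Qed.

Lemma tri_sphere_coord a b c (y := val (tri_sphere a b c)) : a + b + c = 1 ->
  [/\ 1 - y ord0 0 = 2 * min3 a b c ^+ 2 / tri_den a b (min3 a b c),
      y ord0 1 = 2 * (a - 3^-1) * min3 a b c / tri_den a b (min3 a b c) &
      y ord0 2 = 2 * (b - 3^-1) * min3 a b c / tri_den a b (min3 a b c)].
Proof.
move=> abc; have D0 := tri_den_gt0 abc.
rewrite /y val_tri_sphere ?gt_eqF//= !mxE /=; split=> //.
move: D0; rewrite /tri_den; move: (min3 _ _ _) (a - 3^-1) (b - 3^-1) => m u v D0.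
by field; rewrite gt_eqF.
Qed.

Lemma sphere_base_coord0 : val (sphere_base R 2) ord0 0 = 1.
Proof. by rewrite /= mxE. Qed.

Lemma tri_sphere_nbase a b c : a + b + c = 1 -> 0 < min3 a b c ->
  tri_sphere a b c != sphere_base R 2.
Proof.
move=> abc m0; have D0 := tri_den_gt0 abc; apply/eqP => h.
have [+ _ _] := tri_sphere_coord abc; rewrite h sphere_base_coord0 subrr.
by apply/eqP; rewrite eq_sym gt_eqF// divr_gt0// mulr_gt0// exprn_gt0.
Qed.

Lemma tri_sphere_inj a b c a' b' c' : a + b + c = 1 -> a' + b' + c' = 1 ->
  0 < min3 a b c -> 0 < min3 a' b' c' -> tri_sphere a b c = tri_sphere a' b' c' ->
  [/\ a = a', b = b' & c = c'].
Proof.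
move=> abc abc' m0 m0' h; have D0 := tri_den_gt0 abc; have D0' := tri_den_gt0 abc'.
have [h0 h1 h2] := tri_sphere_coord abc; have [] := tri_sphere_coord abc'.
rewrite -h h0 h1 h2; move: D0 D0'.
move: {h h0 h1 h2} (tri_den a b _) (tri_den a' b' _) => D D' D0 D0' e0 e1 e2.
move: (min3_le a b c) (min3_cases a b c) (min3_le a' b' c') (min3_cases a' b' c').
move: (min3 a b c) (min3 a' b' c') m0 m0' e0 e1 e2 => m m' m0 m0' e0 e1 e2.
have ratio (u u' : R) : 2 * u * m / D = 2 * u' * m' / D' -> u * m' = u' * m.
  move=> e; have : (2 * u * m / D) * (2 * m' ^+ 2 / D') = (2 * u' * m' / D') * (2 * m ^+ 2 / D).
    by rewrite e0 e.
  move=> /(congr1 (fun z => z * (D * D' / (4 * m * m')))).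
  have -> : 2 * u * m / D * (2 * m' ^+ 2 / D') * (D * D' / (4 * m * m')) = u * m'.
    by field; rewrite !gt_eqF.
  by move=> ->; field; rewrite !gt_eqF.
have {}e1 := ratio _ _ e1; have {}e2 := ratio _ _ e2.
have e3 : (c - 3^-1) * m' = (c' - 3^-1) * m.
  have -> : c - 3^-1 = - (a - 3^-1) - (b - 3^-1) by lra.
  have -> : c' - 3^-1 = - (a' - 3^-1) - (b' - 3^-1) by lra.
  by rewrite (mulrBl m' (- _)) mulNr e1 e2; ring.
move=> [ma mb mc] mm [ma' mb' mc'] mm'.
(* If [m = a], then [(m - 3^-1) * m' = (a' - 3^-1) * m >= (m' - 3^-1) * m], whence [m' <= m];
   likewise for the other coordinates and for the roles exchanged. *)
have mE : m = m'.
  apply/eqP; rewrite eq_le; apply/andP; split.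
    by case: mm' => h; rewrite -h in e1 e2 e3; nra.
  by case: mm => h; rewrite -h in e1 e2 e3; nra.
rewrite mE in e1 e2 e3.
have m'N0 : m' != 0 by rewrite gt_eqF.
by split; [have := mulIf m'N0 e1|have := mulIf m'N0 e2|have := mulIf m'N0 e3]; lra.
Qed.

Lemma tri_sphere_surj (y : sphere R 2) : y != sphere_base R 2 ->
  exists a b c, [/\ a + b + c = 1, 0 < min3 a b c & tri_sphere a b c = y].
Proof.
move=> yb; have := valP y; rewrite sphereE => /eqP.
pose y0 := val y ord0 0; pose y1 := val y ord0 1; pose y2 := val y ord0 2.
rewrite -/y0 -/y1 -/y2 => y012.
have y0N1 : y0 < 1.
  rewrite lt_neqAle; apply/andP; split; last by nra.
  apply: contra_neq yb => y01; apply: sphere_eqP => -[[|[|[|//]]] i3]; rewrite [RHS]mxE /=.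
  - by rewrite -[RHS]y01; congr (_ _ _); exact/val_inj.
  - transitivity y1; first by congr (_ _ _); exact/val_inj.
    by rewrite -[RHS]/(0 : R); nra.
  - transitivity y2; first by congr (_ _ _); exact/val_inj.
    by rewrite -[RHS]/(0 : R); nra.
pose u := y1 / (1 - y0); pose v := y2 / (1 - y0).
have mn0 : min3 u v (- u - v) <= 0.
  by have [] := min3_le u v (- u - v); lra.
(* Here [(u, v)] is the stereographic projection of [y], and [mu] solves
   [3^-1 + mu * min3 u v (- u - v) = mu]: the least coordinate of the point constructed below must
   be [mu] itself. *)
pose mu := (3 * (1 - min3 u v (- u - v)))^-1.
have mu0 : 0 < mu by rewrite invr_gt0; lra.
have muE : mu * min3 u v (- u - v) = mu - 3^-1.
  by rewrite /mu; field; rewrite gt_eqF//; lra.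
exists (3^-1 + mu * u), (3^-1 + mu * v), (3^-1 + mu * (- u - v)).
have abc : 3^-1 + mu * u + (3^-1 + mu * v) + (3^-1 + mu * (- u - v)) = 1 by field.
have mE : min3 (3^-1 + mu * u) (3^-1 + mu * v) (3^-1 + mu * (- u - v)) = mu.
  have [l1 l2 l3] := min3_le u v (- u - v).
  have [k1 k2 k3] := min3_le (3^-1 + mu * u) (3^-1 + mu * v) (3^-1 + mu * (- u - v)).
  apply/eqP; rewrite eq_le; apply/andP; split.
    by have [h|h|h] := min3_cases u v (- u - v); rewrite h in muE; lra.
  by have [->|->|->] := min3_cases (3^-1 + mu * u) (3^-1 + mu * v) (3^-1 + mu * (- u - v));
    nra.
split=> //; first by rewrite mE.
have [h0 h1 h2] := tri_sphere_coord abc; rewrite !mE in h0 h1 h2.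
have z0 : 1 - y0 != 0 by rewrite subr_eq0 eq_sym lt_eqF.
have DE : tri_den (3^-1 + mu * u) (3^-1 + mu * v) mu = 2 * mu ^+ 2 / (1 - y0).
  rewrite /tri_den (addrC 3^-1) addrK (addrC 3^-1) addrK /u /v.
  have -> : (mu * (y1 / (1 - y0))) ^+ 2 + (mu * (y2 / (1 - y0))) ^+ 2 + mu ^+ 2 =
     mu ^+ 2 * ((y1 ^+ 2 + y2 ^+ 2 + (1 - y0) ^+ 2) / (1 - y0) ^+ 2) by field.
  have -> : y1 ^+ 2 + y2 ^+ 2 + (1 - y0) ^+ 2 = 2 * (1 - y0) by lra.
  by field.
rewrite DE in h0 h1 h2.
have muN0 : mu != 0 by rewrite gt_eqF.
apply: sphere_eqP => -[[|[|[|//]]] i3].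
- rewrite (_ : Ordinal i3 = 0); last exact/val_inj.
  suff : 1 - val (tri_sphere (3^-1 + mu * u) (3^-1 + mu * v) (3^-1 + mu * (- u - v))) ord0 0
    = 1 - y0 by move=> /addrI/oppr_inj.
  by rewrite h0; field; rewrite z0.
- rewrite (_ : Ordinal i3 = 1); last exact/val_inj.
  by rewrite h1 -/y1 (addrC 3^-1) addrK /u; field; rewrite z0.
- rewrite (_ : Ordinal i3 = 2); last exact/val_inj.
  by rewrite h2 -/y2 (addrC 3^-1) addrK /v; field; rewrite z0.
Qed.

Lemma tri_sphere_continuous (T : topologicalType) (a b c : T -> R) (t : T) :
  continuous a -> continuous b -> continuous c ->
  tri_den (a t) (b t) (min3 (a t) (b t) (c t)) != 0 ->
  {for t, continuous (fun t => tri_sphere (a t) (b t) (c t))}.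
Proof.
move=> ca cb cc D0.
have cm : continuous (fun t => min3 (a t) (b t) (c t)).
  by apply: continuous_min_fun => //; exact: continuous_min_fun.
have sq (f : T -> R) : continuous f -> continuous (fun t => f t ^+ 2).
  by move=> cf; under eq_fun do rewrite expr2; exact: continuousM_fun.
have ca' : continuous (fun t => a t - 3^-1).
  by apply: continuousB_fun => //; exact: continuous_cst_fun.
have cb' : continuous (fun t => b t - 3^-1).
  by apply: continuousB_fun => //; exact: continuous_cst_fun.
have cD : continuous (fun t => tri_den (a t) (b t) (min3 (a t) (b t) (c t))).
  by do 2![apply: continuousD_fun; last exact: sq]; exact: sq.
have nD : \forall s \near t, tri_den (a s) (b s) (min3 (a s) (b s) (c s)) != 0.
  apply: (cD t [set z : R | z != 0]).
  by apply: open_nbhs_nbhs; split=> //; exact: open_neq.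
have ce j : tri_vec (a s) (b s) (min3 (a s) (b s) (c s)) ord0 j @[s --> t] -->
    tri_vec (a t) (b t) (min3 (a t) (b t) (c t)) ord0 j.
  have entry (f : T -> R) : continuous f ->
      (f s / tri_den (a s) (b s) (min3 (a s) (b s) (c s))) @[s --> t] -->
      f t / tri_den (a t) (b t) (min3 (a t) (b t) (c t)).
    by move=> cf; apply: cvgM; [exact: cf|apply: cvgV => //; exact: cD].
  have c2 := @continuous_cst_fun R T 2.
  under eq_fun do rewrite mxE; rewrite mxE; case: j => -[|[|[|//]]] j3 /=.
  - apply: entry; apply: continuousB_fun; last exact: sq.
    by apply: continuousD_fun; exact: sq.
  - by apply: entry; do 2!apply: continuousM_fun => //.
  - by apply: entry; do 2!apply: continuousM_fun => //.
move=> U [_ [/= [W oW <-]] Wt WU].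
have : nbhs (tri_vec (a t) (b t) (min3 (a t) (b t) (c t))) W.
  by apply: open_nbhs_nbhs; split=> //; rewrite -val_tri_sphere.
move=> [P nP PW]; rewrite nbhs_simpl /=.
have nj : \forall s \near t, forall j,
    P ord0 j (tri_vec (a s) (b s) (min3 (a s) (b s) (c s)) ord0 j).
  by apply: filter_forall => j; exact: (ce j _ (nP ord0 j)).
near=> s; apply: WU => /=; rewrite set_valE /= val_tri_sphere; last by near: s.
apply: PW => i j; rewrite ord1.
by move: j; near: s.
Unshelve. all: by end_near. Qed.

Lemma sphere_hausdorff n : hausdorff_space (sphere R n).
Proof.
move=> x y xy; apply: val_inj; apply: norm_hausdorff => A B nA nB.
have cval : continuous (val : sphere R n -> 'rV[R]_n.+1) by exact: initial_continuous.
have [z [Az Bz]] := xy _ _ (cval x _ nA) (cval y _ nB).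
by exists (val z).
Qed.

End TriangleSphere.

Lemma compact_quotient_continuous (X Y Z : topologicalType) (D : set X)
    (p : X -> Y) (k : X -> Z) (h : Y -> Z) :
  hausdorff_space Y -> compact D -> continuous p -> continuous k ->
  (forall x, D x -> h (p x) = k x) -> {within p @` D, continuous h}.
Proof.
move=> hY cD cp ck hk; apply/continuous_closedP => C cC.
apply/closed_subspaceP; exists (p @` (D `&` k @^-1` C)).
  apply: compact_closed => //; apply: continuous_compact.
    exact: continuous_subspaceT.
  apply: compact_closedI => //; apply: preimage_closed cC => x _; exact: ck.
apply/seteqP; split=> y /=.
  move=> [[x [Dx Cx] <-] _]; split; last by exists x.
  by suff : C (h (p x)) by []; rewrite hk.
move=> [Cy [x Dx xy]]; have Cx : C (k x) by rewrite -hk// xy.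
by split; exists x.
Qed.

Lemma prod_hausdorff (X Y : topologicalType) :
  hausdorff_space X -> hausdorff_space Y -> hausdorff_space (X * Y)%type.
Proof.
move=> hX hY p q pq; rewrite [p]surjective_pairing [q]surjective_pairing; congr pair.
  apply: hX => A B nA nB.
  have [z [Az Bz]] := pq _ _ (@cvg_fst _ _ _ _ _ _ nA) (@cvg_fst _ _ _ _ _ _ nB).
  by exists z.1.
apply: hY => A B nA nB.
have [z [Az Bz]] := pq _ _ (@cvg_snd _ _ _ _ _ _ nA) (@cvg_snd _ _ _ _ _ _ nB).
by exists z.2.
Qed.

Lemma wedge_lift_inj (I : choiceType) (S : topologicalType) (p0 : S) (i j : I) (x y : S) :
  wedge_lift (fun _ : I => p0) (i := i) x = wedge_lift (fun _ : I => p0) (i := j) y ->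
  (i = j /\ x = y) \/ (x = p0 /\ y = p0).
Proof.
move=> /eqmodP/predU1P[e|/andP[/eqP /= -> /eqP ->]]; last by right.
by left; split; [exact: (congr1 (@projT1 _ _) e)|exact: (congr1 (fun z : {_ : I & S} => projT2 z) e)].
Qed.

(** * Crushing a collapsible subcomplex to obtain a wedge of 2-spheres *)

Section WedgeOfSpheres.
Context (R : realType) (V : choiceType) (K : set {fset V}) (E : {fset V}).
Hypothesis allE : forall v, v \in E.
Hypothesis Ksub : subcomplex K.
Local Notation X := (realization R K).
Local Notation supp := (@supp R V E).

Context (K' : set {fset V}) (A : {fset {fset V}}) (v0 : V).
Context (m : nat) (va vb vc : 'I_m -> V).
Local Notation tri j := (va j |` (vb j |` [fset vc j]))%fset.
Hypothesis m0 : (0 < m)%N.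
Hypothesis K'K : K' `<=` K.
Hypothesis K'sub : subcomplex K'.
Hypothesis Asub : subcomplex [set` A].
Hypothesis K'E : forall s, K' s <-> s \in A \/ exists j, s = tri j.
Hypothesis triA : forall j, tri j \notin A.
Hypothesis tri_facet : forall s j, K' s -> (tri j `<=` s)%fset -> s = tri j.
Hypothesis tri_inj : forall i j, tri i = tri j -> i = j.
Hypothesis tri_neq : forall j, [/\ va j != vb j, va j != vc j & vb j != vc j].
Hypothesis v0A : [fset v0]%fset \in A.
Hypothesis Acol : collapse A [fset [fset v0]]%fset.
Hypothesis retract : exists H : X * R -> X,
  [/\ continuous H, forall x, H (x, 0) = x, forall x, K' (supp (H (x, 1))) &
      forall (x : X) t, K' (supp x) -> H (x, t) = x].

Let W := wedge_copies m (sphere_base R 2).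
Let lift (j : 'I_m) : sphere R 2 -> W := @wedge_lift 'I_m (fun=> sphere R 2) _ j.
Let base : W := lift (Ordinal m0) (sphere_base R 2).

Let depth (j : 'I_m) (x : V -> R) : R := min3 (x (va j)) (x (vb j)) (x (vc j)).
Let tsph (j : 'I_m) (x : V -> R) : sphere R 2 := tri_sphere (x (va j)) (x (vb j)) (x (vc j)).
(** On points of [K'], [0 < depth j x] means lying in the interior of triangle [j], so at most one
    [j] can be picked; the points supported in [A] go to the base point. *)
Let crush (x : V -> R) : W :=
  if [pick j | 0 < depth j x] is Some j then lift j (tsph j x) else base.

Let lift_base j : lift j (sphere_base R 2) = base.
Proof. 
exact: (@wedge_liftE _ (fun=> sphere R 2) (fun=> sphere_base R 2) (Ordinal m0)
  (sphere_base R 2) j (sphere_base R 2)).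
Qed.

Let sum_tri (x : V -> R) j : \sum_(v <- tri j) x v = x (va j) + x (vb j) + x (vc j).
Proof.
have [ab ac bc] := tri_neq j.
rewrite big_fsetU1 /=; last by rewrite !inE negb_or ab.
by rewrite big_fsetU1 /= ?big_seq_fset1 ?addrA// inE.
Qed.

Let depth_supp (x : X) j : 0 < depth j x <-> (tri j `<=` supp x)%fset.
Proof.
have pos v : (0 < x v) = (v \in supp x).
  by rewrite in_supp// lt_def (real_ge0 allE) andbT.
by rewrite /depth min3_gt0 !pos !fsubUset !fsub1set.
Qed.

Let depth_ge0 (x : X) j : 0 <= depth j x.
Proof. by rewrite /depth /min3 !le_min !(real_ge0 allE). Qed.

Let depth_tri (x : X) j : K' (supp x) -> 0 < depth j x -> supp x = tri j.
Proof. by move=> K'x /depth_supp; exact: tri_facet. Qed.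

Let depth_sum1 (x : X) j : K' (supp x) -> 0 < depth j x ->
  x (va j) + x (vb j) + x (vc j) = 1.
Proof.
move=> K'x /(depth_tri K'x) xj; rewrite -sum_tri -(real_sum1 allE x).
by rewrite (sum_E allE (s := tri j))// xj.
Qed.

Let crush_tri (x : X) j : K' (supp x) -> 0 < depth j x -> crush x = lift j (tsph j x).
Proof.
move=> K'x xj; rewrite /crush; case: pickP => [i xi|/(_ j)]; last by rewrite xj.
suff -> : i = j by [].
by apply: tri_inj; rewrite -(depth_tri K'x xi) (depth_tri K'x xj).
Qed.

Let crush_base (x : X) : (forall j, ~~ (0 < depth j x)) -> crush x = base.
Proof. by move=> xj; rewrite /crush; case: pickP => // j; rewrite (negPf (xj j)). Qed.

Let crush_A (x : X) : supp x \in A -> crush x = base.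
Proof.
move=> xA; apply: crush_base => j; apply/negP => xj.
have := triA j; rewrite -(depth_tri _ xj) ?xA//.
by apply/K'E; left.
Qed.

Let crush_eq (x y : X) : K' (supp x) -> K' (supp y) -> crush x = crush y ->
  x = y \/ (supp x \in A /\ supp y \in A).
Proof.
have inA (z : X) : K' (supp z) -> supp z \in A \/ exists j, 0 < depth j z.
  move=> /K'E[|[j zj]]; first by left.
  by right; exists j; apply/depth_supp; rewrite zj fsubset_refl.
have nb (z : X) j : K' (supp z) -> 0 < depth j z -> tsph j z != sphere_base R 2.
  by move=> K'z zj; apply: tri_sphere_nbase => //; exact: depth_sum1.
move=> K'x K'y; case: (inA x K'x) => [xA|[i xi]]; case: (inA y K'y) => [yA|[j yj]].
- by right.
- rewrite (crush_A xA) (crush_tri K'y yj) => /wedge_lift_inj[[_ /esym/eqP]|[_ /eqP]];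
  by rewrite (negPf (nb _ _ K'y yj)).
- rewrite (crush_A yA) (crush_tri K'x xi) => /wedge_lift_inj[[_ /eqP]|[/eqP + _]];
  by rewrite (negPf (nb _ _ K'x xi)).
rewrite (crush_tri K'x xi) (crush_tri K'y yj) => /wedge_lift_inj[[ij]|[/eqP + _]]; last first.
  by rewrite (negPf (nb _ _ K'x xi)).
rewrite -{j}ij in yj * => e; left; apply: real_inj => v.
have [ha hb hc] := tri_sphere_inj (depth_sum1 K'x xi) (depth_sum1 K'y yj) xi yj e.
have [vi|vi] := boolP (v \in tri i).
  by move: vi; rewrite !inE => /or3P[]/eqP->.
have z0 (z : X) : K' (supp z) -> 0 < depth i z -> z v = 0.
  move=> K'z zi; apply/eqP; apply: contraNT vi; rewrite -(depth_tri K'z zi).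
  by rewrite in_supp.
by rewrite !z0.
Qed.

Let K'_compact : compact [set x : X | K' (supp x)].
Proof. exact: in_complex_compact. Qed.

Let point_of (x : V -> R) (s : {fset V}) : K' s -> (forall v, v \in s -> 0 < x v) ->
  (forall v, v \notin s -> x v = 0) -> \sum_(v <- s) x v = 1 ->
  exists2 y : X, supp y = s & forall v, y v = x v.
Proof.
move=> K's xs x0 x1.
have sE : supp x = s.
  apply/fsetP => v; rewrite in_supp//; have [vs|vs] := boolP (v \in s).
    by rewrite gt_eqF// xs.
  by rewrite x0 ?eqxx.
have x_ge0 v : 0 <= x v.
  by have [/xs/ltW//|/x0->] := boolP (v \in s).
have sumx : \sum_(v <- E) x v = 1 by rewrite (sum_E allE (s := s))// sE.
have Kx : K (supp x) by rewrite sE; exact: K'K.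
by exists (mk_real allE x_ge0 sumx Kx).
Qed.

Let crush_surj (w : W) : exists x : X, K' (supp x) /\ crush x = w.
Proof.
have : [set: W] w by [].
rewrite /W /wedge_copies -wedgeTE => -[j _ [y _ <-]].
have [->|yb] := eqVneq y (sphere_base R 2).
  have [||||x xs _] := @point_of (fun v => (v == v0)%:R) [fset v0]%fset.
  - by apply/K'E; left.
  - by move=> v; rewrite inE => /eqP ->; rewrite eqxx.
  - by move=> v; rewrite inE => /negPf ->.
  - by rewrite big_seq_fset1 eqxx.
  by exists x; rewrite crush_A ?xs//; split; [apply/K'E; left|rewrite -(lift_base j)].
have [a [b [c [abc m0' yE]]]] := tri_sphere_surj yb.
have [ab ac bc] := tri_neq j.
pose xf v := if v == va j then a else if v == vb j then b else if v == vc j then c else 0.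
have xa : xf (va j) = a by rewrite /xf eqxx.
have xb : xf (vb j) = b by rewrite /xf eq_sym (negPf ab) eqxx.
have xc : xf (vc j) = c by rewrite /xf eq_sym (negPf ac) eq_sym (negPf bc) eqxx.
have [||||x xs xE] := @point_of xf (tri j).
- by apply/K'E; right; exists j.
- move: m0'; rewrite min3_gt0 => /and3P[a0 b0 c0] v.
  by rewrite !inE => /or3P[]/eqP->; rewrite ?xa ?xb ?xc.
- by move=> v; rewrite !inE !negb_or /xf => /and3P[/negPf-> /negPf-> /negPf->].
- by rewrite sum_tri xa xb xc.
have K'x : K' (supp x) by rewrite xs; apply/K'E; right; exists j.
exists x; split=> //; rewrite (@crush_tri x j)//; last by rewrite /depth !xE xa xb xc.
by rewrite /tsph !xE xa xb xc yE.
Qed.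

(** One map retracts onto [K'] and crushes, the other lifts by [psi] and collapses. The latter is
    independent of [psi] because two lifts of the same point differ only within [A], on which the
    collapse is constant at time 1. Both homotopies are the retraction and the collapse run
    backwards. *)
Lemma wedge_of_spheres : homotopy_equivalent R X W.
Proof.
have AK' : [set` A] `<=` K' by move=> s sA; apply/K'E; left.
have [H1 [cH1 H10 H11 H1fix]] := retract.
have [H2 [cH2 H20 H21 H2pres]] :=
  collapse_deformation R allE Ksub Acol (subset_trans AK' K'K) Asub.
have H2A (x : X) t : supp x \in A -> supp (H2 (x, t)) \in A by exact: (H2pres [set` A]).
have H2K' (x : X) t : K' (supp x) -> K' (supp (H2 (x, t))) by exact: H2pres.
have H2pt (x y : X) : supp x \in A -> supp y \in A -> H2 (x, 1) = H2 (y, 1).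
  have at_v0 (z : X) : supp z \in A -> forall v, H2 (z, 1) v = (v == v0)%:R.
    move=> /H21; rewrite inE => /eqP zs v; have [->|vv0] := eqVneq v v0.
      have := real_sum1 allE (H2 (z, 1)).
      by rewrite (sum_E allE (s := [fset v0]%fset)) ?zs// big_seq_fset1.
    by apply/eqP; apply: contraNT vv0; rewrite -(in_supp allE) zs inE.
  by move=> xA yA; apply: real_inj => v; rewrite !at_v0.
pose f (x : X) : W := crush (H1 (x, 1)).
have fK' (x : X) : K' (supp x) -> f x = crush x by move=> K'x; rewrite /f H1fix.
have cH (H : X * R -> X) : continuous H -> continuous (fun x : X => H (x, 1)).
  move=> cHH x; apply: (@continuous_comp X (X * R)%type X (fun x => (x, 1 : R)) H); last exact: cHH.
  by apply: (@cvg_pair _ _ _ (nbhs x) (nbhs x) (nbhs (1 : R))); [exact: cvg_id|exact: cvg_cst].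
have cf : continuous f.
  have cr v : continuous (fun x : X => H1 (x, 1) v).
    move=> x; apply: (@continuous_comp X X R (fun x => H1 (x, 1)) (fun x => x v)).
      exact: (cH _ cH1).
    exact: coord_continuous.
  have cd j : continuous (fun x : X => depth j (H1 (x, 1))).
    by apply: continuous_min_fun => //; exact: continuous_min_fun.
  have ct j (x : X) : tri_den (H1 (x, 1) (va j)) (H1 (x, 1) (vb j)) (depth j (H1 (x, 1))) != 0 ->
      {for x, continuous (fun y : X => lift j (tsph j (H1 (y, 1))))}.
    move=> D0; apply: (@continuous_comp X (sphere R 2) W); last exact: wedge_lift_continuous.
    exact: (tri_sphere_continuous (cr (va j)) (cr (vb j)) (cr (vc j)) D0).
  have Dpos j (x : X) : 0 < depth j (H1 (x, 1)) ->
      tri_den (H1 (x, 1) (va j)) (H1 (x, 1) (vb j)) (depth j (H1 (x, 1))) != 0.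
    move=> dx; have := depth_sum1 (H11 x) dx => /tri_den_gt0 D0; exact: lt0r_neq0.
  move=> x; have [[j xj]|nj] := pselect (exists j, 0 < depth j (H1 (x, 1))).
    have near_j : \forall y \near x, 0 < depth j (H1 (y, 1)).
      apply: (cd j x [set z : R | 0 < z]); apply: open_nbhs_nbhs; split.
        exact: open_gt.
      exact: xj.
    rewrite /continuous_at [f x](crush_tri (H11 x) xj) => U nU.
    have nU' : \forall y \near x, U (lift j (tsph j (H1 (y, 1)))).
      exact: (ct j x (Dpos j x xj) U nU).
    have nf : \forall y \near x, f y = lift j (tsph j (H1 (y, 1))).
      by apply: filterS near_j => y yj; exact: crush_tri.
    by apply: filterS (filterI nf nU') => y [/= ->].
  have {}nj j : ~~ (0 < depth j (H1 (x, 1))) by apply/negP => xj; apply: nj; exists j.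
  rewrite /continuous_at [f x](crush_base nj) => U nU.
  have Uj j : nbhs (sphere_base R 2) (lift j @^-1` U).
    move: nU; rewrite /base /lift wedge_point_nbhs => /(_ j I); exact.
  (* If the three coordinates of triangle [j] sum to 1, the depth is 0 at [x] and [tri_sphere] is
     continuous there with value the base point. Otherwise the sum differs from 1 nearby, which
     excludes the interior of triangle [j]. *)
  have near_j j : \forall y \near x, 0 < depth j (H1 (y, 1)) -> U (lift j (tsph j (H1 (y, 1)))).
    pose sm (y : X) := H1 (y, 1) (va j) + H1 (y, 1) (vb j) + H1 (y, 1) (vc j).
    have csm : continuous sm by do 2!apply: continuousD_fun => //.
    have [s1|s1] := eqVneq (sm x) 1.
      have d0 : depth j (H1 (x, 1)) = 0.
        by apply/eqP; rewrite eq_le depth_ge0 andbT leNgt.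
      have D0 := tri_den_gt0 s1.
      have e : lift j (tsph j (H1 (x, 1))) = base.
        by rewrite /tsph (tri_sphere_base s1 d0) lift_base.
      have nU' : nbhs (lift j (tsph j (H1 (x, 1)))) U by rewrite e.
      have h : \forall y \near x, U (lift j (tsph j (H1 (y, 1)))).
        exact: (ct j x (lt0r_neq0 D0) U nU').
      by apply: filterS h => y Uy _.
    have ns : \forall y \near x, sm y != 1.
      apply: (csm x [set z : R | z != 1]); apply: open_nbhs_nbhs; split.
        exact: open_neq.
      exact: s1.
    near=> y => dy; have sy : sm y != 1 by near: y.
    by move: sy; rewrite /sm (depth_sum1 (H11 y) dy) eqxx.
  have near_all : \forall y \near x, forall j,
      0 < depth j (H1 (y, 1)) -> U (lift j (tsph j (H1 (y, 1)))).
    refine (@filter_forall X 'I_m (fun j y => 0 < depth j (H1 (y, 1)) ->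
      U (lift j (tsph j (H1 (y, 1))))) (nbhs x) (nbhs_filter x) _) => j; exact: near_j.
  suff nf : \forall y \near x, U (f y) by exact: nf.
  apply: filterS near_all => y yj; rewrite /f /crush.
  by case: pickP => [j /yj//|_]; exact: nbhs_singleton.
have /choice[psi psiP] := crush_surj.
pose g (w : W) : X := H2 (psi w, 1).
have psi_crush (x : X) : K' (supp x) ->
    psi (crush x) = x \/ (supp (psi (crush x)) \in A /\ supp x \in A).
  by move=> K'x; have [K'p pE] := psiP (crush x); exact: crush_eq.
have gE (x : X) : K' (supp x) -> g (crush x) = H2 (x, 1).
  by move=> K'x; rewrite /g; have [->|[? ?]] := psi_crush _ K'x; [|exact: H2pt].
have hW : hausdorff_space W.
  by apply: wedge_hausdorff => i; exact: sphere_hausdorff.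
have cHr (H : X * R -> X) : continuous H -> continuous (fun z : X * R => H (z.1, 1 - z.2)).
  move=> cHH z; apply: (@continuous_comp _ _ _ (fun z : X * R => (z.1, 1 - z.2)) H).
    apply: (@cvg_pair _ _ _ (nbhs z) (nbhs z.1) (nbhs (1 - z.2))); first exact: cvg_fst.
    by apply: cvgB; [exact: cvg_cst|exact: cvg_snd].
  exact: cHH.
exists f, g; split=> //.
- have fD : f @` [set x : X | K' (supp x)] = setT.
    rewrite -subTset => w _; have [K'p pE] := psiP w.
    by exists (psi w) => //; rewrite fK'.
  have : {within f @` [set x : X | K' (supp x)], continuous g}.
    apply: (compact_quotient_continuous hW K'_compact cf (cH _ cH2)) => x K'x.
    by rewrite fK'// gE.
  by rewrite fD continuous_subspace_setT.
- exists (fun z => H2 (H1 (z.1, 1 - z.2), 1 - z.2)); split.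
  + apply: continuous_subspaceT => z.
    apply: (@continuous_comp _ _ _ (fun z : X * R => (H1 (z.1, 1 - z.2), 1 - z.2)) H2).
      apply: (@cvg_pair _ _ _ (nbhs z) (nbhs (H1 (z.1, 1 - z.2))) (nbhs (1 - z.2))).
        exact: (cHr _ cH1).
      by apply: cvgB; [exact: cvg_cst|exact: cvg_snd].
    exact: cH2.
  + by move=> x /=; rewrite subr0 -gE.
  + by move=> x /=; rewrite subrr H10 H20.
- exists (fun z => f (H2 (psi z.1, 1 - z.2))); split.
  + pose D : set (X * R) := [set x : X | K' (supp x)] `*` `[0 : R, 1 : R]%classic.
    have -> : [set: W] `*` `[0 : R, 1 : R]%classic = (fun z : X * R => (f z.1, z.2)) @` D.
      apply/seteqP; split=> [[w t] [_ /= t01]|_ [[x t] [/= K'x t01] <-]]; last by [].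
      have [K'p pE] := psiP w; exists (psi w, t) => //=; by rewrite fK'// pE.
    apply: (@compact_quotient_continuous _ _ _ D (fun z : X * R => (f z.1, z.2))
      (fun z : X * R => f (H2 (z.1, 1 - z.2)))).
    * by apply: prod_hausdorff => //; exact: Rhausdorff.
    * by apply: compact_setX => //; exact: segment_compact.
    * move=> z; apply: (@cvg_pair _ _ _ (nbhs z) (nbhs (f z.1)) (nbhs z.2)); last exact: cvg_snd.
      by apply: (@continuous_comp _ _ _ fst f); [exact: cvg_fst|exact: cf].
    * by move=> z; apply: (@continuous_comp _ _ _ (fun z : X * R => H2 (z.1, 1 - z.2)) f);
        [exact: (cHr _ cH2)|exact: cf].
    (* The lift [psi (crush x)] is [x] unless both lie in [A], which the collapse preserves and [f]
       sends to the base point. *)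
    * move=> [x t] [/= K'x _]; rewrite (fK' x K'x).
      have [->//|[pA xA]] := psi_crush _ K'x.
      have fA (z : X) : supp z \in A -> f z = base.
        by move=> zA; rewrite fK' ?crush_A//; exact: AK'.
      by rewrite !fA//; exact: H2A.
  + by move=> w; rewrite /= subr0.
  + by move=> w; rewrite /= subrr H20; have [K'p pE] := psiP w; rewrite fK'.
Unshelve. all: by end_near. Qed.

End WedgeOfSpheres.

(** * Saturated cosets and their identification with flats *)

Section Saturated.
Context (r : nat).
Local Notation G := (burnside r 3).
Local Notation U := 'rV['F_3]_r.
Local Notation C := (coset_poset (nilpotent_subgroups G 2)).
Implicit Types (F : {set U}) (v w : C).

Lemma origin_coset : abel_preimage [set 0%R : U]%SET \in
  is_coset_of (nilpotent_subgroups G 2).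
Proof. by rewrite inE; apply: flat_coset; rewrite ?flat1 ?cards1. Qed.

Definition flat_vertex F : C :=
  insubd (SigSub origin_coset : C) (abel_preimage F).

Lemma val_flat_vertex F : flat F -> (#|F| <= 9)%N ->
  val (flat_vertex F) = abel_preimage F.
Proof. by move=> fF F9; rewrite insubdK// inE; exact: flat_coset. Qed.

Definition vertex_flat v : {set U} := abel_image (val v).

Lemma vertex_flatP v : flat (vertex_flat v) /\ (#|vertex_flat v| <= 9)%N.
Proof. by apply: coset_image; have := valP v; rewrite inE. Qed.

Lemma flat_vertexK F : flat F -> (#|F| <= 9)%N -> vertex_flat (flat_vertex F) = F.
Proof. by move=> fF F9; rewrite /vertex_flat val_flat_vertex// abel_imageK. Qed.

Lemma flat_vertex_inj F F' : flat F -> flat F' -> (#|F| <= 9)%N -> (#|F'| <= 9)%N ->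
  flat_vertex F = flat_vertex F' -> F = F'.
Proof.
move=> fF fF' F9 F9' e.
by rewrite -(flat_vertexK fF F9) e flat_vertexK.
Qed.

Definition saturate v : C := flat_vertex (vertex_flat v).

Lemma flat_saturate v : vertex_flat (saturate v) = vertex_flat v.
Proof. by have [h1 h2] := vertex_flatP v; rewrite flat_vertexK. Qed.

Lemma saturate_idem v : saturate (saturate v) = saturate v.
Proof. by rewrite {1}/saturate flat_saturate. Qed.

Lemma saturate_flat_vertex F : flat F -> (#|F| <= 9)%N ->
  saturate (flat_vertex F) = flat_vertex F.
Proof. by move=> fF F9; rewrite /saturate flat_vertexK. Qed.

Lemma vertex_flat_le v w : (v <= w)%O -> vertex_flat v \subset vertex_flat w.
Proof.
rewrite coset_poset_le => /asboolP vw; apply/fintype.subsetP => u /abel_imageP[g vg gu].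
by apply/abel_imageP; exists g => //; exact: vw.
Qed.

Lemma flat_vertex_le F F' : flat F -> flat F' -> (#|F| <= 9)%N -> (#|F'| <= 9)%N ->
  F \subset F' -> (flat_vertex F <= flat_vertex F')%O.
Proof.
move=> fF fF' F9 F9' /fintype.subsetP FF'; rewrite coset_poset_le; apply/asboolP.
by rewrite !val_flat_vertex// => g; exact: FF'.
Qed.

Lemma saturate_ge v : (v <= saturate v)%O.
Proof.
have [h1 h2] := vertex_flatP v; rewrite coset_poset_le; apply/asboolP.
by rewrite val_flat_vertex// => g vg; apply/abel_imageP; exists g.
Qed.

Lemma saturate_homo v w : (v <= w)%O -> (saturate v <= saturate w)%O.
Proof.
have [h1 h2] := vertex_flatP v; have [h3 h4] := vertex_flatP w.
by move=> /vertex_flat_le; exact: flat_vertex_le.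
Qed.

Local Notation K := (order_complex C).
Local Notation sim := (sim flat_vertex).

Definition saturated_complex : set {fset C} :=
  [set s | K s /\ forall v, v \in s -> saturate v = v].
Local Notation K' := saturated_complex.

Lemma saturated_sub : subcomplex K'.
Proof.
move=> s t [Ks ss] t0 ts; split; first exact: order_complex_sub Ks t0 ts.
by move=> v /(fsubsetP ts)/ss.
Qed.

Lemma sim_saturated c : valid c -> K' (sim c).
Proof.
move=> vc; have small v : v \in sim c -> exists F, [/\ flat F, (#|F| <= 9)%N & v = flat_vertex F].
  move=> /in_sim[[q _ ->]|[l cl ->]|[P cP ->]].
  - by exists [set q]%SET; rewrite flat1 cards1.
  - by exists l; have [] := line_small (valid_line vc cl).
  - by exists P; have [] := plane_small (valid_plane vc cP).
split; last by move=> v /small[F [fF F9 ->]]; exact: saturate_flat_vertex.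
split; first exact: sim_neq0.
have q1 (q : U) : flat [set q]%SET /\ (#|[set q]%SET| <= 9)%N by rewrite flat1 cards1.
have cmp F F' : flat F /\ (#|F| <= 9)%N -> flat F' /\ (#|F'| <= 9)%N -> F \subset F' ->
    (flat_vertex F >=< flat_vertex F')%O /\ (flat_vertex F' >=< flat_vertex F)%O.
  move=> [fF F9] [fF' F9'] FF'; have h := flat_vertex_le fF fF' F9 F9' FF'.
  by rewrite /Order.comparable h orbT.
move: vc; case: c small => -[oq ol] oP small vc u v.
move=> /in_sim[[q /= qE ->]|[l /= lE ->]|[P /= PE ->]]
  /in_sim[[q' /= q'E ->]|[l' /= l'E ->]|[P' /= P'E ->]]; subst.
- by case: q'E => ->; exact: comparablexx.
- have [] := cmp [set q]%SET l' (q1 q) (line_small (valid_fl vc)) => //.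
  by rewrite finset.sub1set (valid_fql vc).
- have [] := cmp [set q]%SET P' (q1 q) (plane_small (valid_fp vc)) => //.
  by rewrite finset.sub1set (valid_fqp vc).
- have [] := cmp [set q']%SET l (q1 q') (line_small (valid_fl vc)) => //.
  by rewrite finset.sub1set (valid_fql vc).
- by case: l'E => ->; exact: comparablexx.
- have [] := cmp l P' (line_small (valid_fl vc)) (plane_small (valid_fp vc)) => //.
  exact: valid_flp vc.
- have [] := cmp [set q']%SET P (q1 q') (plane_small (valid_fp vc)) => //.
  by rewrite finset.sub1set (valid_fqp vc).
- have [] := cmp l' P (line_small (valid_fl vc)) (plane_small (valid_fp vc)) => //.
  exact: valid_flp vc.
- by case: P'E => ->; exact: comparablexx.
Qed.

(** The flats of a saturated chain have 1, 3 or 9 points, and comparable flats of the same size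
    coincide. The chain thus holds at most one point, one line and one plane, which [pick]
    recovers. *)
Lemma saturated_sim s : K' s -> exists2 c, valid c & s = sim c.
Proof.
move=> [[s0 sc] ss].
have sE v : v \in s -> v = flat_vertex (vertex_flat v) by move=> /ss.
have sub F F' : flat_vertex F \in s -> flat_vertex F' \in s -> flat F -> flat F' ->
    (#|F| <= #|F'|)%N -> (#|F'| <= 9)%N -> F \subset F'.
  move=> sF sF' fF fF' FF' F9'; have F9 := leq_trans FF' F9'.
  have /orP[/vertex_flat_le|/vertex_flat_le] := sc _ _ sF sF'; rewrite !flat_vertexK// => h.
  by have /eqP -> : F' == F by rewrite eqEcard h.
pose c : flag r := ([pick q | flat_vertex [set q]%SET \in s],
  [pick l | is_line l & flat_vertex l \in s], [pick P | is_plane P & flat_vertex P \in s]).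
have cq q : c.1.1 = Some q -> flat_vertex [set q]%SET \in s.
  by rewrite /c /=; case: pickP => // q' ? [<-].
have cl l : c.1.2 = Some l -> is_line l /\ flat_vertex l \in s.
  by rewrite /c /=; case: pickP => // l' /andP[? ?] [<-].
have cP P : c.2 = Some P -> is_plane P /\ flat_vertex P \in s.
  by rewrite /c /=; case: pickP => // l' /andP[? ?] [<-].
have incl : s = sim c.
  apply/fsetP => v; apply/idP/idP; last first.
    by move=> /in_sim[[q /cq ? ->]|[l /cl[_ ?] ->]|[P /cP[_ ?] ->]].
  move=> sv; have [fF F9] := vertex_flatP v; have vE := sE v sv.
  rewrite vE in sv *; move: (vertex_flat v) fF F9 sv {vE} => F fF F9 sv; apply/in_sim.
  have eqF F' : flat_vertex F' \in s -> flat F' -> #|F'| = #|F| -> F' = F.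
    move=> sF' fF' e; apply/eqP; rewrite eqEcard e leqnn andbT.
    by apply: sub => //; rewrite e.
  case: (flat_card fF F9) => Fn.
  - move/eqP: Fn => /cards1P[q qF]; constructor 1; rewrite /c /=; case: pickP => [q' sq'|/(_ q)].
      exists q' => //; rewrite -(eqF [set q']%SET)// ?flat1//.
      by rewrite qF !cards1.
    by rewrite -qF sv.
  - constructor 2; rewrite /c /=; case: pickP => [l /andP[/andP[fl /eqP l3] sl]|/(_ F)].
      by exists l => //; rewrite (eqF l)// l3 Fn.
    by rewrite /is_line fF Fn sv.
  - constructor 3; rewrite /c /=; case: pickP => [l /andP[/andP[fl /eqP l3] sl]|/(_ F)].
      by exists l => //; rewrite (eqF l)// l3 Fn.
    by rewrite /is_plane fF Fn sv.
exists c => //; move: cq cl cP incl; case: c => -[oq ol] oP /= cq cl cP incl.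
apply/and5P; split=> /=.
- apply: contra_neq s0 => cE; rewrite incl cE.
  by apply/fsetP => v; rewrite in_simE.
- by case: ol cl {incl} => [l|] //= /(_ l erefl)[].
- by case: oP cP {incl} => [l|] //= /(_ l erefl)[].
- case: oq cq {incl} => // q /(_ q erefl) sq; case: ol cl => // l /(_ l erefl)[/andP[fl /eqP l3] sl].
  by rewrite -finset.sub1set; apply: sub => //; rewrite ?flat1 ?cards1 ?l3.
apply/andP; split.
- case: oq cq {incl} => // q /(_ q erefl) sq; case: oP cP => [P|]; last by case: (ol).
  move=> /(_ P erefl)[/andP[fl /eqP l3] sl].
  by case: (ol) => [l|]; rewrite -finset.sub1set; apply: sub => //; rewrite ?flat1 ?cards1 ?l3.
- case: ol cl {incl} => [l|]; last by case: (oq).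
  move=> /(_ l erefl)[/andP[fl /eqP l3] sl]; case: oP cP => [P|]; last by case: (oq).
  move=> /(_ P erefl)[/andP[fP /eqP P9] sP].
  by case: (oq) => [q|]; apply: sub => //; rewrite ?l3 P9.
Qed.

End Saturated.

(** * The number of spheres and the conclusion *)

Lemma num_spheresE r n : (3 <= r)%N ->
  (27 * n = (3 ^ r - 1) * (3 ^ r - 3) * (3 ^ r - 9))%N -> n = num_spheres r /\ (0 < n)%N.
Proof.
move=> r3; have [k rE] : exists k, r = (k + 3)%N by exists (r - 3)%N; rewrite subnK.
rewrite rE /num_spheres addnK (_ : 9 ^ (k + 3) = (3 ^ (k + 3)) ^ 2)%N; last first.
  by rewrite -expnM mulnC expnM.
rewrite expnD; have : (0 < 3 ^ k)%N by rewrite expn_gt0.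
move: (3 ^ k)%N => m m0; rewrite -[(3 ^ 3)%N]/27%N.
(* With [3 ^ r = 27 * m], the three factors are [27 m - 1], [3 (9 m - 1)] and [9 (3 m - 1)]; writing
   [m = p.+1] removes the truncated subtractions from them. *)
have [p ->] : exists p, m = p.+1 by exists m.-1; rewrite prednK.
have -> : (p.+1 * 27 - 1 = 27 * p + 26)%N by lia.
have -> : (p.+1 * 27 - 3 = 3 * (9 * p + 8))%N by lia.
have -> : (p.+1 * 27 - 9 = 9 * (3 * p + 2))%N by lia.
have -> : ((p.+1 * 27) ^ 2 - 13 * (p.+1 * 27) = (27 * p + 27) * (27 * p + 14))%N.
  by rewrite expnS expn1; nia.
move=> h; have -> : n = ((27 * p + 26) * (9 * p + 8) * (3 * p + 2))%N by nia.
split; last by rewrite !muln_gt0 !addn_gt0 !orbT.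
by nia.
Qed.

Theorem theorem4p6 (R : realType) (r : nat) (hr : (3 <= r)%N) :
  homotopy_equivalent R
    (realization R
       (order_complex (coset_poset (nilpotent_subgroups (burnside r 3) 2))))
    (wedge_copies (num_spheres r) (sphere_base R 2)).
Proof.
have [E allE] := coset_poset_finite r.
pose cr := critical (@pt r) (@pt r).
have cardc : (27 * #|cr| = (3 ^ r - 1) * (3 ^ r - 3) * (3 ^ r - 9))%N.
  by apply: critical_card27 => [P|l /ptP//]; rewrite inE => /and3P[/ptP].
have [mE m0] := num_spheresE hr cardc; rewrite -mE.
pose fv := @flat_vertex r; have fv_inj := @flat_vertex_inj r.
pose tr (j : 'I_#|cr|) := enum_val j.
pose fl j : flag r := (Some (tr j).1.1, Some (tr j).1.2, Some (tr j).2).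
have flP j : valid (fl j) /\ crit (fl j).
  have := enum_valP j; rewrite -/(tr j) !inE => /and5P[/and3P[fP P9 P0] fl_ l3 lP].
  move=> /and3P[pl ql qc]; rewrite /valid /crit /= /is_line /is_plane fP P9 fl_ l3 lP ql.
  by rewrite (fintype.subsetP lP _ ql) P0 pl qc.
have critP c : valid c -> crit c -> exists j, c = fl j.
  case: c => -[[q|] [l|]] [P|] // vc /and3P[P0 pl ql].
  have trc : (q, l, P) \in cr.
    have /andP[fl_ l3] := valid_fl vc; have /andP[fP P9] := valid_fp vc.
    by rewrite !inE /= fP P9 P0 fl_ l3 (valid_flp vc) pl (valid_fql vc) ql.
  by exists (enum_rank_in trc (q, l, P)); rewrite /fl /tr enum_rankK_in.
pose va j := fv [set (tr j).1.1]%SET.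
pose vb j := fv (tr j).1.2.
pose vc j := fv (tr j).2.
have triE j : (va j |` (vb j |` [fset vc j]))%fset = sim fv (fl j).
  by apply/fsetP => v; rewrite in_simE !inE.
pose A := [fset sim fv c | c in flags0 r]%fset.
have AP s : s \in A <-> exists c, [/\ valid c, ~~ crit c & s = sim fv c].
  split=> [/imfsetP[c /=]|[c [c1 c2 ->]]]; last by apply: in_imfset; rewrite /= inE c1.
  by rewrite inE => /andP[c1 c2] ->; exists c.
pose K' := @saturated_complex r.
have K'E s : K' s <-> s \in A \/ exists j, s = (va j |` (vb j |` [fset vc j]))%fset.
  split=> [/saturated_sim[c c1 ->]|[/AP[c [c1 _ ->]]|[j ->]]].
  - case: (boolP (crit c)) => c2; last by left; apply/AP; exists c.
    by have [j ->] := critP c c1 c2; right; exists j; rewrite triE.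
  - exact: sim_saturated.
  - by rewrite triE; apply: sim_saturated; have [] := flP j.
(* A critical flag already has a point, a line and a plane, so no larger saturated chain contains
   it. *)
have facet s j : K' s -> ((va j |` (vb j |` [fset vc j])) `<=` s)%fset ->
    s = (va j |` (vb j |` [fset vc j]))%fset.
  rewrite triE => /saturated_sim[c c1 ->] sub; congr (sim _ _).
  have [v1 _] := flP j; have [h1 h2 h3] := sim_sub fv_inj v1 c1 sub.
  move: (h1 _ erefl) (h2 _ erefl) (h3 _ erefl); rewrite /fl.
  by case: c {c1 sub h1 h2 h3} => -[oq ol] oP /= -> -> ->.
have triA j : (va j |` (vb j |` [fset vc j]))%fset \notin A.
  rewrite triE; apply/negP => /AP[c [c1 c2 /(sim_inj fv_inj) e]].
  have [v1 cr1] := flP j; by move: c2; rewrite -e ?cr1.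
apply: (@wedge_of_spheres R _ _ E allE _ K' A (fv [set 0%R]%SET) #|cr| va vb vc) => //.
- exact: order_complex_sub.
- by move=> s [].
- exact: saturated_sub.
(* A face of a simplex of [A] cannot be a critical triangle, since such a triangle is a facet and
   would be the simplex itself. *)
- move=> s t sA t0 ts; have K's : K' s by apply/K'E; left.
  have /K'E[//|[j tE]] := saturated_sub K's t0 ts.
  by exfalso; have := triA j; rewrite -(facet s j K's) ?sA// -tE.
- move=> i j; rewrite !triE => /(sim_inj fv_inj (flP i).1 (flP j).1) e.
  apply: enum_val_inj; move: e; rewrite /fl /tr.
  by case: (enum_val i) => -[q l] P; case: (enum_val j) => -[q' l'] P' /= [-> -> ->].
- move=> j; have [v1 _] := flP j.
  rewrite /va /vb /vc (vt_ql fv_inj _ (valid_fl v1)) (vt_qp fv_inj _ (valid_fp v1)).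
  by rewrite (vt_lp fv_inj (valid_fl v1) (valid_fp v1)).
- apply/AP; exists (origin_flag r); split=> //.
  by apply/fsetP => v; rewrite in_simE !inE.
- have -> : [fset [fset fv [set 0%R]%SET]]%fset = [fset sim fv (origin_flag r)]%fset.
    by congr [fset _]%fset; apply/fsetP => v; rewrite in_simE !inE.
  exact: ranked_collapse (flags_matching fv_inj).
(* Saturation is a closure operator whose fixed cosets span [K'], so its deformation is the required
   retraction. *)
have [H [cH H0 H1 Hfix]] := closure_deformation R allE (@saturate_ge r)
  (@saturate_homo r) (@saturate_idem r).
exists H; split=> // [x|x t [_ sx]]; last exact: Hfix.
split; last exact: H1.
exact: (real_supp allE (@order_complex_sub _ _)).
Qed.
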